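(* Let $\varsigma\in M^1(\mathbb{Z}^n\times\mathbb{T}^n)$ and let $g\in M^1(\mathbb{Z}^n)$ be non-zero. Then the localization operator $\mathfrak{L}^{g,g}_\varsigma$ is in $S_1$ and $$\frac{1}{\|g\|^2_{M^1(\mathbb{Z}^n)}}\,\|\tilde\varsigma\|_{L^1(\mathbb{Z}^n\times\mathbb{T}^n)}\le\|\mathfrak{L}^{g,g}_\varsigma\|_{S_1}\le\|g\|^2_{M^1(\mathbb{Z}^n)}\,\|\varsigma\|_{M^1(\mathbb{Z}^n\times\mathbb{T}^n)},$$ where $\tilde\varsigma(m,w)=\langle\mathfrak{L}^{g,g}_\varsigma(M_wT_mg),M_wT_mg\rangle_{\ell^2(\mathbb{Z}^n)}$ for $(m,w)\in\mathbb{Z}^n\times\mathbb{T}^n$.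
   Context: $\mathbb{T}^n$ is the torus with normalized Haar measure $dw$; $\mathbb{Z}^n\times\mathbb{T}^n$ carries the product of counting measure and $dw$. $T_mf(k)=f(k-m)$, $M_wf(k)=e^{2\pi i w\cdot k}f(k)$, and the short-time Fourier transform is $V_gf(m,w)=\langle f,M_wT_mg\rangle=\sum_{k\in\mathbb{Z}^n}f(k)\overline{g(k-m)}e^{-2\pi i w\cdot k}$. $\mathcal{S}(\mathbb{Z}^n)$ is the space of rapidly decreasing functions on $\mathbb{Z}^n$, $\mathcal{S}'(\mathbb{Z}^n)$ its dual (tempered distributions); $\mathcal{S}(\mathbb{Z}^n\times\mathbb{T}^n)$ and $\mathcal{S}'(\mathbb{Z}^n\times\mathbb{T}^n)$ are the Schwartz functions and tempered distributions on the group $\mathbb{Z}^n\times\mathbb{T}^n$. Modulation spaces: fix a non-zero window $\phi\in\mathcal{S}(\mathbb{Z}^n)$; for $1\le p\le\infty$, $M^p(\mathbb{Z}^n)=\{f\in\mathcal{S}'(\mathbb{Z}^n): V_\phi f\in L^p(\mathbb{Z}^n\times\mathbb{T}^n)\}$ with $\|f\|_{M^p(\mathbb{Z}^n)}=\|V_\phi f\|_{L^p}$. Similarly, fix a non-zero $\Phi\in\mathcal{S}(\mathbb{Z}^n\times\mathbb{T}^n)$ and set $$V_\Phi F(m,\omega,\xi,k)=\sum_{j\in\mathbb{Z}^n}\int_{\mathbb{T}^n}e^{-2\pi i j\xi}e^{-2\pi i\eta k}F(j,\eta)\overline{\Phi(j-m,\eta-\omega)}\,d\eta,\quad m,k\in\mathbb{Z}^n,\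 \omega,\xi\in\mathbb{T}^n;$$ $M^p(\mathbb{Z}^n\times\mathbb{T}^n)$ is the space of $F\in\mathcal{S}'(\mathbb{Z}^n\times\mathbb{T}^n)$ with $\|F\|_{M^p(\mathbb{Z}^n\times\mathbb{T}^n)}=\|V_\Phi F\|_{L^p((\mathbb{Z}^n\times\mathbb{T}^n)\times(\mathbb{T}^n\times\mathbb{Z}^n))}<\infty$. Different windows give equivalent norms. Localization operator: for windows $g_1,g_2$ and symbol $\varsigma$, $\mathfrak{L}^{g_1,g_2}_\varsigma$ is defined in the weak sense by $$\langle\mathfrak{L}^{g_1,g_2}_\varsigma f,h\rangle_{\ell^2(\mathbb{Z}^n)}=\sum_{m\in\mathbb{Z}^n}\int_{\mathbb{T}^n}\varsigma(m,w)\,V_{g_1}f(m,w)\,\overline{V_{g_2}h(m,w)}\,dw,\qquad f,h\in\ell^2(\mathbb{Z}^n).$$ $S_1$ is the trace class on $\ell^2(\mathbb{Z}^n)$: compact operators whose singular values $s_n$ (eigenvalues of $|\mathcal{A}|=\sqrt{\mathcal{A}^*\mathcal{A}}$) are summable, with $\|\mathcal{A}\|_{S_1}=\sum_n s_n(\mathcal{A})$.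
   Formalization: With constant 1 for arbitrary windows the estimate is false (rescale φ or Φ). Proved instead: for all non-zero windows it holds with ‖g‖² replaced by c‖g‖² on both sides, c>0 depending only on the windows, and c=1 whenever ‖φ‖₂≥1 and ‖Φ‖_∞≥1. *)

(* Defs.v *)
(* Library: MathComp, MathComp-Analysis, and R[i] from real-closed. *)
From HB Require Import structures.
From mathcomp Require Import all_boot all_order all_algebra.
From mathcomp Require Import all_classical all_reals all_analysis.
From mathcomp Require Import complex.

Set Implicit Arguments.
Unset Strict Implicit.
Unset Printing Implicit Defensive.

Import Order.TTheory GRing.Theory Num.Theory.
Import numFieldNormedType.Exports.

Local Open Scope classical_set_scope.
Local Open Scope ring_scope.

Notation Zn n := 'rV[int]_n.
(* Points of T^n = R^n / Z^n are given by representatives in R^n; functions on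
   T^n that are evaluated pointwise are 1-periodic functions on R^n. *)
Notation Tn R n := (n.-tuple R).

HB.instance Definition _ := isPointed.Build int 0.
HB.instance Definition _ (n : nat) :=
  @isMeasurable.Build default_measure_display (Zn n)
    discrete_measurable discrete_measurable0
    discrete_measurableC discrete_measurableU.

Definition muZ (R : realType) (n : nat) : set (Zn n) -> \bar R := counting.

HB.instance Definition _ (R : realType) (n : nat) := Measure.on (@muZ R n).

Lemma sigma_finite_muZ (R : realType) (n : nat) :
  sigma_finite [set: Zn n] (@muZ R n).
Proof.
exists (fun i => [set k : Zn n | (pickle k <= i)%N]).
  by apply/seteqP; split=> // k _; exists (pickle k) => /=.
move=> i; split => //; rewrite /muZ /counting asboolT ?ltry//.
rewrite (_ : [set k : Zn n | _] = @pickle (Zn n) @^-1` `I_i.+1) //.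
apply: finite_preimage; last exact: finite_II.
by move=> x y _ _; exact: (pcan_inj (@pickleK _)).
Qed.

HB.instance Definition _ (R : realType) (n : nat) :=
  @Measure_isSigmaFinite.Build _ _ _ (@muZ R n) (sigma_finite_muZ R n).

Definition consT (R : realType) (n : nat) (x : measurableTypeR R * Tn R n) :
  Tn R n.+1 := [tuple of x.1 :: x.2].

Lemma measurable_consT (R : realType) (n : nat) :
  measurable_fun [set: measurableTypeR R * Tn R n] (@consT R n).
Proof. exact: (@measurable_cons _ _ _ R fst n snd). Qed.

HB.instance Definition _ (R : realType) (n : nat) :=
  @isMeasurableFun.Build _ _ _ _ (@consT R n) (@measurable_consT R n).

(* Normalized Haar measure of T^n: the n-fold product of the uniform
   probability on [0, 1], carried by the fundamental domain [0, 1]^n. *)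
Fixpoint haar (R : realType) (n : nat) : probability (Tn R n) R :=
  match n with
  | 0 => \d_ [tuple]
  | m.+1 => distribution (uniform_prob (@ltr01 R) \x haar R m)%E (@consT R m)
  end.

Definition muZT (R : realType) (n : nat) : set (Zn n * Tn R n) -> \bar R :=
  (@muZ R n \x haar R n)%E.

HB.instance Definition _ (R : realType) (n : nat) := Measure.on (@muZT R n).

Definition muTZ (R : realType) (n : nat) : set (Tn R n * Zn n) -> \bar R :=
  (haar R n \x @muZ R n)%E.

HB.instance Definition _ (R : realType) (n : nat) := Measure.on (@muTZ R n).

Lemma sigma_finite_muTZ (R : realType) (n : nat) :
  sigma_finite [set: Tn R n * Zn n] (@muTZ R n).
Proof.
have /sigma_finiteP[F [TF ndF Foo]] := sigma_finiteT (@muZ R n).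
exists (fun i => [set: Tn R n] `*` F i).
  apply/seteqP; split=> [[w k] _|//].
  by have [i _ Fik] : (\bigcup_i F i) k by [rewrite -TF]; exists i.
move=> i; have [mF Fi] := Foo i; split; first exact: measurableX.
rewrite /muTZ product_measure1E//.
by rewrite lte_mul_pinfty// ?probability_setT// fin_num_measure.
Qed.

HB.instance Definition _ (R : realType) (n : nat) :=
  @Measure_isSigmaFinite.Build _ _ _ (@muTZ R n) (sigma_finite_muTZ R n).

Definition muZTTZ (R : realType) (n : nat) :
  set ((Zn n * Tn R n) * (Tn R n * Zn n)) -> \bar R :=
  (@muZT R n \x @muTZ R n)%E.

HB.instance Definition _ (R : realType) (n : nat) := Measure.on (@muZTTZ R n).

Section Lebesgue.
Context d (T : measurableType d) (R : realType).
Variable mu : {measure set T -> \bar R}.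
Implicit Types f : T -> R[i].

Definition cmod (z : R[i]) : R := ComplexField.Normc.normc z.

Definition cmeasurable f :=
  measurable_fun [set: T] (fun x => complex.Re (f x)) /\
  measurable_fun [set: T] (fun x => complex.Im (f x)).

Definition cintegrable f :=
  mu.-integrable [set: T] (fun x => (complex.Re (f x))%:E) /\
  mu.-integrable [set: T] (fun x => (complex.Im (f x))%:E).

Definition cint f : R[i] :=
  ((\int[mu]_x complex.Re (f x)) +i* (\int[mu]_x complex.Im (f x)))%C.

Definition lpnorm (p : \bar R) f : \bar R := Lnorm mu p (fun x => (cmod (f x))%:E).

Definition inLp (p : \bar R) f := cmeasurable f /\ (lpnorm p f < +oo)%E.

(* The linear functional u on the space S of test functions is given by
   integration against the function f. *)
Definition represents (S : set (T -> R[i])) (u : (T -> R[i]) -> R[i]) f :=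
  cmeasurable f /\
  forall psi, S psi ->
    cintegrable (fun x => f x * psi x) /\ u psi = cint (fun x => f x * psi x).

End Lebesgue.

Section TimeFrequency.
Variables (R : realType) (n : nat).
Local Notation C := R[i].
Local Notation Z := (Zn n).
Local Notation mZ := (@muZ R n).
Local Notation T := (Tn R n).
Implicit Types (k m l j : Z) (w eta omega xi : T) (f g h phi : Z -> C).

Definition subT eta omega : T := [tuple tnth eta i - tnth omega i | i < n].
Definition translT w l : T := [tuple tnth w i + (l 0 i)%:~R | i < n].
Definition dotT w k : R := \sum_(i < n) tnth w i * (k 0 i)%:~R.

Definition expi (x : R) : C := (cos (2 * pi * x) +i* sin (2 * pi * x))%C.

Definition conjf (X : Type) (f : X -> C) : X -> C := fun x => (f x)^*.

Definition dotl2 f h : C := cint mZ (fun k => f k * (h k)^*).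
Definition l2 f := inLp mZ 2%:E f.

(* M_w T_m g *)
Definition tfshift m w g : Z -> C := fun k => expi (dotT w k) * g (k - m).

Definition stft g f : Z * T -> C := fun x => dotl2 f (tfshift x.1 x.2 g).

Definition weight k : R := 1 + \sum_(i < n) `|(k 0 i)%:~R|.

Definition schwartzZ : set (Z -> C) :=
  [set f | forall N : nat, exists B : R,
     forall k, weight k ^+ N * cmod (f k) <= B].

Definition is_linear_on (X : Type) (S : set (X -> C)) (u : (X -> C) -> C) :=
  forall (a : C) (f g : X -> C), S f -> S g ->
    u (fun x => a * f x + g x) = a * u f + u g.

Definition temperedZ (v : (Z -> C) -> C) :=
  is_linear_on schwartzZ v /\
  exists (N : nat) (B : R), forall f, schwartzZ f -> forall K : R,
    (forall k, weight k ^+ N * cmod (f k) <= K) -> cmod (v f) <= B * K.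

(* Tempered distributions are bilinear in (distribution, test function), so
   that <v, f> is v (conjf f). *)
Definition dstft phi (v : (Z -> C) -> C) : Z * T -> C :=
  fun x => v (conjf (tfshift x.1 x.2 phi)).

Definition inMpZ phi (p : \bar R) (v : (Z -> C) -> C) :=
  temperedZ v /\ inLp (@muZT R n) p (dstft phi v).
Definition MpZnorm phi (p : \bar R) (v : (Z -> C) -> C) : \bar R :=
  lpnorm (@muZT R n) p (dstft phi v).

(* The function k |-> <v, delta_k> on Z^n that v is identified with. *)
Definition seq_of (v : (Z -> C) -> C) : Z -> C :=
  fun k => v (fun j => (j == k)%:R).

Definition bumpT w (i : 'I_n) (t : R) : T :=
  [tuple tnth w j + t *+ (j == i) | j < n].

Definition has_partial (i : 'I_n) (f : T -> C) w :=
  derivable (fun t : R => complex.Re (f (bumpT w i t))) 0 1 /\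
  derivable (fun t : R => complex.Im (f (bumpT w i t))) 0 1.

Definition partial (i : 'I_n) (f : T -> C) : T -> C := fun w =>
  (derive1 (fun t : R => complex.Re (f (bumpT w i t))) 0 +i*
   derive1 (fun t : R => complex.Im (f (bumpT w i t))) 0)%C.

Definition partials (s : seq 'I_n) (f : T -> C) : T -> C := foldr partial f s.

(* All iterated partial derivatives in the torus variable exist and are
   rapidly decreasing in the other one; being bounded they make each other
   Lipschitz, so that F is C^oo in the torus variable. *)
Definition schwartzZT : set (Z * T -> C) :=
  [set F | [/\ (forall j w l, F (j, translT w l) = F (j, w)),
    (forall j (s : seq 'I_n) i w,
       has_partial i (partials s (fun eta => F (j, eta))) w) &
    (forall (N : nat) (s : seq 'I_n), exists B : R, forall j w,
       weight j ^+ N * cmod (partials s (fun eta => F (j, eta)) w) <= B)]].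

Definition temperedZT (u : (Z * T -> C) -> C) :=
  is_linear_on schwartzZT u /\
  exists (N : nat) (B : R), forall F, schwartzZT F -> forall K : R,
    (forall s : seq 'I_n, (size s <= N)%N -> forall j w,
       weight j ^+ N * cmod (partials s (fun eta => F (j, eta)) w) <= K) ->
    cmod (u F) <= B * K.

(* M_(xi, k) T_(m, omega) Phi *)
Definition tfshiftZT m omega xi k (Phi : Z * T -> C) : Z * T -> C :=
  fun y => expi (dotT xi y.1 + dotT y.2 k) * Phi (y.1 - m, subT y.2 omega).

Definition dstftZT (Phi : Z * T -> C) (u : (Z * T -> C) -> C) :
    (Z * T) * (T * Z) -> C :=
  fun x => u (conjf (tfshiftZT x.1.1 x.1.2 x.2.1 x.2.2 Phi)).

Definition inMpZT (Phi : Z * T -> C) (p : \bar R) (u : (Z * T -> C) -> C) :=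
  temperedZT u /\ inLp (@muZTTZ R n) p (dstftZT Phi u).
Definition MpZTnorm (Phi : Z * T -> C) (p : \bar R) (u : (Z * T -> C) -> C) :
  \bar R := lpnorm (@muZTTZ R n) p (dstftZT Phi u).

(* Operators on l^2(Z^n) are maps between all functions on Z^n, of which only
   the restriction to l^2(Z^n) matters. *)
Implicit Types A B P : (Z -> C) -> (Z -> C).

Definition bounded_op A :=
  [/\ (forall f, l2 f -> l2 (A f)),
      (forall (a : C) f h, l2 f -> l2 h ->
         A (fun k => a * f k + h k) = (fun k => a * A f k + A h k)) &
      exists c : R, forall f, l2 f ->
        (lpnorm mZ 2%:E (A f) <= c%:E * lpnorm mZ 2%:E f)%E].

Definition compact_op A :=
  forall (f : nat -> Z -> C) (c : R),
    (forall i, l2 (f i) /\ (lpnorm mZ 2%:E (f i) <= c%:E)%E) ->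
    exists (s : nat -> nat) (h : Z -> C),
      [/\ {homo s : i j / (i < j)%N}, l2 h &
        (fun i => lpnorm mZ 2%:E (fun k => A (f (s i)) k - h k))
          @ \oo --> 0%E].

Definition adjoint_op A B :=
  bounded_op B /\ forall f h, l2 f -> l2 h -> dotl2 (A f) h = dotl2 f (B h).

(* P = sqrt (A^* A) *)
Definition is_absop A P :=
  [/\ bounded_op P, (forall f, l2 f -> 0 <= dotl2 (P f) f) &
      exists2 B, adjoint_op A B & forall f, l2 f -> P (P f) = B (A f)].

Definition absop A : (Z -> C) -> (Z -> C) :=
  if pselect (exists P, is_absop A P) is left absA then sval (cid absA)
  else idfun.

Definition lin_indep (r : nat) (e : 'I_r -> Z -> C) :=
  forall c : 'I_r -> C,
    (forall k, \sum_(i < r) c i * e i k = 0) -> forall i, c i = 0.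

(* Dimension (possibly +oo) of the eigenspace of P in l^2(Z^n) for lam. *)
Definition eigen_mult P (lam : R) : \bar R :=
  ereal_sup [set r%:R%:E | r in [set r : nat | exists e : 'I_r -> Z -> C,
    lin_indep e /\
    forall i, l2 (e i) /\ P (e i) = (fun k => lam%:C%C * e i k)]].

(* Sum of the singular values of A, each repeated according to its
   multiplicity as an eigenvalue of |A|. *)
Definition S1norm A : \bar R :=
  \esum_(lam in [set lam : R | 0 < lam]) (lam%:E * eigen_mult (absop A) lam)%E.

Definition inS1 A := [/\ bounded_op A, compact_op A & (S1norm A < +oo)%E].

(* A is the localization operator with symbol u and windows g1, g2. The
   pointwise formula needs u to be given by a function sig; this is part of the
   claim that A exists. *)
Definition is_locop (u : (Z * T -> C) -> C) g1 g2 A :=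
  bounded_op A /\
  exists2 sig : Z * T -> C, represents (@muZT R n) schwartzZT u sig &
    forall f h, l2 f -> l2 h ->
      let I x := sig x * stft g1 f x * (stft g2 h x)^* in
      cintegrable (@muZT R n) I /\ dotl2 (A f) h = cint (@muZT R n) I.

Definition lower_symbol A g : Z * T -> C :=
  fun x => dotl2 (A (tfshift x.1 x.2 g)) (tfshift x.1 x.2 g).

(* The norms of M^1 scale with the windows phi and Phi, so an inequality with
   constant 1 between such norms and window-independent quantities presupposes
   a normalization of the windows. *)
Definition normalized_windows phi (Phi : Z * T -> C) :=
  (1 <= lpnorm mZ 2%:E phi)%E /\ (1 <= lpnorm (@muZT R n) +oo%E Phi)%E.

End TimeFrequency.

(* Main.v *)
Require Import Defs.
From HB Require Import structures.
From mathcomp Require Import all_boot all_order all_algebra.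
From mathcomp Require Import all_classical all_reals all_analysis.
From mathcomp Require Import measurable_realfun ess_sup_inf.
From mathcomp Require Import complex ring lra zify.

Set Implicit Arguments.
Unset Strict Implicit.
Unset Printing Implicit Defensive.

Import Order.TTheory GRing.Theory Num.Theory.
Import numFieldNormedType.Exports.

Local Open Scope classical_set_scope.
Local Open Scope ring_scope.

(* Write G = seq_of g, V for the short-time Fourier transform of vsig and W for
   that of g. Reading off the Fourier coefficients of W(m, .) shows that G is in
   l^1 and, with Moyal's identity, |G|_2 |phi|_2 <= |W|_1.

   For each z = (p, zeta) with Phi z != 0, inverting V through the value Phi z
   gives an integrable function F_z with |Phi z| |F_z|_1 <= |V|_1. Its Fourier
   coefficients are those of vsig, and trigonometric polynomials are dense in the
   Schwartz space (Fejer means), so F_z represents vsig. The matrix of a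
   localization operator L depends on vsig only; hence L has symbol F_z for
   every z, L is bounded and compact, and its adjoint has symbol conj F_z.

   With P = |L| and orthonormal eigenvectors e_i of P with eigenvalues l_i > 0, the
   vectors L e_i / l_i are orthonormal too, and sum_i l_i = sum_i <L e_i, L e_i / l_i>
   is the integral of F_z against a kernel bounded by |G|_2^2 (Bessel). So
   |Phi z| |L|_{S_1} <= |V|_1 |G|_2^2; take the supremum over z. For the lower
   bound expand <L f, f> = sum_j <f, e_j> <L e_j, f> at f = M_w T_m G and integrate,
   using Moyal and Cauchy-Schwarz termwise.

   The constant c accounts for windows with |phi|_2 < 1 or sup |Phi| < 1. *)

(** * Complex modulus and complex-valued integrals *)

(** Inverting through one window value [Phi z] costs only the factor |Phi z|, whereas averaging
    against a dual window would cost its norm; the supremum over z then leaves sup |Phi|. The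
    functions F_z are never compared with each other: a bounded operator is fixed by its matrix, and
    each entry sees the symbol only through the values of vsig on the monomials [mono]. Summability
    is not extracted from smoothness: for G, for phi and for the Fourier coefficients of a row of
    Phi it is read off from the integrability of V and W, whose Fourier coefficients in one variable
    are explicit products. Density is needed with rates, hence a Fejer estimate linear in the
    Lipschitz constant, which serves all derivatives and all translates at once. The norm of S_1 is
    a sum over eigenspaces, so the trace estimate is proved for finite orthogonal families that may
    contain zero vectors, and the supremum of finite sums comes last. For the lower bound, the
    partial sums of the expansion are only shown to converge pointwise; Fatou's lemma suffices
    because their L^1-norms are bounded uniformly. *)

Section ComplexModulus.
Variable R : realType.
Implicit Types z u v : R[i].

Lemma cmodM u v : cmod (u * v) = cmod u * cmod v.
Proof. exact: ComplexField.Normc.normcM. Qed.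

Lemma cmodD u v : cmod (u + v) <= cmod u + cmod v.
Proof. exact: le_normcD. Qed.

Lemma cmod0 : cmod (0 : R[i]) = 0.
Proof. exact: ComplexField.Normc.normc0. Qed.

Lemma cmod1 : cmod (1 : R[i]) = 1.
Proof. exact: ComplexField.Normc.normc1. Qed.

Lemma cmodN z : cmod (- z) = cmod z.
Proof. exact: normcN. Qed.

Lemma cmodB u v : cmod (u - v) <= cmod u + cmod v.
Proof. by rewrite -(cmodN v) cmodD. Qed.

Lemma cmodC u v : cmod (u - v) = cmod (v - u).
Proof. by rewrite -cmodN opprB. Qed.

Lemma cmod_ge0 z : 0 <= cmod z.
Proof. by case: z => a b; exact: sqrtr_ge0. Qed.

Lemma cmod_eq0 z : (cmod z == 0) = (z == 0).
Proof.
apply/eqP/eqP => [|->]; last exact: cmod0.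
exact: ComplexField.Normc.eq0_normc.
Qed.

Lemma cmodV z : cmod z^-1 = (cmod z)^-1.
Proof. exact: ComplexField.Normc.normcV. Qed.

Lemma cmod_gt0 z : (0 < cmod z) = (z != 0).
Proof. by rewrite lt_def cmod_ge0 andbT cmod_eq0. Qed.

Lemma sqr_cmod z : cmod z ^+ 2 = complex.Re z ^+ 2 + complex.Im z ^+ 2.
Proof. by case: z => a b /=; rewrite sqr_sqrtr// addr_ge0 ?sqr_ge0. Qed.

Lemma cmodJ z : cmod z^* = cmod z.
Proof. by case: z => a b /=; rewrite /cmod/= sqrrN. Qed.

Lemma cmod_real (x : R) : cmod x%:C%C = `|x|.
Proof. by rewrite /cmod /= expr0n/= addr0 sqrtr_sqr. Qed.

Lemma cmod_nat (k : nat) : cmod (k%:R : R[i]) = k%:R.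
Proof. by rewrite -(rmorph_nat (real_complex R)) cmod_real ger0_norm. Qed.

Lemma cmodX z k : cmod (z ^+ k) = cmod z ^+ k.
Proof. by elim: k => [|k IH]; rewrite ?expr0 ?cmod1// !exprS cmodM IH. Qed.

Lemma Re_le_cmod z : `|complex.Re z| <= cmod z.
Proof.
rewrite -(@ler_sqr _ `|_|) ?nnegrE ?cmod_ge0//.
by rewrite sqr_cmod real_normK ?num_real// lerDl sqr_ge0.
Qed.

Lemma Im_le_cmod z : `|complex.Im z| <= cmod z.
Proof.
rewrite -(@ler_sqr _ `|_|) ?nnegrE ?cmod_ge0//.
by rewrite sqr_cmod real_normK ?num_real// lerDr sqr_ge0.
Qed.

Lemma Re_ge_Ncmod z : complex.Re z <= cmod z.
Proof. exact: le_trans (ler_norm _) (Re_le_cmod z). Qed.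

Lemma cmod_le_ReIm z : cmod z <= `|complex.Re z| + `|complex.Im z|.
Proof.
rewrite -ler_sqr ?nnegrE ?cmod_ge0 ?addr_ge0//.
rewrite sqr_cmod sqrrD !real_normK ?num_real// lerD2r lerDl.
by rewrite mulrn_wge0// mulr_ge0.
Qed.

Lemma cmod_sum (I : Type) (s : seq I) (P : pred I) (F : I -> R[i]) :
  cmod (\sum_(i <- s | P i) F i) <= \sum_(i <- s | P i) cmod (F i).
Proof.
apply: (big_ind2 (fun x y => cmod x <= y)) => [|x u y v xu yv|//].
  by rewrite cmod0.
by apply: le_trans (cmodD _ _) _; apply: lerD.
Qed.

Lemma mulJ z : z * z^* = (cmod z ^+ 2)%:C%C.
Proof.
rewrite sqr_cmod; case: z => a b /=; rewrite /GRing.mul/=.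
by congr (_ +i* _)%C; ring.
Qed.

Lemma ReD u v : complex.Re (u + v) = complex.Re u + complex.Re v.
Proof. by case: u; case: v. Qed.
Lemma ImD u v : complex.Im (u + v) = complex.Im u + complex.Im v.
Proof. by case: u; case: v. Qed.
Lemma ReN u : complex.Re (- u) = - complex.Re u.
Proof. by case: u. Qed.
Lemma ImN u : complex.Im (- u) = - complex.Im u.
Proof. by case: u. Qed.
Lemma ReM u v : complex.Re (u * v) =
  complex.Re u * complex.Re v - complex.Im u * complex.Im v.
Proof. by case: u; case: v. Qed.
Lemma ImM u v : complex.Im (u * v) =
  complex.Re u * complex.Im v + complex.Im u * complex.Re v.
Proof. by case: u; case: v. Qed.
Lemma ReJ z : complex.Re z^* = complex.Re z.
Proof. by case: z. Qed.
Lemma ImJ z : complex.Im z^* = - complex.Im z.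
Proof. by case: z. Qed.

Lemma Re_sum (I : Type) (s : seq I) (P : pred I) (F : I -> R[i]) :
  complex.Re (\sum_(i <- s | P i) F i) = \sum_(i <- s | P i) complex.Re (F i).
Proof. exact: (raddf_sum (@complex.Re R : {additive _ -> _})). Qed.

Lemma eqRI u v : complex.Re u = complex.Re v -> complex.Im u = complex.Im v ->
  u = v.
Proof. by case: u; case: v => /= ? ? ? ? -> ->. Qed.

Lemma Re_mulJ z : complex.Re (z * z^*) = cmod z ^+ 2.
Proof. by rewrite mulJ. Qed.

Lemma complex_ge0P (z : R[i]) : (0 <= z) = (complex.Im z == 0) && (0 <= complex.Re z).
Proof. by rewrite lecE/=. Qed.

End ComplexModulus.

Ltac nonneg := intros; rewrite ?lee_fin; repeat first
  [ done | exact: cmod_ge0 | exact: sqr_ge0 | exact: normr_ge0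
  | apply: mulr_ge0 | apply: addr_ge0 | apply: exprn_ge0 ].

Section ComplexIntegral.
Context d (T : measurableType d) (R : realType).
Variable mu : {measure set T -> \bar R}.
Implicit Types (f g : T -> R[i]) (a : R[i]).

Lemma cmeas_cmod f : cmeasurable f ->
  measurable_fun [set: T] (fun x => cmod (f x)).
Proof.
move=> [mr mi].
under eq_fun => x do rewrite -(ger0_norm (cmod_ge0 _)) -sqrtr_sqr sqr_cmod.
apply: (@measurableT_comp _ _ _ _ _ _ (@Num.sqrt R)) => //.
  by apply: continuous_measurable_fun; exact: sqrt_continuous.
by apply: measurable_funD; apply: measurable_funX.
Qed.

Lemma cmeas_cmodE f : cmeasurable f ->
  measurable_fun [set: T] (fun x => (cmod (f x))%:E).
Proof. by move=> mf; apply/measurable_EFinP; exact: cmeas_cmod. Qed.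

Lemma cmeas_cst a : cmeasurable (fun _ : T => a).
Proof. by split. Qed.

Lemma cmeasD f g : cmeasurable f -> cmeasurable g ->
  cmeasurable (fun x => f x + g x).
Proof.
move=> [? ?] [? ?]; split.
  by under eq_fun do rewrite ReD; apply: measurable_funD.
by under eq_fun do rewrite ImD; apply: measurable_funD.
Qed.

Lemma cmeasN f : cmeasurable f -> cmeasurable (fun x => - f x).
Proof.
move=> [? ?]; split.
  by under eq_fun do rewrite ReN; apply: measurable_funN.
by under eq_fun do rewrite ImN; apply: measurable_funN.
Qed.

Lemma cmeasJ f : cmeasurable f -> cmeasurable (fun x => (f x)^*).
Proof.
move=> [? ?]; split.
  by under eq_fun do rewrite ReJ.
by under eq_fun do rewrite ImJ; apply: measurable_funN.
Qed.

Lemma cmeasM f g : cmeasurable f -> cmeasurable g ->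
  cmeasurable (fun x => f x * g x).
Proof.
move=> [? ?] [? ?]; split.
  under eq_fun do rewrite ReM.
  by apply: measurable_funB; apply: measurable_funM.
under eq_fun do rewrite ImM.
by apply: measurable_funD; apply: measurable_funM.
Qed.

Lemma cmeas_sum (I : Type) (s : seq I) (F : I -> T -> R[i]) :
  (forall i, cmeasurable (F i)) -> cmeasurable (fun x => \sum_(i <- s) F i x).
Proof.
move=> mF; elim: s => [|i s IH].
  by under eq_fun do rewrite big_nil; exact: cmeas_cst.
by under eq_fun do rewrite big_cons; exact: cmeasD.
Qed.

(** Both directions compare moduli: |Re z| and |Im z| are at most |z|, which is at most their sum.
    Later integrability proofs thus reduce to bounding the integral of a modulus. *)
Lemma cintegrableP f :
  cintegrable mu f <->
  cmeasurable f /\ (\int[mu]_x (cmod (f x))%:E < +oo)%E.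
Proof.
split=> [[ir ii]|[mf foo]].
  have mf : cmeasurable f.
    by split; apply/measurable_EFinP; [exact: (measurable_int mu ir)|exact: (measurable_int mu ii)].
  split=> //.
  have := integrableD measurableT (integrable_abse ir) (integrable_abse ii).
  move=> /integrableP[mD]; apply: le_lt_trans.
  apply: ge0_le_integral => //.
  - by move=> x _; rewrite lee_fin cmod_ge0.
  - by have := cmeas_cmodE mf.
  - exact: measurableT_comp.
  - by move=> x _; rewrite lee_fin /= ger0_norm ?addr_ge0// cmod_le_ReIm.
have := cmeas_cmodE mf => mc.
have ic : mu.-integrable [set: T] (fun x => (cmod (f x))%:E).
  apply/integrableP; split=> //.
  by under eq_integral do rewrite gee0_abs ?lee_fin ?cmod_ge0//.
case: (mf) => mr mi; split; apply: le_integrable ic => //=; try exact/measurable_EFinP.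
  by move=> x _; rewrite lee_fin (ger0_norm (cmod_ge0 _)) Re_le_cmod.
by move=> x _; rewrite lee_fin (ger0_norm (cmod_ge0 _)) Im_le_cmod.
Qed.

Lemma cintegrable_meas f : cintegrable mu f -> cmeasurable f.
Proof. by case/cintegrableP. Qed.

Lemma cintegrable_lty f : cintegrable mu f ->
  (\int[mu]_x (cmod (f x))%:E < +oo)%E.
Proof. by case/cintegrableP. Qed.

Lemma le_cintegrable f (g : T -> R) : cmeasurable f ->
  measurable_fun [set: T] g ->
  (forall x, cmod (f x) <= g x) -> (\int[mu]_x (g x)%:E < +oo)%E ->
  cintegrable mu f.
Proof.
move=> mf mg fg goo; apply/cintegrableP; split=> //.
apply: le_lt_trans goo; apply: ge0_le_integral => //.
- by move=> x _; rewrite lee_fin cmod_ge0.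
- exact: cmeas_cmodE.
- exact/measurable_EFinP.
- by move=> x _; rewrite lee_fin.
Qed.

Lemma cintegrableD f g : cintegrable mu f -> cintegrable mu g ->
  cintegrable mu (fun x => f x + g x).
Proof.
move=> [fr fi] [gr gi]; split.
  by under eq_fun do rewrite ReD EFinD; exact: integrableD.
by under eq_fun do rewrite ImD EFinD; exact: integrableD.
Qed.

Lemma cintegrableN f : cintegrable mu f -> cintegrable mu (fun x => - f x).
Proof.
move=> [fr fi]; split.
  by under eq_fun do rewrite ReN EFinN; exact: integrableN.
by under eq_fun do rewrite ImN EFinN; exact: integrableN.
Qed.

Lemma cintegrableB f g : cintegrable mu f -> cintegrable mu g ->
  cintegrable mu (fun x => f x - g x).
Proof. by move=> fi /cintegrableN; exact: cintegrableD. Qed.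

Lemma cintegrableZ a f : cintegrable mu f -> cintegrable mu (fun x => a * f x).
Proof.
move=> [fr fi]; split.
  under eq_fun do rewrite ReM EFinB !EFinM.
  by apply: integrableB => //; exact: integrableZl.
under eq_fun do rewrite ImM EFinD !EFinM.
by apply: integrableD => //; exact: integrableZl.
Qed.

Lemma cintegrableJ f : cintegrable mu f -> cintegrable mu (fun x => (f x)^*).
Proof.
move=> [fr fi]; split.
  by under eq_fun do rewrite ReJ.
by under eq_fun do rewrite ImJ EFinN; exact: integrableN.
Qed.

Lemma cintegrable0 : cintegrable mu (fun _ => 0).
Proof. by split; exact: integrable0. Qed.

Lemma cintegrable_sum (I : Type) (s : seq I) (F : I -> T -> R[i]) :
  (forall i, cintegrable mu (F i)) ->
  cintegrable mu (fun x => \sum_(i <- s) F i x).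
Proof.
move=> mF; elim: s => [|i s IH].
  by under eq_fun do rewrite big_nil; exact: cintegrable0.
by under eq_fun do rewrite big_cons; exact: cintegrableD.
Qed.

Lemma eq_cint f g : f =1 g -> cint mu f = cint mu g.
Proof. by move=> /funext ->. Qed.

Lemma cintD f g : cintegrable mu f -> cintegrable mu g ->
  cint mu (fun x => f x + g x) = cint mu f + cint mu g.
Proof.
move=> [fr fi] [gr gi]; apply: eqRI; rewrite ?ReD ?ImD /cint /=.
  by rewrite -RintegralD//; apply: eq_Rintegral => x _; rewrite ReD.
by rewrite -RintegralD//; apply: eq_Rintegral => x _; rewrite ImD.
Qed.

Lemma cintZ a f : cintegrable mu f ->
  cint mu (fun x => a * f x) = a * cint mu f.
Proof.
move=> [fr fi]; apply: eqRI; rewrite ?ReM ?ImM /cint /=.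
  rewrite -!RintegralZl// -RintegralB//=; 
    try (exact: (integrableZl measurableT _ fr)); try (exact: (integrableZl measurableT _ fi)).
  by apply: eq_Rintegral => x _; rewrite ReM.
rewrite -!RintegralZl// -RintegralD//=; 
    try (exact: (integrableZl measurableT _ fr)); try (exact: (integrableZl measurableT _ fi)).
by apply: eq_Rintegral => x _; rewrite ImM.
Qed.

Lemma cintZr a f : cintegrable mu f ->
  cint mu (fun x => f x * a) = cint mu f * a.
Proof. by move=> fi; under eq_cint do rewrite mulrC; rewrite cintZ// mulrC. Qed.

Lemma cint0 : cint mu (fun _ => 0) = 0.
Proof.
by rewrite /cint /= /Rintegral (_ : (fun _ => 0%:E) = (fun _ : T => 0%E))// integral0.
Qed.

Lemma cintN f : cintegrable mu f -> cint mu (fun x => - f x) = - cint mu f.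
Proof.
move=> fi; rewrite -mulN1r -cintZ//.
by apply: eq_cint => x; rewrite mulN1r.
Qed.

Lemma cintB f g : cintegrable mu f -> cintegrable mu g ->
  cint mu (fun x => f x - g x) = cint mu f - cint mu g.
Proof. by move=> fi gi; rewrite cintD// ?cintN//; exact: cintegrableN. Qed.

Lemma cintJ f : cintegrable mu f -> cint mu (fun x => (f x)^*) = (cint mu f)^*.
Proof.
move=> [fr fi]; apply: eqRI; rewrite ?ReJ ?ImJ /cint /=.
  by apply: eq_Rintegral => x _; rewrite ReJ.
rewrite -mulN1r -RintegralZl//.
by apply: eq_Rintegral => x _; rewrite ImJ mulN1r.
Qed.

Lemma cint_sum (I : Type) (s : seq I) (F : I -> T -> R[i]) :
  (forall i, cintegrable mu (F i)) ->
  cint mu (fun x => \sum_(i <- s) F i x) = \sum_(i <- s) cint mu (F i).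
Proof.
move=> mF; elim: s => [|i s IH].
  by rewrite big_nil -[RHS]cint0; apply: eq_cint => x; rewrite big_nil.
rewrite big_cons -IH -cintD//; last exact: cintegrable_sum.
by apply: eq_cint => x; rewrite big_cons.
Qed.

Lemma Re_cint f : complex.Re (cint mu f) = \int[mu]_x complex.Re (f x).
Proof. by []. Qed.

(* Rotate the integral onto the positive real axis and compare real parts. *)
Lemma cmod_cint_le f : cintegrable mu f ->
  ((cmod (cint mu f))%:E <= \int[mu]_x (cmod (f x))%:E)%E.
Proof.
move=> fi; set z := cint mu f; have [z0|z0] := eqVneq z 0.
  by rewrite z0 cmod0; apply: integral_ge0 => x _; rewrite lee_fin cmod_ge0.
have cz0 : 0 < cmod z by rewrite cmod_gt0.
rewrite -(@lee_pmul2l _ (cmod z)%:E) ?lte_fin//.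
have fi' := cintegrableZ z^* fi.
have [mf foo] := (cintegrableP f).1 fi.
rewrite -EFinM -expr2 -Re_mulJ mulrC /z -cintZ// Re_cint -/z.
have [ir _] := fi'.
rewrite -ge0_integralZl//; [|exact: cmeas_cmodE| |by rewrite lee_fin cmod_ge0];
  last by move=> x _; rewrite lee_fin cmod_ge0.
rewrite /Rintegral fineK ?integrable_fin_num//.
apply: le_integral => //.
  apply/integrableP; split.
    by apply/measurable_EFinP; apply: measurable_funM => //; exact: cmeas_cmod.
  under eq_integral do rewrite gee0_abs ?lee_fin ?mulr_ge0 ?cmod_ge0//.
  rewrite ge0_integralZl ?lte_mul_pinfty// ?lee_fin ?cmod_ge0//.
    exact: cmeas_cmodE.
  by move=> x _; rewrite lee_fin cmod_ge0.
by move=> x _; rewrite lee_fin (le_trans (Re_ge_Ncmod _))// cmodM cmodJ.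
Qed.

Lemma cmod_cint_le_fine f : cintegrable mu f ->
  cmod (cint mu f) <= fine (\int[mu]_x (cmod (f x))%:E)%E.
Proof.
move=> fi; rewrite -lee_fin fineK ?cmod_cint_le//.
rewrite ge0_fin_numE ?cintegrable_lty//.
by apply: integral_ge0 => x _; rewrite lee_fin cmod_ge0.
Qed.

Lemma cmod_cint_bound f (B : R) : cintegrable mu f ->
  (\int[mu]_x (cmod (f x))%:E <= B%:E)%E -> cmod (cint mu f) <= B.
Proof. by move=> fi fB; rewrite -lee_fin (le_trans _ fB)// cmod_cint_le. Qed.

End ComplexIntegral.

Section RealIntegrands.
Context d (T : measurableType d) (R : realType).
Variable mu : {measure set T -> \bar R}.
Implicit Types h : T -> R.

Lemma gint_scale (c : R) h : measurable_fun [set: T] h -> 0 <= c ->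
  (forall x, 0 <= h x) ->
  (\int[mu]_x (c * h x)%:E = c%:E * \int[mu]_x (h x)%:E)%E.
Proof.
move=> mh c0 h0; under eq_integral do rewrite EFinM.
apply: ge0_integralZl => //; first exact/measurable_EFinP.
by move=> x _; rewrite lee_fin.
Qed.

Lemma gint_add h1 h2 : measurable_fun [set: T] h1 -> measurable_fun [set: T] h2 ->
  (forall x, 0 <= h1 x) -> (forall x, 0 <= h2 x) ->
  (\int[mu]_x (h1 x + h2 x)%:E = \int[mu]_x (h1 x)%:E + \int[mu]_x (h2 x)%:E)%E.
Proof.
move=> m1 m2 h10 h20; under eq_integral do rewrite EFinD.
apply: ge0_integralD => //; try (by move=> x _; rewrite lee_fin);
  exact/measurable_EFinP.
Qed.

Lemma gint_le h1 h2 : measurable_fun [set: T] h1 -> measurable_fun [set: T] h2 ->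
  (forall x, 0 <= h1 x) -> (forall x, h1 x <= h2 x) ->
  (\int[mu]_x (h1 x)%:E <= \int[mu]_x (h2 x)%:E)%E.
Proof.
move=> m1 m2 h10 h12; apply: ge0_le_integral => //;
  try exact/measurable_EFinP.
- by move=> x _; rewrite lee_fin.
- by move=> x _; rewrite lee_fin.
Qed.

End RealIntegrands.

Section ComplexMeasurability.
Context d1 d2 (T1 : measurableType d1) (T2 : measurableType d2) (R : realType).

Lemma cmeas_comp (h : T1 -> T2) (f : T2 -> R[i]) :
  measurable_fun [set: T1] h -> cmeasurable f -> cmeasurable (fun x => f (h x)).
Proof.
by move=> mh [mr mi]; split; [exact: (measurableT_comp mr mh)|exact: (measurableT_comp mi mh)].
Qed.

End ComplexMeasurability.

Section ComplexSections.
Context d1 d2 (T1 : measurableType d1) (T2 : measurableType d2) (R : realType).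

Lemma cmeas_xsection (f : T1 * T2 -> R[i]) x :
  cmeasurable f -> cmeasurable (fun y => f (x, y)).
Proof. exact: (cmeas_comp (pair1_measurable x)). Qed.

Lemma cmeas_ysection (f : T1 * T2 -> R[i]) y :
  cmeasurable f -> cmeasurable (fun x => f (x, y)).
Proof. exact: (cmeas_comp (pair2_measurable y)). Qed.

End ComplexSections.

Section ComplexConvergence.
Context d (T : measurableType d) (R : realType).
Variable mu : {measure set T -> \bar R}.
Implicit Types (f : T -> R[i]).

Lemma cvgEFinP (I : Type) (F : set_system I) {FF : Filter F} (u : I -> R) l :
  ((fun i => (u i)%:E) @ F --> l%:E) <-> (u @ F --> l).
Proof.
split=> [/fine_cvg//|ul]; apply: cvg_EFin => //; exact: nearW.
Qed.

Lemma cvg_cmodP (I : Type) (F : set_system I) {FF : Filter F} (u : I -> R[i]) l :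
  (fun i => cmod (u i - l)) @ F --> (0 : R) <->
  ((fun i => complex.Re (u i)) @ F --> complex.Re l) /\
  ((fun i => complex.Im (u i)) @ F --> complex.Im l).
Proof.
split=> [/cvgr0Pnorm_lt u0|[/cvgrPdist_lt ur /cvgrPdist_lt ui]].
  split; apply/cvgrPdist_lt => e e0; have := u0 _ e0; apply: filterS => i;
    rewrite ger0_norm ?cmod_ge0//; apply: le_lt_trans; rewrite distrC.
    by rewrite -ReN -ReD Re_le_cmod.
  by rewrite -ImN -ImD Im_le_cmod.
apply/cvgr0Pnorm_lt => e e0; near=> i; rewrite ger0_norm ?cmod_ge0//.
apply: le_lt_trans (cmod_le_ReIm _) _; rewrite ReD ReN ImD ImN (splitr e).
by rewrite ltrD// distrC; near: i; [apply: ur|apply: ui]; rewrite divr_gt0.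
Unshelve. all: by end_near. Qed.

Lemma cvg_cmod_unique (I : Type) (F : set_system I) {FF : ProperFilter F}
    (u : I -> R[i]) l l' :
  (fun i => cmod (u i - l)) @ F --> (0 : R) ->
  (fun i => cmod (u i - l')) @ F --> (0 : R) -> l = l'.
Proof.
move=> /cvg_cmodP[ur ui] /cvg_cmodP[ur' ui']; apply: eqRI.
  exact: (cvg_unique _ ur ur').
exact: (cvg_unique _ ui ui').
Qed.

Lemma cmeas_cvg (f_ : nat -> T -> R[i]) f : (forall n, cmeasurable (f_ n)) ->
  (forall x, (fun n => cmod (f_ n x - f x)) @ \oo --> (0 : R)) -> cmeasurable f.
Proof.
move=> mf ff; split.
  apply: (measurable_fun_cvg (h := fun n x => complex.Re (f_ n x))) => //.
    by move=> n; case: (mf n).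
  by move=> x _; have /cvg_cmodP[] := ff x.
apply: (measurable_fun_cvg (h := fun n x => complex.Im (f_ n x))) => //.
  by move=> n; case: (mf n).
by move=> x _; have /cvg_cmodP[] := ff x.
Qed.

(** The L^1 form of dominated convergence. Compactness of localization operators needs it, since
    convergence of the integrals alone does not control norms. *)
Lemma cint_dominated_abs (f_ : nat -> T -> R[i]) f (g : T -> R) :
  (forall n, cmeasurable (f_ n)) ->
  (forall x, (fun n => cmod (f_ n x - f x)) @ \oo --> (0 : R)) ->
  measurable_fun [set: T] g -> (\int[mu]_x (g x)%:E < +oo)%E ->
  (forall n x, cmod (f_ n x) <= g x) ->
  (fun n => (\int[mu]_x (cmod (f_ n x - f x))%:E)%E) @ \oo --> 0%E.
Proof.
move=> mf ff mg goo fg.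
have mf0 : cmeasurable f by exact: cmeas_cvg ff.
have fg0 x : cmod (f x) <= g x.
  apply/ler_addgt0Pr => e e0.
  have /cvgr0Pnorm_lt/(_ _ e0)[N _ /(_ N (leqnn N))] := ff x.
  rewrite ger0_norm ?cmod_ge0// => h.
  rewrite -[f x](subrK (f_ N x)) (le_trans (cmodD _ _))// addrC lerD//.
  by rewrite cmodC ltW.
have g0 x : 0 <= g x by exact: le_trans (cmod_ge0 _) (fg0 x).
have ig : mu.-integrable [set: T] (fun x => (2 * g x)%:E).
  apply/integrableP; split.
    by apply/measurable_EFinP; exact: measurable_funM.
  under eq_integral do rewrite gee0_abs ?lee_fin ?mulr_ge0// EFinM.
  rewrite ge0_integralZl ?lte_mul_pinfty ?lee_fin//.
    exact/measurable_EFinP.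
  by move=> x _; rewrite lee_fin.
rewrite -(integral0 mu [set: T]).
apply: (@dominated_cvg _ _ _ mu _ measurableT _ (fun=> 0%E) (fun x => (2 * g x)%:E)) => //.
- move=> n; apply: cmeas_cmodE; apply: cmeasD => //; exact: cmeasN.
- by move=> x _; apply/cvgEFinP; exact: ff.
- move=> n x _; rewrite gee0_abs ?lee_fin ?cmod_ge0//.
  by rewrite (le_trans (cmodB _ _))// mulr_natl mulr2n lerD.
Qed.

Lemma cint_dominated (f_ : nat -> T -> R[i]) f (g : T -> R) :
  (forall n, cmeasurable (f_ n)) ->
  (forall x, (fun n => cmod (f_ n x - f x)) @ \oo --> (0 : R)) ->
  measurable_fun [set: T] g -> (\int[mu]_x (g x)%:E < +oo)%E ->
  (forall n x, cmod (f_ n x) <= g x) ->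
  cintegrable mu f /\
  (fun n => cmod (cint mu (f_ n) - cint mu f)) @ \oo --> (0 : R).
Proof.
move=> mf ff mg goo fg.
have mf0 : cmeasurable f by exact: cmeas_cvg ff.
have fg0 x : cmod (f x) <= g x.
  apply/ler_addgt0Pr => e e0.
  have /cvgr0Pnorm_lt/(_ _ e0)[N _ /(_ N (leqnn N))] := ff x.
  rewrite ger0_norm ?cmod_ge0// => h.
  rewrite -[f x](subrK (f_ N x)) (le_trans (cmodD _ _))// addrC lerD//.
  by rewrite cmodC ltW.
have fi : cintegrable mu f by exact: le_cintegrable goo.
have fni n : cintegrable mu (f_ n) by exact: le_cintegrable goo.
split=> //.
have h := cint_dominated_abs mf ff mg goo fg.
apply/cvgEFinP.
apply: (squeeze_cvge _ (cvg_cst 0%E) h).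
apply: nearW => n; rewrite lee_fin cmod_ge0 -(cintB (fni n) fi).
by apply: cmod_cint_le; exact: cintegrableB.
Qed.

End ComplexConvergence.

(** * Fubini and Tonelli for complex integrands *)

Section ComplexFubini.
Context d1 d2 (T1 : measurableType d1) (T2 : measurableType d2) (R : realType).
Variable m1 : {sigma_finite_measure set T1 -> \bar R}.
Variable m2 : {sigma_finite_measure set T2 -> \bar R}.
Implicit Type f : T1 * T2 -> R[i].
Local Notation m12 := (m1 \x m2)%E.

Lemma tonelli1 (f : T1 * T2 -> R[i]) : cmeasurable f ->
  (\int[m12]_z (cmod (f z))%:E = \int[m1]_x \int[m2]_y (cmod (f (x, y)))%:E)%E.
Proof.
move=> mf; rewrite fubini_tonelli1//; first exact: cmeas_cmodE.
by move=> z; rewrite lee_fin cmod_ge0.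
Qed.

Lemma tonelli2 (f : T1 * T2 -> R[i]) : cmeasurable f ->
  (\int[m12]_z (cmod (f z))%:E = \int[m2]_y \int[m1]_x (cmod (f (x, y)))%:E)%E.
Proof.
move=> mf; rewrite fubini_tonelli2//; first exact: cmeas_cmodE.
by move=> z; rewrite lee_fin cmod_ge0.
Qed.

Lemma meas_tonelli1 f : cmeasurable f ->
  measurable_fun [set: T1] (fun x => \int[m2]_y (cmod (f (x, y)))%:E)%E.
Proof.
move=> mf; apply: (@measurable_fun_fubini_tonelli_F _ _ _ _ _ m2 (fun z => (cmod (f z))%:E)).
  exact: cmeas_cmodE.
by move=> z; rewrite lee_fin cmod_ge0.
Qed.

Lemma meas_tonelli2 f : cmeasurable f ->
  measurable_fun [set: T2] (fun y => \int[m1]_x (cmod (f (x, y)))%:E)%E.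
Proof.
move=> mf; apply: (@measurable_fun_fubini_tonelli_G _ _ _ _ _ m1 (fun z => (cmod (f z))%:E)).
  exact: cmeas_cmodE.
by move=> z; rewrite lee_fin cmod_ge0.
Qed.

(** Holds without integrability: [fine] is measurable, and the positive and negative parts of h have
    measurable section integrals by Tonelli. *)
Lemma meas_Rint1 (h : T1 * T2 -> R) : measurable_fun setT h ->
  measurable_fun setT (fun x => \int[m2]_y h (x, y)).
Proof.
move=> mh; rewrite /Rintegral; apply: (@measurableT_comp _ _ _ _ _ _ (@fine R)) => //.
have mh' : measurable_fun setT (fun z => (h z)%:E) by exact/measurable_EFinP.
rewrite (_ : (fun x => \int[m2]_y (h (x, y))%:E) = fubini_F m2 (fun z => (EFin \o h)^\+ z)
    \- fubini_F m2 (fun z => (EFin \o h)^\- z))%E; last first.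
  by apply/funext => x; rewrite integralE; congr (_ - _)%E;
    apply: eq_integral => ? _; rewrite ?funeposE ?funenegE.
apply: emeasurable_funB; apply: measurable_fun_fubini_tonelli_F.
- exact: measurable_funepos.
- by move=> z; rewrite ?funepos_ge0 ?funeneg_ge0.
- exact: measurable_funeneg.
- by move=> z; rewrite ?funepos_ge0 ?funeneg_ge0.
Qed.

Lemma meas_Rint2 (h : T1 * T2 -> R) : measurable_fun setT h ->
  measurable_fun setT (fun y => \int[m1]_x h (x, y)).
Proof.
move=> mh; rewrite /Rintegral; apply: (@measurableT_comp _ _ _ _ _ _ (@fine R)) => //.
have mh' : measurable_fun setT (fun z => (h z)%:E) by exact/measurable_EFinP.
rewrite (_ : (fun y => \int[m1]_x (h (x, y))%:E) = fubini_G m1 (fun z => (EFin \o h)^\+ z)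
    \- fubini_G m1 (fun z => (EFin \o h)^\- z))%E; last first.
  by apply/funext => y; rewrite integralE; congr (_ - _)%E;
    apply: eq_integral => ? _; rewrite ?funeposE ?funenegE.
apply: emeasurable_funB; apply: measurable_fun_fubini_tonelli_G.
- exact: measurable_funepos.
- by move=> z; rewrite ?funepos_ge0 ?funeneg_ge0.
- exact: measurable_funeneg.
- by move=> z; rewrite ?funepos_ge0 ?funeneg_ge0.
Qed.

Lemma cmeas_cint1 f : cmeasurable f ->
  cmeasurable (fun x => cint m2 (fun y => f (x, y))).
Proof.
move=> [mr mi]; split; rewrite /cint/=.
  exact: (meas_Rint1 mr).
exact: (meas_Rint1 mi).
Qed.

Lemma cmeas_cint2 f : cmeasurable f ->
  cmeasurable (fun y => cint m1 (fun x => f (x, y))).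
Proof.
move=> [mr mi]; split; rewrite /cint/=.
  exact: (meas_Rint2 mr).
exact: (meas_Rint2 mi).
Qed.

(** The sections of h may fail to be integrable on a null set, where [fine] supplies a default.
    Equality almost everywhere transfers both the integrability and the value of the iterated
    integral. *)
Lemma Rint_fubini1 (h : T1 * T2 -> R) : m12.-integrable setT (fun z => (h z)%:E) ->
  m1.-integrable setT (fun x => (\int[m2]_y h (x, y))%:E) /\
  \int[m12]_z h z = \int[m1]_x \int[m2]_y h (x, y).
Proof.
move=> hi.
have iF := integrable_fubini_F hi.
have mh : measurable_fun setT h by apply/measurable_EFinP; exact: measurable_int hi.
have ae : {ae m1, forall x, setT x ->
    fubini_F m2 (fun z => (h z)%:E) x = (\int[m2]_y h (x, y))%:E}.
  apply: filterS (integrable_ae measurableT iF) => x hx _.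
  by rewrite /Rintegral fineK//; exact: hx.
have mR := meas_Rint1 mh.
split.
  apply/integrableP; split; first exact/measurable_EFinP.
  have /integrableP[_] := iF; apply: le_lt_trans.
  rewrite le_eqVlt; apply/orP; left; apply/eqP.
  apply: ae_eq_integral => //.
  - by apply/measurableT_comp => //; exact/measurable_EFinP.
  - by apply/measurableT_comp => //; exact: measurable_int iF.
  - by apply: filterS ae => x hx _; rewrite hx.
rewrite /Rintegral -integral12_prod_meas1//; congr fine.
apply: ae_eq_integral => //.
- exact: measurable_int iF.
- exact/measurable_EFinP.
Qed.

Lemma Rint_fubini2 (h : T1 * T2 -> R) : m12.-integrable setT (fun z => (h z)%:E) ->
  m2.-integrable setT (fun y => (\int[m1]_x h (x, y))%:E) /\
  \int[m12]_z h z = \int[m2]_y \int[m1]_x h (x, y).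
Proof.
move=> hi.
have mh : measurable_fun setT h by apply/measurable_EFinP; exact: measurable_int hi.
have ae : {ae m2, forall y, setT y ->
    fubini_G m1 (fun z => (h z)%:E) y = (\int[m1]_x h (x, y))%:E}.
  apply: filterS (ae_integrable2 hi) => y hy _.
  by rewrite /Rintegral fineK//; exact: integrable_fin_num.
have mR := meas_Rint2 mh.
have mhE : measurable_fun setT (EFin \o h) by exact/measurable_EFinP.
split.
  apply/integrableP; split; first exact/measurable_EFinP.
  apply: le_lt_trans ((integrable21ltyP m1 m2 mhE).1 hi).
  apply: ge0_le_integral => //.
  - by apply/measurableT_comp => //; exact/measurable_EFinP.
  - apply: (@measurable_fun_fubini_tonelli_G _ _ _ _ _ m1 (abse \o (EFin \o h))) => [|z].
      exact: measurableT_comp.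
    exact: abse_ge0.
  - move=> y _; apply: le_trans (le_abse_integral _ _ _) => //; last first.
      exact: (measurableT_comp mhE (pair2_measurable y)).
    have fe (e : \bar R) : (`|(fine e)%:E| <= `|e|)%E.
      by case: e => //=; rewrite normr0 leey.
    exact: fe.
rewrite /Rintegral -integral21_prod_meas1//; congr fine.
apply: ae_eq_integral => //.
- exact: (measurable_fubini_G hi).
- exact/measurable_EFinP.
Qed.

Lemma cint_fubini1 f : cintegrable m12 f ->
  cintegrable m1 (fun x => cint m2 (fun y => f (x, y))) /\
  cint m12 f = cint m1 (fun x => cint m2 (fun y => f (x, y))).
Proof.
move=> [/Rint_fubini1[ir er] /Rint_fubini1[ii ei]]; split; first by split.
by apply: eqRI; rewrite /cint/= ?er ?ei.
Qed.

Lemma cint_fubini2 f : cintegrable m12 f ->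
  cintegrable m2 (fun y => cint m1 (fun x => f (x, y))) /\
  cint m12 f = cint m2 (fun y => cint m1 (fun x => f (x, y))).
Proof.
move=> [/Rint_fubini2[ir er] /Rint_fubini2[ii ei]]; split; first by split.
by apply: eqRI; rewrite /cint/= ?er ?ei.
Qed.

Lemma cint_swap f : cintegrable m12 f ->
  cint m1 (fun x => cint m2 (fun y => f (x, y))) =
  cint m2 (fun y => cint m1 (fun x => f (x, y))).
Proof. by move=> fi; rewrite -(cint_fubini1 fi).2 (cint_fubini2 fi).2. Qed.

End ComplexFubini.

(** * Inner product spaces and compact positive operators *)

Section RealSequences.
Variable R : realType.
Implicit Types u v : nat -> R.

Lemma cvg0_le u v : (forall n, 0 <= u n <= v n) -> v @ \oo --> (0 : R) ->
  u @ \oo --> (0 : R).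
Proof.
move=> uv v0; apply: (squeeze_cvgr _ (cvg_cst 0) v0).
exact: nearW.
Qed.

Lemma cvg0_sum_le u v w : (forall n, 0 <= u n <= v n + w n) ->
  v @ \oo --> (0 : R) -> w @ \oo --> (0 : R) -> u @ \oo --> (0 : R).
Proof.
move=> uvw v0 w0; apply: cvg0_le uvw _.
by rewrite -(addr0 0); exact: cvgD.
Qed.

Lemma cvg0_scale (c : R) u : u @ \oo --> (0 : R) ->
  (fun n => c * u n) @ \oo --> (0 : R).
Proof. by move=> u0; rewrite -(mulr0 c); apply: cvgMr. Qed.

Lemma cvg_eps (u : nat -> R) : (forall n, 0 <= u n) ->
  u @ \oo --> (0 : R) <->
  (forall e, 0 < e -> exists N, forall n, (N <= n)%N -> u n <= e).
Proof.
move=> u0; split=> [/cvgr0Pnorm_le uc e e0|h].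
  have [N _ hN] := uc e e0; exists N => n Nn.
  by have := hN n Nn; rewrite ger0_norm.
apply/cvgr0Pnorm_le => e e0; have [N hN] := h e e0.
by exists N => // n Nn; rewrite ger0_norm// hN.
Qed.

Lemma homo_ltn_ge (s : nat -> nat) : {homo s : i j / (i < j)%N} ->
  forall n, (n <= s n)%N.
Proof. by move=> hs; elim=> // n IH; exact: leq_ltn_trans IH (hs _ _ (ltnSn n)). Qed.

End RealSequences.

Section InnerProduct.
Variables (R : realType) (H : lmodType R[i]).
Implicit Types (f g h k e : H) (a : R[i]).

(** Only semidefinite, so that Cauchy-Schwarz applies both to the inner product and to the form <P
    f, g> of a positive operator, which may have a kernel. *)
Record herm_form (B : H -> H -> R[i]) : Prop := HermForm {
  hf_lin : forall a f g k, B (a *: f + g) k = a * B f k + B g k;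
  hf_conj : forall f g, B f g = (B g f)^*;
  hf_ge0 : forall f, 0 <= complex.Re (B f f) }.

Section Form.
Variable B : H -> H -> R[i].
Hypothesis hB : herm_form B.

Lemma formDl f g k : B (f + g) k = B f k + B g k.
Proof. by rewrite -[f in LHS]scale1r (hf_lin hB) mul1r. Qed.
Lemma form0l k : B 0 k = 0.
Proof. by apply: (addrI (B 0 k)); rewrite -formDl !addr0. Qed.
Lemma formZl a f k : B (a *: f) k = a * B f k.
Proof. by rewrite -[a *: f]addr0 (hf_lin hB) form0l addr0. Qed.
Lemma formNl f k : B (- f) k = - B f k.
Proof. by rewrite -scaleN1r formZl mulN1r. Qed.
Lemma formBl f g k : B (f - g) k = B f k - B g k.
Proof. by rewrite formDl formNl. Qed.
Lemma formDr f g k : B k (f + g) = B k f + B k g.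
Proof. by rewrite (hf_conj hB) formDl rmorphD/= -!(hf_conj hB). Qed.
Lemma formZr a f k : B k (a *: f) = a^* * B k f.
Proof. by rewrite (hf_conj hB) formZl rmorphM/= -(hf_conj hB). Qed.
Lemma formNr f k : B k (- f) = - B k f.
Proof. by rewrite (hf_conj hB) formNl rmorphN/= -(hf_conj hB). Qed.
Lemma formBr f g k : B k (f - g) = B k f - B k g.
Proof. by rewrite formDr formNr. Qed.
Lemma form0r k : B k 0 = 0.
Proof. by rewrite (hf_conj hB) form0l rmorph0. Qed.
Lemma form_suml (I : Type) (s : seq I) (F : I -> H) k :
  B (\sum_(i <- s) F i) k = \sum_(i <- s) B (F i) k.
Proof.
by elim: s => [|i s IH]; rewrite ?big_nil ?form0l// !big_cons formDl IH.
Qed.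
Lemma form_sumr (I : Type) (s : seq I) (F : I -> H) k :
  B k (\sum_(i <- s) F i) = \sum_(i <- s) B k (F i).
Proof.
by elim: s => [|i s IH]; rewrite ?big_nil ?form0r// !big_cons formDr IH.
Qed.

Lemma form_self f : B f f = (complex.Re (B f f))%:C%C.
Proof.
have /(congr1 (@complex.Im R)) := hf_conj hB f f; rewrite ImJ.
move=> h; apply: eqRI => //=; lra.
Qed.

Lemma Re_formC f g : complex.Re (B f g) = complex.Re (B g f).
Proof. by rewrite (hf_conj hB) ReJ. Qed.

Lemma form_sqB f g : complex.Re (B (f - g) (f - g)) =
  complex.Re (B f f) - 2 * complex.Re (B f g) + complex.Re (B g g).
Proof.
rewrite formBl !formBr !(ReD, ReN) (Re_formC g f); ring.
Qed.

Lemma form_CS f g : cmod (B f g) ^+ 2 <= complex.Re (B f f) * complex.Re (B g g).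
Proof.
set c := B f g; set x := complex.Re (B f f); set y := complex.Re (B g g).
have x0 : 0 <= x by exact: hf_ge0.
have y0 : 0 <= y by exact: hf_ge0.
(* Nonnegativity of B at f - t c g, a real polynomial in t. *)
have h (t : R) : 0 <= x - 2 * (t * cmod c ^+ 2) + t ^+ 2 * (cmod c ^+ 2 * y).
  have := hf_ge0 hB (f - (t%:C%C * c) *: g).
  rewrite form_sqB formZl !formZr -/c -/x => /le_trans; apply.
  rewrite (_ : (t%:C%C * c)^* * c = (t * cmod c ^+ 2)%:C%C); last first.
    rewrite rmorphM/= -mulrA (mulrC _ c) mulJ; apply: eqRI; rewrite ?ReM ?ImM /=; ring.
  rewrite (mulrA (t%:C%C * c)) mulJ ReM /= mul0r subr0 -/y cmodM cmod_real exprMn.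
  rewrite real_normK ?num_real// le_eqVlt; apply/orP; left; apply/eqP; ring.
move: (cmod c ^+ 2) (sqr_ge0 (cmod c)) h => q q0 h.
have [y_0|yn0] := eqVneq y 0.
  rewrite y_0 mulr0; have [->//|cn0] := eqVneq q 0.
  (* For y = 0 the polynomial is affine with slope - 2 q; at this t it would equal -1. *)
  have := h ((x + 1) / (2 * q)); rewrite y_0 !mulr0 addr0.
  rewrite (_ : 2 * _ = x + 1); last by field.
  lra.
have yp : 0 < y by rewrite lt_def yn0.
(* For y > 0 the polynomial is smallest at t = 1 / y. *)
have := h y^-1; rewrite (_ : _ + _ = x - q / y); last by field.
by rewrite subr_ge0 ler_pdivrMr.
Qed.

End Form.

Record inner_product (dot : H -> H -> R[i]) : Prop := InnerProduct {
  ip_form : herm_form dot;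
  ip_eq0 : forall f, complex.Re (dot f f) = 0 -> f = 0 }.

Variable dot : H -> H -> R[i].
Hypothesis ip : inner_product dot.
Let hf := ip_form ip.

Definition nsq f : R := complex.Re (dot f f).
Definition nrm f : R := Num.sqrt (nsq f).

Lemma nsq_ge0 f : 0 <= nsq f. Proof. exact: hf_ge0. Qed.
Lemma nrm_ge0 f : 0 <= nrm f. Proof. exact: sqrtr_ge0. Qed.
Lemma nrm_sq f : nrm f ^+ 2 = nsq f. Proof. by rewrite sqr_sqrtr// nsq_ge0. Qed.
Lemma nsq0 : nsq 0 = 0. Proof. by rewrite /nsq form0l. Qed.
Lemma nrm0 : nrm 0 = 0. Proof. by rewrite /nrm nsq0 sqrtr0. Qed.
Lemma nsqZ a f : nsq (a *: f) = cmod a ^+ 2 * nsq f.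
Proof.
rewrite /nsq formZl// formZr// mulrA mulJ ReM form_self//= mul0r subr0//.
Qed.
Lemma nrmZ a f : nrm (a *: f) = cmod a * nrm f.
Proof.
by rewrite /nrm nsqZ sqrtrM ?sqr_ge0// sqrtr_sqr ger0_norm// cmod_ge0.
Qed.
Lemma nrmN f : nrm (- f) = nrm f.
Proof. by rewrite -scaleN1r nrmZ cmodN cmod1 mul1r. Qed.
Lemma nrmC f g : nrm (f - g) = nrm (g - f).
Proof. by rewrite -nrmN opprB. Qed.
Lemma nrm_eq0 f : nrm f = 0 -> f = 0.
Proof. by move=> f0; apply: (ip_eq0 ip); rewrite -/(nsq f) -nrm_sq f0 expr0n. Qed.

Lemma dot_CS f g : cmod (dot f g) <= nrm f * nrm g.
Proof.
rewrite -ler_sqr ?nnegrE ?cmod_ge0 ?mulr_ge0 ?nrm_ge0//.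
by rewrite exprMn !nrm_sq; exact: form_CS.
Qed.

Lemma nrmD f g : nrm (f + g) <= nrm f + nrm g.
Proof.
rewrite -ler_sqr ?nnegrE ?addr_ge0 ?nrm_ge0// sqrrD !nrm_sq.
rewrite (_ : f + g = f - (- g)); last by rewrite opprK.
rewrite /nsq form_sqB// formNr// ReN formNl// formNr// opprK.
have := le_trans (Re_ge_Ncmod _) (dot_CS f g); lra.
Qed.

Lemma nrm_tri f g h : nrm (f - h) <= nrm (f - g) + nrm (g - h).
Proof. by have := nrmD (f - g) (g - h); rewrite addrA subrK. Qed.

Lemma nrm_diff f g : `|nrm f - nrm g| <= nrm (f - g).
Proof.
rewrite ler_norml; apply/andP; split.
  by have := nrmD (g - f) f; rewrite subrK nrmC; lra.
by have := nrmD (f - g) g; rewrite subrK; lra.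
Qed.

Definition Hcvg (u : nat -> H) (l : H) := (fun n => nrm (u n - l)) @ \oo --> (0 : R).

Lemma Hcvg_unique u l l' : Hcvg u l -> Hcvg u l' -> l = l'.
Proof.
move=> ul ul'; apply/eqP; rewrite -subr_eq0; apply/eqP/nrm_eq0.
have h : (fun _ : nat => nrm (l - l')) @ \oo --> (0 : R).
  apply: cvg0_sum_le ul ul' => n; rewrite nrm_ge0/= (nrmC _ l).
  exact: nrm_tri.
exact: (cvg_unique _ (cvg_cst _) h).
Qed.

Lemma Hcvg_dotl u l k : Hcvg u l ->
  (fun n => cmod (dot (u n) k - dot l k)) @ \oo --> (0 : R).
Proof.
move=> /(cvg0_scale (nrm k)); apply: cvg0_le => n.
by rewrite cmod_ge0/= -formBl// mulrC dot_CS.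
Qed.

Lemma Hcvg_nrm u l : Hcvg u l -> (fun n => nrm (u n)) @ \oo --> nrm l.
Proof.
move=> ul; apply/subr_cvg0/norm_cvg0P.
by apply: cvg0_le ul => n; rewrite normr_ge0 nrm_diff.
Qed.

Lemma HcvgD u v l m : Hcvg u l -> Hcvg v m -> Hcvg (fun n => u n + v n) (l + m).
Proof.
move=> ul vm; apply: cvg0_sum_le ul vm => n.
by rewrite nrm_ge0 opprD addrACA nrmD.
Qed.

Lemma HcvgZ a u l : Hcvg u l -> Hcvg (fun n => a *: u n) (a *: l).
Proof.
move=> /(cvg0_scale (cmod a)); apply: cvg0_le => n.
by rewrite nrm_ge0/= -scalerBr nrmZ.
Qed.

Definition Hcauchy (u : nat -> H) :=
  forall e : R, 0 < e -> exists N, forall i j, (N <= i)%N -> (N <= j)%N ->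
    nrm (u i - u j) <= e.

Lemma Hcvg_cauchy u l : Hcvg u l -> Hcauchy u.
Proof.
move=> /cvg_eps -/(_ (fun=> nrm_ge0 _)) h e e0.
have [N hN] := h (e / 2) (divr_gt0 e0 (ltr0Sn R 1)).
exists N => i j Ni Nj; rewrite (le_trans (nrm_tri _ l _))// (splitr e).
by rewrite lerD ?hN// nrmC hN.
Qed.

Section Orthogonal.
Variables (I : finType) (e : I -> H).
Hypothesis oe : forall i j, i != j -> dot (e i) (e j) = 0.

Lemma pythagoras (c : I -> R[i]) :
  nsq (\sum_i c i *: e i) = \sum_i cmod (c i) ^+ 2 * nsq (e i).
Proof.
rewrite /nsq form_suml// Re_sum.
apply: eq_bigr => i _; rewrite form_sumr// (bigD1 i)//= big1 ?addr0.
  exact: nsqZ.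
by move=> j ji; rewrite formZl// formZr// oe 1?eq_sym// !mulr0.
Qed.

Lemma bessel_id (f : H) : (forall i, nsq (e i) <= 1) ->
  nsq (f - \sum_i dot f (e i) *: e i) + \sum_i cmod (dot f (e i)) ^+ 2 <= nsq f.
Proof.
move=> e1; rewrite {1}/nsq form_sqB// -/(nsq _) -/(nsq _) pythagoras form_sumr//.
rewrite (eq_bigr (fun i => (cmod (dot f (e i)) ^+ 2)%:C%C)); last first.
  by move=> i _; rewrite formZr// mulrC mulJ.
rewrite -(rmorph_sum (real_complex R))/=.
have : \sum_i cmod (dot f (e i)) ^+ 2 * nsq (e i) <= \sum_i cmod (dot f (e i)) ^+ 2.
  by apply: ler_sum => i _; rewrite ler_piMr ?sqr_ge0.
lra.
Qed.

Lemma bessel (f : H) : (forall i, nsq (e i) <= 1) ->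
  \sum_i cmod (dot f (e i)) ^+ 2 <= nsq f.
Proof. by move=> /(bessel_id f); have := nsq_ge0 (f - \sum_i dot f (e i) *: e i); lra. Qed.

End Orthogonal.

Definition span_of (r : nat) (v : nat -> H) (x : H) :=
  exists c : nat -> R[i], x = \sum_(j < r) c j *: v j.

(** Indexing by nat, with only the first r terms relevant, keeps the induction free of casts between
    ordinals. The span is recorded because it makes orthonormalized eigenvectors eigenvectors
    again. *)
Lemma gram_schmidt (r : nat) (v : nat -> H) :
  (forall c : nat -> R[i], \sum_(j < r) c j *: v j = 0 ->
     forall j, (j < r)%N -> c j = 0) ->
  exists o : nat -> H, [/\ forall i j, (i < r)%N -> (j < r)%N -> i != j ->
      dot (o i) (o j) = 0, forall i, (i < r)%N -> nsq (o i) = 1 &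
      forall i, (i < r)%N -> span_of r v (o i)].
Proof.
elim: r => [|r IH] li; first by exists (fun=> 0).
have [] := IH.
  move=> c c0 j jr.
  have := li (fun i => if (i < r)%N then c i else 0); rewrite big_ord_recr/= ltnn scale0r addr0.
  move=> /(_ _ j (leqW jr)); rewrite jr; apply.
  by rewrite -[RHS]c0; apply: eq_bigr => i _; rewrite ltn_ord.
move=> o [oo o1 os].
pose w := v r - \sum_(j < r) dot (v r) (o j) *: o j.
(* The coefficient 1 at [v r] is what contradicts independence if w = 0. *)
have wspan : exists2 c : nat -> R[i], c r = 1 & w = \sum_(j < r.+1) c j *: v j.
  have [c cE] : exists c : nat -> R[i],
      \sum_(j < r) dot (v r) (o j) *: o j = \sum_(j < r) c j *: v j.
    have [C hC] : exists C : nat -> nat -> R[i], forall i, (i < r)%N ->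
        o i = \sum_(j < r) C i j *: v j.
      have h i : exists c : nat -> R[i], (i < r)%N -> o i = \sum_(j < r) c j *: v j.
        case: (ltnP i r) => ir; last by exists (fun=> 0).
        by have [c hc] := os i ir; exists c.
      by have [C hC] := choice h; exists C.
    exists (fun q : nat => \sum_(j < r) dot (v r) (o j) * C j q).
    rewrite (eq_bigr (fun j : 'I_r => \sum_(q < r) (dot (v r) (o j) * C j q) *: v q)).
      by rewrite exchange_big; apply: eq_bigr => q _; rewrite -scaler_suml.
    move=> j _; rewrite {2}(hC j (ltn_ord j)) scaler_sumr.
    by apply: eq_bigr => q _; rewrite scalerA.
  exists (fun j => if j == r then 1 else - c j); first by rewrite eqxx.
  rewrite big_ord_recr/= eqxx scale1r /w cE addrC -sumrN; congr (_ + _).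
  by apply: eq_bigr => i _; rewrite (ltn_eqF (ltn_ord i)) scaleNr.
have wn0 : w != 0.
  apply/eqP => w0; have [c c1 cE] := wspan.
  by have := li c (etrans (esym cE) w0) r (ltnSn r); rewrite c1 => /eqP; rewrite oner_eq0.
have nw0 : 0 < nrm w.
  by rewrite lt_def nrm_ge0 andbT; apply: contra wn0 => /eqP/nrm_eq0 ->.
pose o' i := if (i < r)%N then o i else (nrm w)^-1%:C%C *: w.
have wo i : (i < r)%N -> dot w (o i) = 0.
  move=> ir; rewrite /w formBl// form_suml// (bigD1 (Ordinal ir))//= big1 => [|j ji].
    rewrite addr0 formZl// (form_self hf (o i)) -/(nsq _) o1// mulr1 subrr//.
  by rewrite formZl// oo ?mulr0//; exact: contra ji.
exists o'; split.
- move=> i j; rewrite /o' !ltnS leq_eqVlt (leq_eqVlt j) => /predU1P[->|ir] /predU1P[->|jr].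
  + by rewrite eqxx.
  + by move=> _; rewrite ltnn jr formZl// wo// mulr0.
  + by move=> _; rewrite ltnn ir formZr// (hf_conj hf) wo// rmorph0 mulr0.
  + by move=> ij; rewrite ir jr oo.
- move=> i; rewrite /o' ltnS leq_eqVlt => /predU1P[->|ir]; last by rewrite ir o1.
  by rewrite ltnn nsqZ cmod_real ger0_norm ?invr_ge0 ?nrm_ge0// -nrm_sq exprVn mulVf// expf_neq0 ?gt_eqF.
- move=> i; rewrite /o' ltnS leq_eqVlt => /predU1P[->|ir].
    rewrite ltnn; have [c _ wE] := wspan.
    exists (fun j => (nrm w)^-1%:C%C * c j); rewrite {2}wE scaler_sumr.
    by apply: eq_bigr => j _; rewrite scalerA.
  rewrite ir; have [c ->] := os i ir; exists (fun j => if (j < r)%N then c j else 0).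
  rewrite big_ord_recr/= ltnn scale0r addr0.
  by apply: eq_bigr => j _; rewrite ltn_ord.
Qed.

End InnerProduct.

(** * Spectral theorem and square roots for compact positive operators *)

Section Spectral.
Variables (R : realType) (H : lmodType R[i]) (dot : H -> H -> R[i]).
Hypothesis ip : inner_product dot.
Let hf := ip_form ip.
Local Notation nsq := (nsq dot).
Local Notation nrm := (nrm dot).
Local Notation Hcvg := (Hcvg dot).
Implicit Types (f g h k e : H) (a : R[i]).

Definition Hlinear (P : H -> H) := forall a f g, P (a *: f + g) = a *: P f + P g.
Definition Hbounded (P : H -> H) := exists2 c : R, 0 <= c & forall f, nrm (P f) <= c * nrm f.
Definition Hcompact (P : H -> H) := forall (u : nat -> H) (c : R),
  (forall i, nrm (u i) <= c) ->
  exists (s : nat -> nat) (h : H), {homo s : i j / (i < j)%N} /\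
    Hcvg (fun i => P (u (s i))) h.
Definition Hsym (P : H -> H) := forall f g, dot (P f) g = dot f (P g).
Definition Hpos (P : H -> H) := forall f, 0 <= complex.Re (dot (P f) f).

Section LinearTheory.
Variable P : H -> H.
Hypothesis linP : Hlinear P.

Lemma HlinD f g : P (f + g) = P f + P g.
Proof. by rewrite -[f in LHS]scale1r linP scale1r. Qed.
Lemma Hlin0 : P 0 = 0.
Proof. by apply: (addrI (P 0)); rewrite -HlinD !addr0. Qed.
Lemma HlinZ a f : P (a *: f) = a *: P f.
Proof. by rewrite -[a *: f]addr0 linP Hlin0 addr0. Qed.
Lemma HlinN f : P (- f) = - P f.
Proof. by rewrite -scaleN1r HlinZ scaleN1r. Qed.
Lemma HlinB f g : P (f - g) = P f - P g.
Proof. by rewrite HlinD HlinN. Qed.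
Lemma Hlin_sum (I : Type) (s : seq I) (F : I -> H) :
  P (\sum_(i <- s) F i) = \sum_(i <- s) P (F i).
Proof. by elim: s => [|i s IH]; rewrite ?big_nil ?Hlin0// !big_cons HlinD IH. Qed.

Lemma Hcvg_lin : Hbounded P -> forall u l, Hcvg u l -> Hcvg (fun i => P (u i)) (P l).
Proof.
move=> [c c0 Pc] u l /(cvg0_scale c); apply: cvg0_le => n.
by rewrite nrm_ge0 -HlinB Pc.
Qed.

End LinearTheory.

Section Top.
Variable P : H -> H.
Hypotheses (linP : Hlinear P) (symP : Hsym P) (posP : Hpos P).
Hypotheses (bndP : Hbounded P) (cmpP : Hcompact P).

Lemma sym_form : herm_form (fun f g => dot (P f) g).
Proof.
split=> // [a f g k|f g].
  by rewrite linP (hf_lin hf).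
by rewrite symP (hf_conj hf).
Qed.

Definition perp (es : seq H) f := forall e, e \in es -> dot f e = 0.

(** The supremum of the Rayleigh quotient on the orthogonal complement of es. The unit ball in place
    of the sphere keeps the set nonempty when that complement is trivial; the value is then 0. *)
Definition top (es : seq H) : R :=
  sup [set x | exists f, [/\ perp es f, nsq f <= 1 & x = complex.Re (dot (P f) f)]].

Lemma perpZ es a f : perp es f -> perp es (a *: f).
Proof. by move=> pf e /pf h; rewrite formZl// h mulr0. Qed.

Lemma top_has_sup es :
  has_sup [set x | exists f, [/\ perp es f, nsq f <= 1 & x = complex.Re (dot (P f) f)]].
Proof.
have [c c0 Pc] := bndP; split.
  exists 0, 0; split; first by move=> e _; rewrite form0l.
    by rewrite nsq0.
  by rewrite Hlin0// form0l.
exists c => _ [f [_ f1 ->]].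
apply: le_trans (Re_ge_Ncmod _) (le_trans (dot_CS ip _ _) _).
have n1 : nrm f <= 1 by rewrite -(expr_le1 (n := 2)) ?nrm_ge0// nrm_sq.
apply: (le_trans (ler_pM (nrm_ge0 _ _) (nrm_ge0 _ _) (Pc f) (lexx _))).
by rewrite -mulrA ler_piMr// mulr_ile1 ?nrm_ge0.
Qed.

Lemma top_ge0 es : 0 <= top es.
Proof.
apply: sup_upper_bound; first exact: top_has_sup.
exists 0; split; first by move=> e _; rewrite form0l.
  by rewrite nsq0.
by rewrite Hlin0// form0l.
Qed.

Lemma top_ub es f : perp es f -> complex.Re (dot (P f) f) <= top es * nsq f.
Proof.
move=> pf; have [f0|fn0] := eqVneq (nrm f) 0.
  by rewrite (nrm_eq0 ip f0) Hlin0// form0l// nsq0// mulr0.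
have nf : 0 < nrm f by rewrite lt_def fn0 nrm_ge0.
rewrite -ler_pdivrMr -?nrm_sq ?exprn_gt0//.
apply: sup_upper_bound; first exact: top_has_sup.
exists ((nrm f)^-1%:C%C *: f); split; first exact: perpZ.
  by rewrite nsqZ// cmod_real ger0_norm ?invr_ge0 ?nrm_ge0// -nrm_sq// exprVn mulVf// expf_neq0.
rewrite HlinZ// formZl// formZr// mulrA mulJ cmod_real ReM /= mul0r subr0.
by rewrite ger0_norm ?invr_ge0 ?nrm_ge0// exprVn mulrC.
Qed.

Lemma le_top es es' : {subset es <= es'} -> top es' <= top es.
Proof.
move=> ee'; apply: sup_le_ub; first by case: (top_has_sup es').
move=> _ [f [pf f1 ->]]; apply: le_trans (top_ub _) _.
  by move=> e /ee' /pf.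
by rewrite ler_piMr// top_ge0.
Qed.

Definition eigs (es : seq H) := forall e, e \in es -> exists l : R, P e = l%:C%C *: e.

Lemma perp_inv es f : eigs es -> perp es f -> perp es (P f).
Proof.
move=> ees pf e ee; have [l Pe] := ees e ee.
by rewrite symP Pe formZr// pf// mulr0.
Qed.

(** Cauchy-Schwarz for the form <P f, g> at f and P f gives |P f|^4 <= <P f, f> <P P f, P f>. Both
    factors are controlled by [top], since P f stays orthogonal to the eigenvectors es. *)
Lemma top_nrm es f : eigs es -> perp es f -> nrm (P f) <= top es * nrm f.
Proof.
move=> ees pf; have [->|Pn0] := eqVneq (nrm (P f)) 0.
  by rewrite mulr_ge0 ?top_ge0 ?nrm_ge0.
have Pf0 : 0 < nrm (P f) by rewrite lt_def Pn0 nrm_ge0.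
have := form_CS sym_form f (P f).
rewrite form_self// cmod_real ger0_norm ?nsq_ge0// -/(nsq _) -(nrm_sq ip) => h.
have h1 := top_ub pf; have h2 := top_ub (perp_inv ees pf).
have h3 : (nrm (P f) ^+ 2) ^+ 2 <= (top es * nrm f * nrm (P f)) ^+ 2.
  apply: le_trans h _; apply: le_trans (ler_pM _ _ h1 h2) _; [exact: posP|exact: posP|].
  by rewrite -!(nrm_sq ip) !exprMn (mulrACA (top es)) -expr2 mulrA.
move: h3; rewrite ler_sqr ?nnegrE ?sqr_ge0 ?mulr_ge0 ?top_ge0 ?nrm_ge0//.
by rewrite expr2 ler_pM2r.
Qed.

Lemma nsqB_real f (l : R) :
  nsq (P f - l%:C%C *: f) =
  nsq (P f) - 2 * l * complex.Re (dot (P f) f) + l ^+ 2 * nsq f.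
Proof.
rewrite /nsq form_sqB// -/(nsq _) -/(nsq (_ *: _)) nsqZ// cmod_real real_normK ?num_real//.
rewrite formZr//; congr (_ - _ + _); rewrite -mulrA; congr (_ * _).
by rewrite ReM /=; ring.
Qed.

(** Along a maximizing sequence v, |P v - l v|^2 <= 2 l (l - <P v, v>) tends to 0. Compactness makes
    P v converge along a subsequence, hence also v, because l > 0. *)
Lemma top_attained es : eigs es -> 0 < top es ->
  exists e, [/\ perp es e, nsq e = 1 & P e = (top es)%:C%C *: e].
Proof.
set l := top es => ees l0.
have [u hu] : {u : nat -> H & forall i, [/\ perp es (u i), nsq (u i) <= 1 &
    l - i.+1%:R^-1 <= complex.Re (dot (P (u i)) (u i))]}.
  apply: (@choice _ _ (fun i f => [/\ perp es f, nsq f <= 1 &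
    l - i.+1%:R^-1 <= complex.Re (dot (P f) f)])) => i.
  have e0 : 0 < (i.+1%:R^-1 : R) by rewrite invr_gt0.
  have [_ [f [pf f1 ->]] lt] := sup_adherent e0 (top_has_sup es).
  by exists f; split=> //; exact: ltW.
have n1 i : nrm (u i) <= 1.
  by rewrite -(expr_le1 (n := 2)) ?nrm_ge0// nrm_sq//; have [] := hu i.
have [s [h [hs Ph]]] := cmpP n1.
pose v i := u (s i).
(* As s i >= i, the subsequence keeps the accuracy 1 / (i + 1). *)
have hv i : [/\ perp es (v i), nsq (v i) <= 1 &
    l - i.+1%:R^-1 <= complex.Re (dot (P (v i)) (v i))].
  have [h1 h2 h3] := hu (s i); split=> //; apply: le_trans h3.
  by rewrite lerD2l lerN2 lef_pV2 ?posrE// ler_nat ltnS homo_ltn_ge.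
have inv0 : (fun i => i.+1%:R^-1 : R) @ \oo --> (0 : R) by exact: cvg_harmonic.
have d0 : (fun i => nsq (P (v i) - l%:C%C *: v i)) @ \oo --> (0 : R).
  apply: cvg0_le (cvg0_scale (2 * l) inv0) => i; rewrite nsq_ge0//= nsqB_real.
  have [pv v1 hl] := hv i.
  have : nsq (P (v i)) <= l ^+ 2 * nsq (v i).
    rewrite -!nrm_sq// -exprMn ler_sqr ?nnegrE ?mulr_ge0 ?nrm_ge0 ?(ltW l0)//.
    exact: (top_nrm ees pv).
  have : l ^+ 2 * nsq (v i) <= l ^+ 2 by rewrite ler_piMr ?sqr_ge0.
  have : 2 * l * (l - i.+1%:R^-1) <= 2 * l * complex.Re (dot (P (v i)) (v i)).
    by rewrite ler_pM2l// mulr_gt0.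
  move: (i.+1%:R^-1) (complex.Re _) (nsq (v i)) (nsq (P _)) => q r b a'.
  have -> : 2 * l * (l - q) = 2 * l ^+ 2 - 2 * l * q by ring.
  by lra.
have d1 : (fun i => nrm (P (v i) - l%:C%C *: v i)) @ \oo --> (0 : R).
  rewrite -(@sqrtr0 R); rewrite /nrm.
  by apply: (continuous_cvg _ _ d0); exact: sqrt_continuous.
pose e := l^-1%:C%C *: h.
have ve : Hcvg v e.
  have d2 : (fun i => nrm (P (v i) - l%:C%C *: v i) + nrm (P (v i) - h)) @ \oo --> (0 : R).
    by rewrite -(addr0 0); apply: cvgD.
  have := cvg0_scale (l^-1) d2.
  apply: cvg0_le => i; rewrite nrm_ge0/=.
  have -> : v i - e = l^-1%:C%C *: (l%:C%C *: v i - h).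
    by rewrite scalerBr scalerA -rmorphM mulVf ?gt_eqF// scale1r.
  rewrite nrmZ// cmod_real ger0_norm ?invr_ge0 ?(ltW l0)// ler_pM2l ?invr_gt0//.
  by rewrite (nrmC ip (P (v i)) (_ *: _)); exact: nrm_tri.
have Pe : P e = l%:C%C *: e.
  rewrite (Hcvg_unique ip (Hcvg_lin linP bndP ve) Ph) /e scalerA -rmorphM.
  by rewrite mulfV ?gt_eqF// scale1r.
have sqe : (fun i => nsq (v i)) @ \oo --> nsq e.
  under eq_fun do rewrite -nrm_sq//.
  by rewrite -nrm_sq// expr2; under eq_fun do rewrite expr2; apply: cvgM; exact: Hcvg_nrm.
exists e; split=> //.
- move=> k ke; have pk i : dot (v i) k = 0 by have [pv _ _] := hv i; exact: pv.
  apply: (@cvg_cmod_unique _ _ \oo _ (fun i => dot (v i) k)).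
    exact: Hcvg_dotl.
  by under eq_fun do rewrite pk subrr cmod0; exact: cvg_cst.
- apply/eqP; rewrite eq_le; apply/andP; split.
    by apply: (cvgr_to_le sqe); apply: nearW => i; have [] := hv i.
  (* The limit keeps norm 1 since l - 1 / (i + 1) <= <P v, v> <= l |v|^2. *)
  have h1 : (fun i => 1 - l^-1 * i.+1%:R^-1) @ \oo --> (1 : R).
    by rewrite -[X in _ --> X]subr0; apply: cvgB (cvg_cst _) (cvg0_scale _ inv0).
  apply: (ler_cvg_to h1 sqe); apply: nearW => i.
  have [pv _ hl] := hv i; rewrite -(ler_pM2l l0) mulrBr mulr1 mulrA mulfV ?gt_eqF// mul1r.
  exact: le_trans hl (top_ub pv).
Qed.

(** For a list es of eigenvectors the default 0 is reached only when nothing but 0 is orthogonal to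
    es, as happens in finite dimension. The sequence then continues with zero vectors and zero
    eigenvalues. *)
Definition nexte (es : seq H) : H :=
  if pselect (exists e, [/\ perp es e, nsq e = 1 & P e = (top es)%:C%C *: e])
  is left h then sval (cid h) else 0.

Definition eig_list (n : nat) : seq H := iter n (fun es => rcons es (nexte es)) [::].
Definition eig_vec (n : nat) : H := nexte (eig_list n).
Definition eig_val (n : nat) : R := top (eig_list n).

Lemma mem_eig_list n e : (e \in eig_list n) <-> exists2 j, (j < n)%N & e = eig_vec j.
Proof.
elim: n => [|n IH]; first by split=> // -[].
rewrite [eig_list _]/= mem_rcons inE; split=> [/predU1P[->|en]|[j]].
- by exists n.
- by have [j jn ->] := IH.1 en; exists j => //; exact: leqW.
- rewrite ltnS leq_eqVlt => /predU1P[-> ->|jn eE]; first by rewrite eqxx.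
  by apply/orP; right; apply: IH.2; exists j.
Qed.

Lemma nexteP es : P (nexte es) = (top es)%:C%C *: nexte es /\
  perp es (nexte es) /\
  (nsq (nexte es) = 1 \/ (nexte es = 0 /\ (eigs es -> top es = 0))).
Proof.
rewrite /nexte; case: pselect => [h|nh].
  by case: (cid h) => e /= [pe e1 Pe]; split=> //; split=> //; left.
split; first by rewrite Hlin0// scaler0.
split; first by move=> e _; rewrite form0l.
right; split=> // ees; apply/eqP; apply: contra_notT nh => tn0.
by apply: top_attained => //; rewrite lt_def tn0 top_ge0.
Qed.

Lemma eigs_list n : eigs (eig_list n).
Proof.
move=> e /mem_eig_list[j _ ->]; exists (eig_val j).
by have [] := nexteP (eig_list j).
Qed.

Theorem spectral_theorem : exists (e : nat -> H) (l : nat -> R),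
  [/\ forall j, 0 <= l j /\ P (e j) = (l j)%:C%C *: e j,
      forall i j, i != j -> dot (e i) (e j) = 0,
      forall j, nsq (e j) = 1 \/ (e j = 0 /\ l j = 0),
      (forall i j, (i <= j)%N -> l j <= l i) /\ l @ \oo --> (0 : R) &
      forall f N, nrm (P (f - \sum_(j < N) dot f (e j) *: e j)) <= l N * nrm f].
Proof.
exists eig_vec, eig_val.
have eqP_ j : P (eig_vec j) = (eig_val j)%:C%C *: eig_vec j by case: (nexteP (eig_list j)).
have l0 j : 0 <= eig_val j by exact: top_ge0.
have e1 j : nsq (eig_vec j) = 1 \/ (eig_vec j = 0 /\ eig_val j = 0).
  have [_ [_ [h1|[h0 h]]]] := nexteP (eig_list j); [by left|right].
  by split=> //; apply: h; exact: eigs_list.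
have olt i j : (i < j)%N -> dot (eig_vec j) (eig_vec i) = 0.
  move=> ij; have [_ [h _]] := nexteP (eig_list j); apply: h.
  by apply/mem_eig_list; exists i.
have oe i j : i != j -> dot (eig_vec i) (eig_vec j) = 0.
  rewrite neq_ltn => /orP[ij|/olt//].
  by rewrite (hf_conj hf) olt// rmorph0.
have ldec i j : (i <= j)%N -> eig_val j <= eig_val i.
  move=> ij; apply: le_top => e /mem_eig_list[q qi ->]; apply/mem_eig_list.
  by exists q => //; exact: leq_trans ij.
have nle1 j : nsq (eig_vec j) <= 1 by case: (e1 j) => [->//|[-> _]]; rewrite nsq0.
split=> //.
(* If the decreasing eigenvalues stayed above eps, the images of the orthonormal eigenvectors would
   be pairwise at distance at least eps, and no subsequence of them could be Cauchy. *)
- split=> //; apply/cvg_eps => // eps eps0; apply: contrapT => /forallNP nN.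
  have lge n : eps <= eig_val n.
    have /existsNP[q /not_implyP[nq /negP]] := nN n; rewrite -ltNge => h.
    exact: le_trans (ltW h) (ldec _ _ nq).
  have n1 i : nrm (eig_vec i) <= 1 by rewrite -(expr_le1 (n := 2)) ?nrm_ge0// nrm_sq.
  have [s [h [hs /(Hcvg_cauchy ip)]]] := cmpP n1.
  move=> /(_ (eps / 2)); rewrite divr_gt0// => /(_ isT)[N hN].
  have := hN N N.+1 (leqnn _) (leqnSn _).
  have sne : s N != s N.+1 by rewrite ltn_eqF// hs.
  have : eps ^+ 2 <= nrm (P (eig_vec (s N)) - P (eig_vec (s N.+1))) ^+ 2.
    have cr : dot (P (eig_vec (s N))) (P (eig_vec (s N.+1))) = 0.
      by rewrite !eqP_ formZl// formZr// oe// !mulr0.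
    rewrite nrm_sq// /nsq form_sqB// cr mulr0 subr0 !eqP_.
    rewrite -/(nsq _) -/(nsq _) !nsqZ// !cmod_real !real_normK ?num_real//.
    have n11 q : nsq (eig_vec q) = 1.
      by case: (e1 q) => // -[_ lq]; have := lge q; rewrite lq leNgt eps0.
    rewrite !n11 !mulr1 (@le_trans _ _ (eig_val (s N) ^+ 2))//.
      by rewrite ler_sqr ?nnegrE ?(ltW eps0).
    by rewrite lerDl sqr_ge0.
  rewrite ler_sqr ?nnegrE ?nrm_ge0 ?(ltW eps0)// => h1 h2.
  have := le_trans h1 h2; rewrite ler_pdivlMr// ger_pMr//; lra.
- move=> f N; set g := f - _.
  have pg : perp (eig_list N) g.
    move=> e /mem_eig_list[q qN ->]; rewrite /g formBl// form_suml//.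
    rewrite (bigD1 (Ordinal qN))//= big1 => [|i iq].
      rewrite addr0 formZl// form_self// -/(nsq _).
      case: (e1 q) => [->|[-> _]]; first by rewrite mulr1 subrr.
      by rewrite form0r// mul0r subr0.
    by rewrite formZl// oe ?mulr0//; exact: contra iq.
  apply: le_trans (top_nrm (@eigs_list N) pg) _.
  apply: ler_wpM2l; first exact: l0.
  rewrite -(@ler_sqr _ (nrm g)) ?nnegrE ?nrm_ge0// !nrm_sq//.
  have oN (i j : 'I_N) : i != j -> dot (eig_vec i) (eig_vec j) = 0 by exact: oe.
  have := bessel_id ip oN f (fun i => nle1 i).
  have : 0 <= \sum_(i < N) cmod (dot f (eig_vec i)) ^+ 2.
    by apply: sumr_ge0 => i _; exact: sqr_ge0.
  by rewrite -/g; lra.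
Qed.

End Top.

(* The spectral data of P turn sum_j sqrt(l_j) <f, e_j> e_j into a square root. *)
Theorem positive_sqrt (P : H -> H) :
  (forall u, Hcauchy dot u -> exists l, Hcvg u l) ->
  Hlinear P -> Hsym P -> Hpos P -> Hbounded P -> Hcompact P ->
  exists S : H -> H, [/\ Hlinear S, Hbounded S,
    forall f, 0 <= dot (S f) f & forall f, S (S f) = P f].
Proof.
move=> compl linP symP posP bndP cmpP.
have [e [l [le oe e1 [ldec lcvg] Pf]]] := spectral_theorem linP symP posP bndP cmpP.
pose r j := Num.sqrt (l j).
pose S_ f n := \sum_(j < n) ((r j)%:C%C * dot f (e j)) *: e j.
have nle1 j : nsq (e j) <= 1 by case: (e1 j) => [->//|[-> _]]; rewrite nsq0.
have nle0 j : 0 <= nsq (e j) by exact: nsq_ge0.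
have r2 j : r j ^+ 2 = l j by rewrite sqr_sqrtr//; have [] := le j.
have oN N (i j : 'I_N) : i != j -> dot (e i) (e j) = 0 by exact: oe.
(* A block of the partial sums carries the factors r_j^2 = l_j <= l_m, so Bessel bounds it; as l
   tends to 0, the partial sums are Cauchy. *)
have Sdiff f m n : (m <= n)%N -> nsq (S_ f n - S_ f m) <= l m * nsq f.
  move=> mn.
  have -> : S_ f n - S_ f m = \sum_(j < n) (if (m <= j)%N then (r j)%:C%C * dot f (e j) else 0) *: e j.
    rewrite /S_ -(subnKC mn) !big_split_ord/= [X in _ = X + _]big1; last first.
      by move=> i _; rewrite leqNgt ltn_ord scale0r.
    rewrite add0r addrAC subrr add0r; apply: eq_bigr => i _.
    by rewrite leq_addr.
  rewrite (pythagoras ip (oN n)).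
  have h : \sum_(j < n) l m * cmod (dot f (e j)) ^+ 2 <= l m * nsq f.
    rewrite -mulr_sumr ler_wpM2l//; first by have [] := le m.
    by apply: (bessel ip (oN n)).
  apply: le_trans h; apply: ler_sum => j _; case: leqP => mj.
    rewrite cmodM cmod_real exprMn real_normK ?num_real// r2 -mulrA.
    apply: ler_pM; [exact: (le j).1| |exact: ldec|].
      by rewrite mulr_ge0 ?sqr_ge0.
    by rewrite ler_piMr ?sqr_ge0.
  by rewrite cmod0 expr0n mul0r mulr_ge0 ?sqr_ge0//; have [] := le m.
have Scau f : Hcauchy dot (S_ f).
  move=> eps eps0.
  have q0 : 0 < eps ^+ 2 / (nsq f + 1) by rewrite divr_gt0 ?exprn_gt0// ltr_wpDl// nsq_ge0.
  have /cvg_eps h := lcvg.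
  have [N hN] := (h (fun j => (le j).1)) _ q0.
  exists N.
  have key i j : (N <= i)%N -> (i <= j)%N -> nrm (S_ f j - S_ f i) <= eps.
    move=> Ni ij; rewrite -ler_sqr ?nnegrE ?nrm_ge0 ?(ltW eps0)// nrm_sq//.
    apply: le_trans (Sdiff f _ _ ij) _.
    have := hN i Ni; rewrite ler_pdivlMr ?ltr_wpDl ?nsq_ge0//.
    by apply: le_trans; rewrite ler_wpM2l ?lerDl//; have [] := le i.
  move=> i j Ni Nj; case: (leqP i j) => [ij|/ltnW ji]; last exact: key.
  by rewrite nrmC//; exact: key.
have [S hS] := choice (fun f => compl _ (Scau f)).
have linS : Hlinear S.
  move=> a f g; apply: (Hcvg_unique ip (hS _)).
  have := HcvgD ip (HcvgZ ip a (hS f)) (hS g).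
  rewrite /Hcvg; under eq_fun => n.
    rewrite (_ : a *: S_ f n + S_ g n = S_ (a *: f + g) n); first over.
    rewrite /S_ scaler_sumr -big_split/=; apply: eq_bigr => j _.
    by rewrite scalerA -scalerDl formDl// formZl//; congr (_ *: _); ring.
  by [].
have Sn0 f n : nsq (S_ f n) <= l 0%N * nsq f.
  by have := Sdiff f 0%N n (leq0n n); rewrite /S_ big_ord0 subr0.
have bndS : Hbounded S.
  exists (Num.sqrt (l 0%N)) => [|f]; first exact: sqrtr_ge0.
  apply: (cvgr_to_le (Hcvg_nrm ip (hS f))); apply: nearW => n.
  rewrite /nrm -sqrtrM; last by have [] := le 0%N.
  by rewrite ler_sqrt ?mulr_ge0 ?nsq_ge0//; have [] := le 0%N.
have Se j : S (e j) = (r j)%:C%C *: e j.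
  apply: (Hcvg_unique ip (hS _)); apply/cvg_eps => [n|eps eps0]; first exact: nrm_ge0.
  exists j.+1 => n jn; rewrite /S_ (bigD1 (Ordinal jn))//= big1 => [|i ij].
    rewrite addr0 form_self// -/(nsq _).
    by case: (e1 j) => [->|[-> _]]; rewrite ?mulr1 ?scaler0 subrr nrm0// ltW.
  by rewrite oe ?mulr0 ?scale0r// eq_sym; exact: contra ij.
exists S; split=> // f.
  rewrite complex_ge0P; apply/andP.
  have sym n : dot (S_ f n) f = (\sum_(j < n) r j * cmod (dot f (e j)) ^+ 2)%:C%C.
    rewrite /S_ form_suml// rmorph_sum/=; apply: eq_bigr => j _.
    by rewrite formZl// (hf_conj hf (e j)) -mulrA mulJ -rmorphM.
  have /cvg_cmodP[hr hi] := Hcvg_dotl ip f (hS f); split.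
    have h0 : (fun n => complex.Im (dot (S_ f n) f)) @ \oo --> (0 : R).
      rewrite (_ : (fun n => _) = fun=> 0); first exact: cvg_cst.
      by apply/funext => n; rewrite sym.
    by apply/eqP; exact: (cvg_unique _ hi h0).
  apply: (cvgr_to_ge hr); apply: nearW => n; rewrite sym/=.
  by apply: sumr_ge0 => j _; rewrite mulr_ge0 ?sqrtr_ge0 ?sqr_ge0.
pose p n := \sum_(j < n) dot f (e j) *: e j.
(* On partial sums the square of S acts as P does on the truncated expansion, and the image under P
   of the remainder tends to 0. *)
have SS n : S (S_ f n) = P (p n).
  rewrite /S_ /p (Hlin_sum linS) (Hlin_sum linP); apply: eq_bigr => j _.
  rewrite (HlinZ linS) (HlinZ linP) Se (le j).2 !scalerA; congr (_ *: _).
  by rewrite mulrAC -rmorphM/= -expr2 r2 mulrC.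
apply: (Hcvg_unique ip (Hcvg_lin linS bndS (hS f))).
under [X in Hcvg X _]eq_fun do rewrite SS.
have := cvg0_scale (nrm f) lcvg; apply: cvg0_le => n; rewrite nrm_ge0 /=.
by rewrite nrmC// -(HlinB linP) mulrC Pf.
Qed.

End Spectral.

(** * The space l^2(Z^n) *)

Section CountingMeasure.
Variables (R : realType) (n : nat).
Local Notation Z := (Zn n).
Local Notation mZ := (@muZ R n).

Lemma meas_Z d (T : measurableType d) (f : Z -> T) : measurable_fun [set: Z] f.
Proof. by move=> _ Y mY. Qed.

Lemma cmeas_Z (f : Z -> R[i]) : cmeasurable f.
Proof. by split; exact: meas_Z. Qed.

(** Since Z^n is countable, a preimage is a countable union of slices over single points. *)
Lemma meas_ZX d d' (X : measurableType d) (Y : measurableType d') (f : Z * X -> Y) :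
  (forall k, measurable_fun [set: X] (fun x => f (k, x))) ->
  measurable_fun [set: Z * X] f.
Proof.
move=> mf _ B mB; rewrite setTI.
have -> : f @^-1` B = \bigcup_i (if @unpickle Z i is Some k
    then [set k] `*` ((fun x => f (k, x)) @^-1` B) else set0).
  apply/seteqP; split=> [[k x] /= Bf|[k x] [i _]].
    by exists (pickle k) => //; rewrite pickleK.
  by case: unpickle => // k' [/= -> ].
apply: bigcupT_measurable => i; case: unpickle => // k.
apply: measurableX => //.
by have := mf k measurableT B mB; rewrite setTI.
Qed.

Lemma meas_XZ d d' (X : measurableType d) (Y : measurableType d') (f : X * Z -> Y) :
  (forall k, measurable_fun [set: X] (fun x => f (x, k))) ->
  measurable_fun [set: X * Z] f.
Proof.
move=> mf; have h := @meas_ZX _ _ _ _ (fun z => f (z.2, z.1)) mf.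
rewrite (_ : f = (fun z => f (z.2, z.1)) \o (fun z => (z.2, z.1))); last first.
  by apply/funext => -[].
apply: (measurableT_comp h); exact: measurable_swap.
Qed.

Lemma cmeas_ZX d (X : measurableType d) (f : Z * X -> R[i]) :
  (forall k, cmeasurable (fun x => f (k, x))) -> cmeasurable f.
Proof. by move=> mf; split; apply: meas_ZX => k; case: (mf k). Qed.

Lemma cmeas_XZ d (X : measurableType d) (f : X * Z -> R[i]) :
  (forall k, cmeasurable (fun x => f (x, k))) -> cmeasurable f.
Proof. by move=> mf; split; apply: meas_XZ => k; case: (mf k). Qed.

Lemma muZ1 (a : Z) : mZ [set a] = 1%E.
Proof.
rewrite /muZ /counting asboolT; last exact: finite_set1.
by rewrite fset_set1 finmap.cardfs1.
Qed.

Lemma intZ_set1 (a : Z) (h : Z -> \bar R) : (\int[mZ]_(k in [set a]) h k = h a)%E.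
Proof.
rewrite (eq_integral (fun=> h a)); last by move=> k; rewrite inE => ->.
by rewrite (integral_cst _ _ (h a))//= muZ1 mule1.
Qed.

Lemma intZ_single (a : Z) (h : Z -> \bar R) : (forall k, k != a -> h k = 0%E) ->
  (\int[mZ]_k h k = h a)%E.
Proof.
move=> h0; rewrite -(intZ_set1 a) [RHS]integral_mkcond; apply: eq_integral => k _.
rewrite patchE; case: ifPn => // /negP; rewrite inE/= => ka.
by rewrite h0//; apply/eqP.
Qed.

Lemma intZ_ge (a : Z) (h : Z -> \bar R) : (forall k, 0 <= h k)%E ->
  (h a <= \int[mZ]_k h k)%E.
Proof.
move=> h0; rewrite -(intZ_set1 a); exact: ge0_subset_integral.
Qed.

Lemma muZ_bij (phi psi : Z -> Z) (A : set Z) : cancel phi psi -> cancel psi phi ->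
  mZ (phi @^-1` A) = mZ A.
Proof.
move=> pK qK; have -> : phi @^-1` A = psi @` A.
  apply/seteqP; split=> [k Ak|_ [k Ak <-]]; last by rewrite /= qK.
  by exists (phi k).
have ce : (psi @` A #= A)%card by apply: inj_card_eq => x y _ _; exact: (can_inj qK).
rewrite /muZ /counting; case: (pselect (finite_set A)) => fA.
  have fA' : finite_set (psi @` A) by exact: finite_image.
  by rewrite !asboolT//; congr _%:E; congr _%:R; apply/fcard_eq.
rewrite !asboolF// => fpA; apply: fA; by rewrite -(eq_finite_set ce).
Qed.

Lemma intZ_bij (phi psi : Z -> Z) (h : Z -> \bar R) : cancel phi psi -> cancel psi phi ->
  (forall k, 0 <= h k)%E -> (\int[mZ]_k h (phi k) = \int[mZ]_k h k)%E.
Proof.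
move=> pK qK h0.
have := @ge0_integral_pushforward _ _ _ _ R phi (meas_Z phi) mZ setT h measurableT (meas_Z h) (fun k _ => h0 k).
rewrite preimage_setT => <-; apply: eq_measure_integral => [|mphi A _ _]; first exact: (meas_Z phi).
exact: (muZ_bij A pK qK).
Qed.

Lemma intZ_shift (m : Z) (h : Z -> \bar R) : (forall k, 0 <= h k)%E ->
  (\int[mZ]_k h (k - m)%R = \int[mZ]_k h k)%E.
Proof.
move=> h0; apply: (@intZ_bij (fun k => k - m) (fun k => k + m)) => // k.
  exact: subrK.
exact: addrK.
Qed.

Lemma intZ_refl (m : Z) (h : Z -> \bar R) : (forall k, 0 <= h k)%E ->
  (\int[mZ]_k h (m - k)%R = \int[mZ]_k h k)%E.
Proof.
move=> h0; apply: (@intZ_bij (fun k => m - k) (fun k => m - k)) => // k;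
  by rewrite opprB addrC subrK.
Qed.

Lemma cintZ_single (a : Z) (f : Z -> R[i]) : (forall k, k != a -> f k = 0) ->
  cintegrable mZ f /\ cint mZ f = f a.
Proof.
move=> f0; split.
  apply/cintegrableP; split; first exact: cmeas_Z.
  by rewrite (@intZ_single a) ?ltry// => k /f0 ->; rewrite cmod0.
by apply: eqRI; rewrite /cint/= /Rintegral (@intZ_single a)// => k /f0 ->.
Qed.

End CountingMeasure.

Section SquareSummable.
Variables (R : realType) (n : nat).
Local Notation Z := (Zn n).
Local Notation mZ := (@muZ R n).
Implicit Types (f g h : Z -> R[i]).

Definition sqn f : \bar R := (\int[mZ]_k (cmod (f k) ^+ 2)%:E)%E.
Definition abn f : \bar R := (\int[mZ]_k (cmod (f k))%:E)%E.

Lemma sqn_ge0 f : (0 <= sqn f)%E.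
Proof. by apply: integral_ge0 => k _; rewrite lee_fin sqr_ge0. Qed.

Lemma abn_ge0 f : (0 <= abn f)%E.
Proof. by apply: integral_ge0 => k _; rewrite lee_fin cmod_ge0. Qed.

Lemma lp2E d (T : measurableType d) (mu : {measure set T -> \bar R}) (f : T -> R[i]) :
  (lpnorm mu 2%:E f = (\int[mu]_x (cmod (f x) ^+ 2)%:E) `^ (2^-1))%E.
Proof.
rewrite /lpnorm unlock; congr (_ `^ _)%E; apply: eq_integral => x _.
by rewrite gee0_abs ?lee_fin ?cmod_ge0// poweR_EFin powR_mulrn ?cmod_ge0.
Qed.

Lemma lp1E d (T : measurableType d) (mu : {measure set T -> \bar R}) (f : T -> R[i]) :
  (lpnorm mu 1%:E f = \int[mu]_x (cmod (f x))%:E)%E.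
Proof.
rewrite /lpnorm Lnorm1; apply: eq_integral => x _.
by rewrite gee0_abs ?lee_fin ?cmod_ge0.
Qed.

Lemma l2P f : l2 f <-> (sqn f < +oo)%E.
Proof.
rewrite /l2 /inLp lp2E -/(sqn f); split=> [[_]|h].
  have := sqn_ge0 f; case: (sqn f) => [r _ _| |] //; first by rewrite ltry.
  by rewrite poweRyr ?invr_neq0 ?ltxx// pnatr_eq0.
split; first exact: cmeas_Z.
by apply: poweR_lty.
Qed.

Lemma l2_sqn_fin f : l2 f -> sqn f \is a fin_num.
Proof. by move/l2P => h; rewrite ge0_fin_numE// sqn_ge0. Qed.

Lemma lp2_sqrt f : l2 f -> (lpnorm mZ 2%:E f = (Num.sqrt (fine (sqn f)))%:E)%E.
Proof.
move=> lf; rewrite lp2E -/(sqn f) -[in LHS](fineK (l2_sqn_fin lf)) poweR_EFin.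
by rewrite powR12_sqrt// fine_ge0// sqn_ge0.
Qed.

Lemma cmod_sqD (u v : R[i]) : cmod (u + v) ^+ 2 <= 2 * cmod u ^+ 2 + 2 * cmod v ^+ 2.
Proof.
rewrite !sqr_cmod ReD ImD.
have := sqr_ge0 (complex.Re u - complex.Re v).
have := sqr_ge0 (complex.Im u - complex.Im v).
by rewrite !expr2; nra.
Qed.

Lemma l2_lin (a : R[i]) f g : l2 f -> l2 g -> l2 (fun k => a * f k + g k).
Proof.
move=> /l2P lf /l2P lg; apply/l2P.
apply: (@le_lt_trans _ _ ((2 * cmod a ^+ 2)%:E * sqn f + 2%:E * sqn g)%E).
  rewrite /sqn -!gint_scale; try exact: meas_Z; try (by nonneg).
  rewrite -gint_add; try exact: meas_Z; try (by nonneg).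
  apply: gint_le; try exact: meas_Z; try (by nonneg).
  by move=> k; apply: le_trans (cmod_sqD _ _) _; rewrite cmodM exprMn mulrA.
by apply: lte_add_pinfty; apply: lte_mul_pinfty => //; nonneg.
Qed.

Lemma l2_0 : l2 (fun _ : Z => 0 : R[i]).
Proof.
apply/l2P; rewrite /sqn; under eq_integral do rewrite cmod0 expr0n/=.
by rewrite integral0 ltry.
Qed.

Lemma l2_sub f g : l2 f -> l2 g -> l2 (fun k => f k - g k).
Proof.
move=> lf lg; have := l2_lin (-1) lg lf.
by under eq_fun do rewrite mulN1r addrC.
Qed.

Lemma cmod_mul_le (u v : R[i]) : cmod (u * v) <= cmod u ^+ 2 + cmod v ^+ 2.
Proof. rewrite cmodM; have := cmod_ge0 u; have := cmod_ge0 v; nra. Qed.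

Lemma abn_mul f g : l2 f -> l2 g -> (abn (fun k => (f k * g k)%R) < +oo)%E.
Proof.
move=> /l2P lf /l2P lg; apply: (@le_lt_trans _ _ (sqn f + sqn g)%E).
  rewrite /sqn -gint_add; try exact: meas_Z; try (by nonneg).
  apply: gint_le; try exact: meas_Z; first by move=> k; exact: cmod_ge0.
  by move=> k; exact: cmod_mul_le.
by rewrite lte_add_pinfty.
Qed.

Lemma cintegrable_Z f : (abn f < +oo)%E -> cintegrable mZ f.
Proof. by move=> h; apply/cintegrableP; split=> //; exact: cmeas_Z. Qed.

Lemma l2_conj f : l2 f -> l2 (fun k => (f k)^*).
Proof. by move=> /l2P lf; apply/l2P; rewrite /sqn; under eq_integral do rewrite cmodJ. Qed.

Lemma dotl2_integrable f g : l2 f -> l2 g -> cintegrable mZ (fun k => f k * (g k)^*).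
Proof. by move=> lf lg; apply/cintegrable_Z/abn_mul => //; exact: l2_conj. Qed.

Lemma l2_shift (m : Z) f : l2 f -> l2 (fun k => f (k - m)).
Proof.
move=> /l2P lf; apply/l2P; rewrite /sqn (intZ_shift m (h := fun k => (cmod (f k) ^+ 2)%:E))//.
by move=> k; rewrite lee_fin sqr_ge0.
Qed.

Definition deltaZ (a : Z) : Z -> R[i] := fun j => (j == a)%:R.

Lemma l2_delta a : l2 (deltaZ a).
Proof.
apply/l2P; rewrite /sqn (@intZ_single _ _ a) ?ltry// => k /negPf ka.
by rewrite /deltaZ ka cmod0 expr0n.
Qed.

Lemma dotl2_delta f a : dotl2 f (deltaZ a) = f a.
Proof.
rewrite /dotl2 (@cintZ_single _ _ a _ _).2 => [|k /negPf ka].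
  by rewrite /deltaZ eqxx rmorph1 mulr1.
by rewrite /deltaZ ka rmorph0 mulr0.
Qed.

(* Summable sequences are square summable because they are bounded. *)
Lemma abn_l2 f : (abn f < +oo)%E -> l2 f /\ (sqn f <= abn f * abn f)%E.
Proof.
move=> lf; have fin : abn f \is a fin_num by rewrite ge0_fin_numE ?abn_ge0.
have h : (sqn f <= abn f * abn f)%E.
  rewrite -{1}(fineK fin) /sqn -gint_scale ?fine_ge0 ?abn_ge0//; try exact: meas_Z;
    last by move=> k; exact: cmod_ge0.
  apply: gint_le; try exact: meas_Z; first by move=> k; exact: sqr_ge0.
  move=> k; rewrite expr2 ler_wpM2r ?cmod_ge0//.
  rewrite -lee_fin fineK//; apply: (intZ_ge k (h := fun k => (cmod (f k))%:E)) => j.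
  by rewrite lee_fin cmod_ge0.
by split=> //; apply/l2P; apply: le_lt_trans h _; rewrite -(fineK fin) -EFinM ltry.
Qed.

Definition l2b : {pred (Z -> R[i]^o)} := fun f => `[< l2 (f : Z -> R[i]) >].

Lemma l2b_submod : submod_closed l2b.
Proof.
split; first by apply/asboolP; exact: l2_0.
by move=> a f g /asboolP lf /asboolP lg; apply/asboolP; exact: l2_lin.
Qed.

HB.instance Definition _ := GRing.isSubmodClosed.Build R[i] (Z -> R[i]^o) l2b l2b_submod.

(** Square summable sequences as a module over the complex numbers, on which the abstract Hilbert
    space results are instantiated. [R[i]^o] gives the plain functions their module structure. *)
Record l2t := L2t { l2v :> Z -> R[i]^o ; l2vP : l2v \in l2b }.

HB.instance Definition _ := [isSub for l2v].
HB.instance Definition _ := [Choice of l2t by <:].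
HB.instance Definition _ := [SubChoice_isSubLmodule of l2t by <:].

End SquareSummable.

Section FatouBound.
Context d (T : measurableType d) (R : realType).
Variable mu : {measure set T -> \bar R}.

(** Serves where only pointwise limits are at hand: the completeness of l^2 and the L^1-norm of the
    lower symbol. *)
Lemma fatou_bound (h_ : nat -> T -> R) (h : T -> R) (B : \bar R) :
  (forall n, measurable_fun [set: T] (h_ n)) -> (forall n x, 0 <= h_ n x) ->
  (forall x, (fun n => h_ n x) @ \oo --> h x) ->
  (forall n, \int[mu]_x (h_ n x)%:E <= B)%E ->
  (\int[mu]_x (h x)%:E <= B)%E.
Proof.
move=> mh h0 hh hB.
have := @fatou _ _ _ mu setT measurableT (fun n x => (h_ n x)%:E)
  (fun n => (measurable_EFinP _ _).2 (mh n)) (fun n x _ => (h0 n x : (0 <= (h_ n x)%:E)%E)).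
rewrite (eq_integral (fun x => (h x)%:E)); last first.
  move=> x _; have hx : (fun n => (h_ n x)%:E) @ \oo --> (h x)%:E by apply/cvgEFinP.
  rewrite is_cvg_limn_einfE; last by apply/cvg_ex; exists (h x)%:E.
  exact/cvg_lim.
move=> /le_trans; apply; rewrite limn_einf_lim; apply: lime_le.
  exact: is_cvg_einfs.
apply: nearW => n; apply: le_trans (hB n).
by apply: ereal_inf_lbound; exists n => /=.
Qed.

End FatouBound.

Section ComplexCauchy.
Variable R : realType.

Lemma real_cauchy (u : nat -> R) :
  (forall e : R, 0 < e -> exists N, forall i j, (N <= i)%N -> (N <= j)%N ->
    `|u i - u j| <= e) -> exists l : R, u @ \oo --> l.
Proof.
move=> hu; suff /cvg_ex[l ul] : cvg (u @ \oo) by exists l.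
suff : cauchy (u @ \oo) by exact: cauchy_cvg.
suff : cauchy_ex (u @ \oo) by exact: cauchy_exP.
move=> e e0.
have [N hN] := hu (e / 2) (divr_gt0 e0 (ltr0Sn R 1)).
exists (u N), N => // j Nj /=; apply: le_lt_trans (hN _ _ (leqnn N) Nj) _.
by rewrite ltr_pdivrMr// ltr_pMr// ltr1n.
Qed.

Lemma complex_cauchy (u : nat -> R[i]) :
  (forall e : R, 0 < e -> exists N, forall i j, (N <= i)%N -> (N <= j)%N ->
    cmod (u i - u j) <= e) ->
  exists l, (fun n => cmod (u n - l)) @ \oo --> (0 : R).
Proof.
move=> hu.
have [a ha] : exists a : R, (fun n => complex.Re (u n)) @ \oo --> a.
  apply: real_cauchy => e e0; have [N hN] := hu e e0; exists N => i j Ni Nj.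
  by rewrite -ReN -ReD (le_trans (Re_le_cmod _))// hN.
have [b hb] : exists b : R, (fun n => complex.Im (u n)) @ \oo --> b.
  apply: real_cauchy => e e0; have [N hN] := hu e e0; exists N => i j Ni Nj.
  by rewrite -ImN -ImD (le_trans (Im_le_cmod _))// hN.
by exists (a +i* b)%C; apply/cvg_cmodP.
Qed.

Lemma cvg_cmod (u : nat -> R[i]) l : (fun n => cmod (u n - l)) @ \oo --> (0 : R) ->
  (fun n => cmod (u n)) @ \oo --> cmod l.
Proof.
move=> h; apply/subr_cvg0/norm_cvg0P; apply: cvg0_le h => n.
rewrite normr_ge0/= ler_norml; apply/andP; split.
  have := cmodD (l - u n) (u n); rewrite subrK cmodC; lra.
have := cmodD (u n - l) l; rewrite subrK; lra.
Qed.

End ComplexCauchy.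

Section L2Space.
Variables (R : realType) (n : nat).
Local Notation Z := (Zn n).
Local Notation mZ := (@muZ R n).
Local Notation H := (l2t R n).

Lemma l2tP (f : H) : l2 (f : Z -> R[i]).
Proof. by have /asboolP := l2vP f. Qed.

Definition mkl2 (f : Z -> R[i]) (lf : l2 f) : H := L2t (asboolT lf).

Lemma l2vD (f g : H) k : (f + g : H) k = f k + g k.
Proof. by []. Qed.
Lemma l2vN (f : H) k : (- f : H) k = - f k.
Proof. by []. Qed.
Lemma l2vZ (a : R[i]) (f : H) k : (a *: f : H) k = a * f k.
Proof. by []. Qed.
Lemma l2v0 k : (0 : H) k = 0.
Proof. by []. Qed.
Lemma l2v_inj (f g : H) : (forall k, f k = g k) -> f = g.
Proof. by move=> fg; apply: val_inj; apply/funext. Qed.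
Lemma l2v_sum (I : Type) (s : seq I) (F : I -> H) k :
  (\sum_(i <- s) F i : H) k = \sum_(i <- s) F i k.
Proof. by elim: s => [|i s IH]; rewrite ?big_nil ?l2v0// !big_cons l2vD IH. Qed.

Definition dotH (f g : H) : R[i] := dotl2 (f : Z -> R[i]) (g : Z -> R[i]).

Lemma Re_dotl2 (f : Z -> R[i]) : complex.Re (dotl2 f f) = fine (sqn f).
Proof.
rewrite /dotl2 Re_cint /Rintegral; congr fine; apply: eq_integral => k _.
by rewrite Re_mulJ.
Qed.

Lemma dotl2_lin (a : R[i]) (f g k : Z -> R[i]) : l2 f -> l2 g -> l2 k ->
  dotl2 (fun j => a * f j + g j) k = a * dotl2 f k + dotl2 g k.
Proof.
move=> lf lg lk; rewrite /dotl2.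
have fk := dotl2_integrable lf lk; have gk := dotl2_integrable lg lk.
rewrite -(cintZ a fk) -cintD//; last exact: cintegrableZ.
by apply: eq_cint => j; rewrite mulrDl mulrA.
Qed.

Lemma dotl2_conj (f g : Z -> R[i]) : l2 f -> l2 g -> dotl2 f g = (dotl2 g f)^*.
Proof.
move=> lf lg; rewrite /dotl2 -cintJ; last exact: dotl2_integrable.
by apply: eq_cint => j; rewrite rmorphM/= conjCK mulrC.
Qed.

Lemma dotH_ip : inner_product dotH.
Proof.
split; first split.
- by move=> a f g k; exact: (dotl2_lin a (l2tP f) (l2tP g) (l2tP k)).
- by move=> f g; exact: (dotl2_conj (l2tP f) (l2tP g)).
- by move=> f; rewrite Re_dotl2 fine_ge0// sqn_ge0.
move=> f; rewrite Re_dotl2 => f0.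
have sf0 : sqn f = 0%E by rewrite -(fineK (l2_sqn_fin (l2tP f))) f0.
apply: l2v_inj => k; apply/eqP; rewrite l2v0 -cmod_eq0 -sqrf_eq0 eq_le sqr_ge0 andbT.
rewrite -lee_fin -[leRHS]sf0; apply: (intZ_ge k (h := fun k => (cmod (f k) ^+ 2)%:E)) => j.
by rewrite lee_fin sqr_ge0.
Qed.

Local Notation nrm := (nrm dotH).

Lemma nrmE (f : H) : (lpnorm mZ 2%:E (f : Z -> R[i]) = (nrm f)%:E)%E.
Proof. by rewrite (lp2_sqrt (l2tP f)) /nrm /nsq Re_dotl2. Qed.

Lemma nsqE (f : H) : sqn (f : Z -> R[i]) = (nsq dotH f)%:E.
Proof. by rewrite /nsq Re_dotl2 fineK// l2_sqn_fin//; exact: l2tP. Qed.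

Lemma coord_le (f : H) k : cmod (f k) <= nrm f.
Proof.
rewrite -ler_sqr ?nnegrE ?cmod_ge0 ?nrm_ge0// (nrm_sq dotH_ip) -lee_fin -nsqE.
apply: (intZ_ge k (h := fun k => (cmod (f k) ^+ 2)%:E)) => j.
by rewrite lee_fin sqr_ge0.
Qed.

Lemma l2_complete (u : nat -> H) : Hcauchy dotH u -> exists l, Hcvg dotH u l.
Proof.
move=> hu.
have /choice[f hf] : forall k, exists l, (fun i => cmod (u i k - l)) @ \oo --> (0 : R).
  move=> k; apply: complex_cauchy => e e0; have [N hN] := hu e e0.
  by exists N => i j Ni Nj; apply: le_trans (hN i j Ni Nj); exact: (coord_le (u i - u j)).
(* The bound on |u_i - u_j| passes to the coordinatewise limit in j by Fatou's lemma. *)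
have key e N : 0 <= e -> (forall i j, (N <= i)%N -> (N <= j)%N -> nrm (u i - u j) <= e) ->
    forall i, (N <= i)%N -> (sqn (fun k => (u i k - f k)%R) <= (e ^+ 2)%:E)%E.
  move=> e0 hN i Ni.
  apply: (@fatou_bound _ _ R mZ (fun j k => cmod (u i k - u (j + N)%N k) ^+ 2)).
  - by move=> j; exact: meas_Z.
  - by move=> j k; exact: sqr_ge0.
  - move=> k; have h : (fun j => cmod (u i k - u (j + N)%N k)) @ \oo --> cmod (u i k - f k).
      apply: cvg_cmod; have := hf k.
      rewrite -(cvg_shiftn N); under eq_fun do rewrite cmodC.
      have e1 j : f k - u (j + N)%N k = u i k - u (j + N)%N k - (u i k - f k) by ring.
      by under eq_fun do rewrite e1.
    by rewrite expr2; under eq_fun do rewrite expr2; exact: cvgM.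
  - move=> j; rewrite -/(sqn (u i - u (j + N)%N : H)) nsqE lee_fin -(nrm_sq dotH_ip).
    by rewrite ler_sqr ?nnegrE ?nrm_ge0// hN// leq_addl.
have lf : l2 f.
  have [N hN] := hu 1 ltr01.
  have lN : l2 (fun k => u N k - f k).
    by apply/l2P; apply: le_lt_trans (key 1 N ler01 hN N (leqnn N)) _; rewrite ltry.
  have := l2_sub (l2tP (u N)) lN.
  by under eq_fun do rewrite opprB addrC subrK.
exists (mkl2 lf); apply/cvg_eps => [i|e e0]; first exact: nrm_ge0.
have [N hN] := hu e e0; exists N => i Ni.
rewrite -ler_sqr ?nnegrE ?nrm_ge0 ?(ltW e0)// (nrm_sq dotH_ip) -lee_fin -nsqE.
exact: (key e N (ltW e0) hN i Ni).
Qed.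

(** [opH] and [unH] translate between operators on all functions and operators on the Hilbert space.
    A bounded operator never meets the default 0, and the values of [unH] outside l^2 do not
    matter. *)
Definition opH (A : (Z -> R[i]) -> (Z -> R[i])) (f : H) : H :=
  if pselect (l2 (A (f : Z -> R[i]))) is left h then mkl2 h else 0.

Definition unH (S : H -> H) (f : Z -> R[i]) : Z -> R[i] :=
  if pselect (l2 f) is left h then S (mkl2 h) else f.

Lemma opHE A (f : H) : bounded_op A -> (opH A f : Z -> R[i]) = A f.
Proof.
by move=> [lA _ _]; rewrite /opH; case: pselect => //=; have := lA _ (l2tP f).
Qed.

Lemma unHE (S : H -> H) (f : H) : unH S f = S f.
Proof.
rewrite /unH; case: pselect => [h|nh]; last by case: nh; exact: l2tP.
by congr (l2v (S _)); exact: l2v_inj.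
Qed.

Lemma mkl2E f (lf : l2 f) : (mkl2 lf : Z -> R[i]) = f.
Proof. by []. Qed.

Lemma opH_lin A : bounded_op A -> Hlinear (opH A).
Proof.
move=> bA a f g; apply: l2v_inj => k.
rewrite opHE// l2vD l2vZ !opHE//; have [_ linA _] := bA.
by have := congr1 (@^~ k) (linA a f g (l2tP f) (l2tP g)).
Qed.

Lemma opH_bnd A : bounded_op A -> Hbounded dotH (opH A).
Proof.
move=> bA; have [lA _ [c hc]] := bA.
exists (Num.max c 0); first by rewrite le_max lexx orbT.
move=> f; have := hc _ (l2tP f).
rewrite -opHE// !nrmE -EFinM lee_fin => /le_trans; apply.
by rewrite ler_wpM2r ?nrm_ge0// le_max lexx.
Qed.

Lemma unH_bounded S : Hlinear S -> Hbounded dotH S -> bounded_op (unH S).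
Proof.
move=> linS [c c0 bS]; split.
- by move=> f lf; rewrite -(mkl2E lf) unHE; exact: l2tP.
- move=> a f h lf lh.
  have := unHE S (a *: mkl2 lf + mkl2 lh); rewrite linS => e.
  have e1 := unHE S (mkl2 lf); have e2 := unHE S (mkl2 lh).
  apply/funext => k.
  transitivity ((a *: S (mkl2 lf) + S (mkl2 lh) : H) k).
    by rewrite -e.
  by rewrite l2vD l2vZ -e1 -e2.
- exists c => f lf; rewrite -(mkl2E lf) unHE !nrmE -EFinM lee_fin.
  exact: bS.
Qed.

Lemma opH_compact A : bounded_op A -> compact_op A -> Hcompact dotH (opH A).
Proof.
move=> bA cA u c uc.
have [|s [h [hs lh hc]]] := cA (fun i => u i : Z -> R[i]) c.
  by move=> i; split; [exact: l2tP|rewrite nrmE lee_fin].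
exists s, (mkl2 lh); split=> //; apply/cvgEFinP; move: hc.
set a := (X in X @ _ --> _ -> _); set b := (X in _ -> X @ _ --> _).
suff -> : a = b by [].
by apply/funext => i; rewrite /a /b -nrmE -opHE.
Qed.

End L2Space.

(** * Haar measure, characters and Fejer means *)

Section UniformShift.
Variable R : realType.
Local Notation mT := (measurableTypeR R).
Local Notation leb := (@lebesgue_measure R).

Lemma meas_shift (c : R) : measurable_fun [set: mT] (fun x : mT => (x + c : mT)).
Proof. by apply: measurable_funD. Qed.

(** Lebesgue measure is determined by its values on the intervals ]a, b], and its pushforward under
    a translation has the same ones. *)
Lemma leb_shift (c : R) (A : set mT) : measurable A ->
  leb ((fun x : R => x + c) @^-1` A) = leb A.
Proof.
move=> mA; have mc := meas_shift c.
have h := @lebesgue_measure_unique R (pushforward leb (fun x : mT => (x + c : mT))).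
apply/esym; apply: h => // _ [[a b] _ <-]/=; rewrite /pushforward/=.
rewrite (_ : _ @^-1` _ = `]a - c, b - c]%classic); last first.
  by apply/seteqP; split=> x /=; rewrite !in_itv/= ltrBlDr lerBrDr.
rewrite !lebesgue_measure_itv/= !lte_fin ltrD2r; case: ifPn => // _.
by rewrite -!EFinD; congr EFin; ring.
Qed.

Lemma integral_shift_itv (f : mT -> \bar R) (a b c : R) :
  measurable_fun [set: mT] f -> (forall x, 0 <= f x)%E ->
  (\int[leb]_(x in `[a, b[) f (x + c)%R = \int[leb]_(x in `[(a + c)%R, (b + c)%R[) f x)%E.
Proof.
move=> mf f0; have mc := meas_shift c.
have := @ge0_integral_pushforward _ _ _ _ R _ mc leb `[(a + c)%R, (b + c)%R[%classic f
  (measurable_itv _) (measurable_funTS mf) (fun x _ => f0 x).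
rewrite (_ : _ @^-1` _ = `[a, b[%classic); last first.
  by apply/seteqP; split=> x /=; rewrite !in_itv/= lerD2r ltrD2r.
by move=> <-; apply: eq_measure_integral => A mA _; exact: leb_shift.
Qed.

Lemma integral_split_itv (f : mT -> \bar R) (a b c : R) : a <= b <= c ->
  measurable_fun [set: mT] f -> (forall x, 0 <= f x)%E ->
  (\int[leb]_(x in `[a, c[) f x =
   \int[leb]_(x in `[a, b[) f x + \int[leb]_(x in `[b, c[) f x)%E.
Proof.
move=> /andP[ab bc] mf f0.
rewrite -ge0_integral_setU//=.
- congr integral; apply/seteqP; split=> x /=; rewrite !in_itv/=.
    by move=> /andP[-> ->]; case: (ltP x b) => xb; [left|right].
  case=> /andP[h1 h2]; apply/andP; split=> //.
    exact: lt_le_trans h2 bc.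
  exact: le_trans ab h1.
- exact: measurable_funTS.
- apply/disj_setPS => x /= []; rewrite !in_itv/= => /andP[_ h] /andP[h' _].
  by move: (lt_le_trans h h'); rewrite ltxx.
Qed.

(** By periodicity a may be replaced by its fractional part r. Then [r, 1 + r[ splits at 1, and the
    piece [1, 1 + r[ moves back onto [0, r[. *)
Lemma uniform_shift (f : mT -> \bar R) (a : R) :
  measurable_fun [set: mT] f -> (forall x, 0 <= f x)%E ->
  (forall (x : R) (z : int), f (x + z%:~R)%R = f x) ->
  (\int[uniform_prob (@ltr01 R)]_x f (x + a)%R = \int[uniform_prob (@ltr01 R)]_x f x)%E.
Proof.
move=> mf f0 pf.
rewrite !integral_uniform//; last exact: (measurableT_comp mf (meas_shift a)).
congr (_ * _)%E; rewrite -!integral_itv_bndo_bndc; last 2 first.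
- exact: measurable_funTS.
- by apply: measurable_funTS; exact: (measurableT_comp mf (meas_shift a)).
pose r := a - (Num.floor a)%:~R.
have r0 : 0 <= r by rewrite subr_ge0 floor_le_tmp.
have r1 : r < 1 by rewrite ltrBlDl -[1](mulr1z 1) -intrD floorD1_gt.
rewrite (eq_integral (fun x : mT => f (x + r)%R)); last first.
  by move=> x _; rewrite /r addrA -[in RHS](pf _ (Num.floor a)) subrK.
rewrite integral_shift_itv// add0r.
rewrite (@integral_split_itv _ r 1)//; last by rewrite (ltW r1) lerDl r0.
rewrite (@integral_split_itv f 0 r 1)//; last by rewrite r0 (ltW r1).
rewrite addeC; congr (_ + _)%E.
rewrite -{1}[1](add0r (1 : R)) (addrC 1 r) -integral_shift_itv//.
by apply: eq_integral => x _; rewrite -(pf x 1).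
Qed.

End UniformShift.

Section HaarShift.
Variable R : realType.

Definition addT n (w t : Tn R n) : Tn R n := [tuple tnth w i + tnth t i | i < n].
Definition negT n (w : Tn R n) : Tn R n := [tuple - tnth w i | i < n].
Definition periodicT n (X : Type) (f : Tn R n -> X) :=
  forall w l, f (translT w l) = f w.

Lemma meas_addT n (t : Tn R n) : measurable_fun [set: Tn R n] (fun w => addT w t).
Proof.
apply/measurable_fun_tnthP => i /=.
rewrite (_ : _ \o _ = fun w => tnth w i + tnth t i); last first.
  by apply/funext => w /=; rewrite tnth_mktuple.
by apply: measurable_funD => //; exact: measurable_tnth.
Qed.

Lemma subT_addT n (w t : Tn R n) : subT w t = addT w (negT t).
Proof. by apply: eq_from_tnth => i; rewrite !tnth_mktuple. Qed.

Lemma meas_subT n (t : Tn R n) : measurable_fun [set: Tn R n] (fun w => subT w t).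
Proof. by under eq_fun do rewrite subT_addT; exact: meas_addT. Qed.

Lemma subT_translT n (w t : Tn R n) l : subT (translT w l) t = translT (subT w t) l.
Proof. by apply: eq_from_tnth => i; rewrite !tnth_mktuple addrAC. Qed.

Lemma subTr_translT n (w t : Tn R n) l : subT w (translT t l) = translT (subT w t) (- l).
Proof.
apply: eq_from_tnth => i; rewrite !tnth_mktuple opprD addrA mxE mulrNz; ring.
Qed.

Lemma addT_translT n (w t : Tn R n) l : addT (translT w l) t = translT (addT w t) l.
Proof. by apply: eq_from_tnth => i; rewrite !tnth_mktuple addrAC. Qed.

Lemma subTK n (w t : Tn R n) : addT (subT w t) t = w.
Proof. by apply: eq_from_tnth => i; rewrite !tnth_mktuple subrK. Qed.

Lemma addTK n (w t : Tn R n) : subT (addT w t) t = w.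
Proof. by apply: eq_from_tnth => i; rewrite !tnth_mktuple addrK. Qed.

Lemma consT_add n (x a : R) (w t : Tn R n) :
  addT (consT (x, w)) (consT (a, t)) = consT (x + a, addT w t).
Proof.
apply: eq_from_tnth => i; rewrite tnth_mktuple.
case: (unliftP ord0 i) => [j ->|->]; rewrite ?tnth0// !tnthS tnth_mktuple//.
Qed.

Lemma integral_haarS n (f : Tn R n.+1 -> \bar R) :
  measurable_fun [set: Tn R n.+1] f -> (forall w, 0 <= f w)%E ->
  (\int[haar R n.+1]_w f w =
   \int[uniform_prob (@ltr01 R)]_x \int[haar R n]_w f (consT (x, w)))%E.
Proof.
move=> mf f0.
have := @ge0_integral_pushforward _ _ _ _ R _ (@measurable_consT R n)
  (uniform_prob (@ltr01 R) \x haar R n)%E setT f measurableT mf (fun x _ => f0 x).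
rewrite preimage_setT => e.
transitivity (\int[(uniform_prob (@ltr01 R) \x haar R n)%E]_z (f \o @consT R n) z)%E.
  by rewrite -e.
rewrite fubini_tonelli1//.
  exact: (measurableT_comp mf (@measurable_consT R n)).
by move=> z; exact: f0.
Qed.

Definition consZ n (z : int) (l : Zn n) : Zn n.+1 :=
  \row_i oapp (fun j => l 0 j) z (unlift ord0 i).

Lemma consZ0 n z (l : Zn n) : consZ z l 0 ord0 = z.
Proof. by rewrite mxE unlift_none. Qed.

Lemma consZS n z (l : Zn n) j : consZ z l 0 (lift ord0 j) = l 0 j.
Proof. by rewrite mxE liftK. Qed.

(** Induction on n, with Tonelli separating the first coordinate. Periodicity along [consZ 0 l]
    feeds the induction hypothesis, periodicity along [consZ z 0] the one-dimensional case. *)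
Lemma haar_shift n (f : Tn R n -> \bar R) (t : Tn R n) :
  measurable_fun [set: Tn R n] f -> (forall w, 0 <= f w)%E -> periodicT f ->
  (\int[haar R n]_w f (addT w t) = \int[haar R n]_w f w)%E.
Proof.
elim: n f t => [|n IH] f t mf f0 pf.
  by apply: eq_integral => w _; rewrite (tuple0 w) (tuple0 (addT _ _)).
have mft : measurable_fun setT (fun w => f (addT w t)) by exact: (measurableT_comp mf (meas_addT t)).
rewrite !integral_haarS//.
have [a [t' tE]] : exists a t', t = consT (a, t').
  by exists (thead t), [tuple of behead t]; rewrite /consT /= -tuple_eta.
rewrite {}tE in mft *.
have mfc : measurable_fun setT (fun z => f (consT z)) by exact: (measurableT_comp mf (@measurable_consT R n)).
pose g (x : measurableTypeR R) := (\int[haar R n]_w f (consT (x, w)))%E.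
have mg : measurable_fun setT g.
  by apply: (@measurable_fun_fubini_tonelli_F _ _ _ _ _ (haar R n) (fun z => f (consT z))).
transitivity (\int[uniform_prob (@ltr01 R)]_x g (x + a)%R)%E.
  apply: eq_integral => x _; rewrite /g; under eq_integral do rewrite consT_add.
  apply: (IH (fun w => f (consT (x + a, w)))) => //.
    exact: (measurableT_comp mfc (pair1_measurable _)).
  move=> w l; rewrite -(pf (consT (x + a, w)) (consZ 0 l)); congr f.
  apply: eq_from_tnth => i; rewrite tnth_mktuple.
  case: (unliftP ord0 i) => [j ->|->]; first by rewrite consZS !tnthS tnth_mktuple.
  by rewrite consZ0 !tnth0 addr0.
apply: uniform_shift => //; first by move=> x; exact: integral_ge0.
move=> x z; apply: eq_integral => w _.
rewrite -[RHS](pf _ (consZ z 0)); congr f.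
apply: eq_from_tnth => i; rewrite tnth_mktuple.
case: (unliftP ord0 i) => [j ->|->]; first by rewrite consZS !tnthS mxE addr0.
by rewrite consZ0 !tnth0.
Qed.

Lemma haar_Rshift n (f : Tn R n -> R) (t : Tn R n) :
  measurable_fun [set: Tn R n] f -> periodicT f ->
  \int[haar R n]_w f (addT w t) = \int[haar R n]_w f w.
Proof.
move=> mf pf; rewrite /Rintegral integralE [in RHS]integralE; congr (fine (_ - _))%E.
  rewrite -(@haar_shift _ (fun w => ((EFin \o f)^\+ w)%E) t)//.
  - by apply: eq_integral => w _; rewrite !funeposE.
  - by apply: measurable_funepos; exact/measurable_EFinP.
  - by move=> w l; rewrite !funeposE/= pf.
rewrite -(@haar_shift _ (fun w => ((EFin \o f)^\- w)%E) t)//.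
- by apply: eq_integral => w _; rewrite !funenegE.
- by apply: measurable_funeneg; exact/measurable_EFinP.
- by move=> w l; rewrite !funenegE/= pf.
Qed.

Lemma haar_cshift n (f : Tn R n -> R[i]) (t : Tn R n) :
  cmeasurable f -> periodicT f ->
  cint (haar R n) (fun w => f (addT w t)) = cint (haar R n) f.
Proof.
move=> [mr mi] pf; apply: eqRI; rewrite /cint/=.
  by rewrite (haar_Rshift t mr)// => w l; rewrite pf.
by rewrite (haar_Rshift t mi)// => w l; rewrite pf.
Qed.

End HaarShift.

Section Characters.
Variable R : realType.

Lemma expiD (x y : R) : expi (x + y) = expi x * expi y.
Proof.
rewrite /expi mulrDr cosD sinD; apply: eqRI; rewrite ?ReM ?ImM/=; ring.
Qed.

Lemma expi0 : expi (0 : R) = 1.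
Proof. by rewrite /expi mulr0 cos0 sin0. Qed.

Lemma expiN (x : R) : expi (- x) = (expi x)^*.
Proof. by rewrite /expi mulrN cosN sinN. Qed.

Lemma cmod_expi (x : R) : cmod (expi x) = 1.
Proof. by rewrite /cmod /= cos2Dsin2 sqrtr1. Qed.

Lemma expi1 : expi (1 : R) = 1.
Proof. by rewrite /expi mulr1 mulr_natl cos2pi sin2pi. Qed.

Lemma expi_int (z : int) : expi (z%:~R : R) = 1.
Proof.
have hn (k : nat) : expi (k%:R : R) = 1.
  by elim: k => [|k IH]; rewrite ?expi0// -natr1 expiD IH expi1 mulr1.
case: z => k; first by rewrite -pmulrn hn.
by rewrite NegzE mulrNz expiN -pmulrn hn rmorph1.
Qed.

Lemma expi_half : expi (2^-1 : R) = -1.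
Proof.
rewrite /expi (_ : 2 * pi * 2^-1 = pi); last by field.
by rewrite cospi sinpi; apply: eqRI => /=; rewrite ?oppr0.
Qed.

Variable n : nat.
Local Notation T := (Tn R n).
Local Notation Z := (Zn n).
Implicit Types (w t : T) (k l : Z).

Definition chr k w : R[i] := expi (dotT w k).

Lemma dotT_addT w t k : dotT (addT w t) k = dotT w k + dotT t k.
Proof.
rewrite /dotT -big_split/=; apply: eq_bigr => i _.
by rewrite tnth_mktuple mulrDl.
Qed.

Lemma dotTD w k l : dotT w (k + l) = dotT w k + dotT w l.
Proof.
rewrite /dotT -big_split/=; apply: eq_bigr => i _.
by rewrite mxE intrD mulrDr.
Qed.

Lemma dotTN w k : dotT w (- k) = - dotT w k.
Proof.
rewrite /dotT -sumrN; apply: eq_bigr => i _.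
by rewrite mxE mulrNz mulrN.
Qed.

Lemma dotT_translT w l k :
  dotT (translT w l) k = dotT w k + (\sum_(i < n) l 0 i * k 0 i)%:~R.
Proof.
rewrite /dotT rmorph_sum -big_split/=; apply: eq_bigr => i _.
by rewrite tnth_mktuple mulrDl intrM.
Qed.

Lemma chrD k l w : chr (k + l) w = chr k w * chr l w.
Proof. by rewrite /chr dotTD expiD. Qed.

Lemma chrN k w : chr (- k) w = (chr k w)^*.
Proof. by rewrite /chr dotTN expiN. Qed.

Lemma chr0 w : chr 0 w = 1.
Proof.
rewrite /chr /dotT big1 ?expi0// => i _.
by rewrite mxE mulr0.
Qed.

Lemma cmod_chr k w : cmod (chr k w) = 1.
Proof. exact: cmod_expi. Qed.

Lemma chr_addT k w t : chr k (addT w t) = chr k w * chr k t.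
Proof. by rewrite /chr dotT_addT expiD. Qed.

Lemma chr_periodic k : periodicT (chr k).
Proof. by move=> w l; rewrite /chr dotT_translT expiD expi_int mulr1. Qed.

Lemma chr_mulN k w : chr k w * chr (- k) w = 1.
Proof. by rewrite -chrD subrr chr0. Qed.

Lemma cmeas_expi d (X : measurableType d) (h : X -> R) :
  measurable_fun [set: X] h -> cmeasurable (fun x => expi (h x)).
Proof.
move=> mh; split => /=.
  apply: (@measurableT_comp _ _ _ _ _ _ (@cos R)); last exact: measurable_funM.
  by apply: continuous_measurable_fun; exact: continuous_cos.
apply: (@measurableT_comp _ _ _ _ _ _ (@sin R)); last exact: measurable_funM.
by apply: continuous_measurable_fun; exact: continuous_sin.
Qed.

Lemma meas_dotT k : measurable_fun [set: T] (fun w => dotT w k).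
Proof.
rewrite /dotT; apply: measurable_sum => i.
by apply: measurable_funM => //; exact: measurable_tnth.
Qed.

Lemma cmeas_chr k : cmeasurable (chr k).
Proof. by apply: cmeas_expi; exact: meas_dotT. Qed.

Lemma haar_int_le (f : T -> R[i]) (B : R) : cmeasurable f ->
  (forall w, cmod (f w) <= B) -> (\int[haar R n]_w (cmod (f w))%:E <= B%:E)%E.
Proof.
move=> mf fB; have := @integral_cst _ _ _ (haar R n) setT measurableT B%:E.
rewrite [X in (_ * X)%E]probability_setT mule1 => <-.
apply: ge0_le_integral => //.
- by nonneg.
- exact: cmeas_cmodE.
- by move=> w _; rewrite lee_fin.
Qed.

Lemma haar_integrable (f : T -> R[i]) (B : R) : cmeasurable f ->
  (forall w, cmod (f w) <= B) -> cintegrable (haar R n) f.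
Proof.
move=> mf fB; apply/cintegrableP; split=> //.
by apply: le_lt_trans (haar_int_le mf fB) _; rewrite ltry.
Qed.

Lemma haar_cint_le (f : T -> R[i]) (B : R) : cmeasurable f ->
  (forall w, cmod (f w) <= B) -> cmod (cint (haar R n) f) <= B.
Proof.
move=> mf fB; apply: cmod_cint_bound; first exact: haar_integrable fB.
exact: haar_int_le.
Qed.

Lemma cint_cst (a : R[i]) : cint (haar R n) (fun _ => a) = a.
Proof.
apply: eqRI; rewrite /cint/= /Rintegral integral_cst//=.
all: by rewrite [X in (_ * X)%E]probability_setT mule1.
Qed.

Lemma chr_integrable k : cintegrable (haar R n) (chr k).
Proof. by apply: (@haar_integrable _ 1) => [|w]; [exact: cmeas_chr|rewrite cmod_chr]. Qed.

(* Translating by half a period in a direction where k does not vanish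
   multiplies the integral by -1. *)
Lemma cint_chr k : cint (haar R n) (chr k) = (k == 0)%:R.
Proof.
have [->|k0] := eqVneq k 0.
  by under eq_cint do rewrite chr0; rewrite cint_cst.
have [i ki] : exists i, k 0 i != 0.
  apply/existsP; apply: contraNT k0; rewrite negb_exists => /forallP h.
  apply/eqP/rowP => i; rewrite mxE; apply/eqP.
  by have := h i; rewrite negbK.
pose t : T := [tuple (if j == i then (2 * (k 0 i)%:~R)^-1 else 0) | j < n].
have ct : chr k t = -1.
  rewrite -expi_half /chr; congr expi; rewrite /dotT (bigD1 i)//= big1.
    rewrite tnth_mktuple eqxx addr0 invfM mulfVK// intr_eq0//.
  by move=> j /negPf ji; rewrite tnth_mktuple ji mul0r.
have := haar_cshift t (cmeas_chr k) (@chr_periodic k).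
under eq_cint do rewrite chr_addT ct.
rewrite cintZr; last exact: chr_integrable.
move=> h; apply/eqP; rewrite mulr0n; move: h => /eqP.
by rewrite mulrN1 eq_sym -subr_eq0 opprK -mulr2n mulrn_eq0.
Qed.

End Characters.

Section Lipschitz.
Variables (R : realType) (n : nat).
Local Notation T := (Tn R n).
Local Notation Z := (Zn n).

Definition lipT (K : R) (f : T -> R[i]) := forall w t,
  cmod (f (addT w t) - f w) <= K * \sum_(i < n) `|tnth t i|.

Lemma addTC (w t : T) : addT w t = addT t w.
Proof. by apply: eq_from_tnth => i; rewrite !tnth_mktuple addrC. Qed.

Definition floorT (m : nat) (w : T) : Z := \row_i Num.floor (m.+1%:R * tnth w i).
Definition gridT (m : nat) (k : Z) : T := [tuple (k 0 i)%:~R / m.+1%:R | i < n].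

Lemma meas_floorT m : measurable_fun [set: T] (floorT m).
Proof.
move=> _ Y _; rewrite setTI.
have -> : floorT m @^-1` Y = \bigcup_j (if @unpickle Z j is Some k then
    (if k \in Y then [set w | floorT m w = k] else set0) else set0).
  apply/seteqP; split=> [w Yw|w [j _]].
    exists (pickle (floorT m w)) => //; rewrite pickleK.
    by rewrite mem_set.
  case: unpickle => // k; case: ifPn => // kY /= wk.
  by rewrite /preimage/= wk; exact: set_mem.
apply: bigcupT_measurable => j; case: unpickle => // k; case: ifPn => // _.
have -> : [set w | floorT m w = k] = \bigcap_(i in [set: 'I_n])
    ((fun w : T => m.+1%:R * tnth w i) @^-1` `[(k 0 i)%:~R, (k 0 i + 1)%:~R[).
  apply/seteqP; split=> [w wk i _ /=|w wk].
    by rewrite in_itv/= -wk mxE floor_le_tmp floorD1_gt.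
  apply/rowP => i; rewrite mxE; have := wk i I; rewrite /= in_itv/=.
  exact: floor_def.
apply: fin_bigcap_measurable => // i _; rewrite -[X in measurable X]setTI.
have h : measurable_fun [set: T] (fun w : T => m.+1%:R * tnth w i).
  by apply: measurable_funM => //; exact: measurable_tnth.
by apply: h.
Qed.

(** Rounding the argument down to the grid of mesh 1 / (m + 1) makes f a function of the measurable
    [floorT m], whose values lie in the discrete Z^n. The Lipschitz bound makes the rounding error
    at most K n / (m + 1). *)
Lemma lip_cmeas (K : R) (f : T -> R[i]) : 0 <= K -> lipT K f -> cmeasurable f.
Proof.
move=> K0 lf; apply: (@cmeas_cvg _ _ _ (fun m w => f (gridT m (floorT m w)))) => [m|w].
  apply: (@cmeas_comp _ _ _ _ _ (floorT m) (fun k => f (gridT m k))).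
    exact: meas_floorT.
  exact: cmeas_Z.
apply: cvg0_le (cvg0_scale (K * n%:R) (@cvg_harmonic R)) => m.
rewrite cmod_ge0/= cmodC.
set g := gridT m (floorT m w).
have e : addT g (subT w g) = w by rewrite addTC subTK.
have := lf g (subT w g); rewrite e => /le_trans; apply; rewrite -mulrA ler_wpM2l//.
rewrite -[n in n%:R]card_ord -sum1_card natr_sum mulr_suml; apply: ler_sum => i _.
rewrite !tnth_mktuple !mxE mul1r; set x := tnth w i.
have m0 : (0 : R) < m.+1%:R by rewrite ltr0n.
have h1 := floor_le_tmp (m.+1%:R * x); have h2 := floorD1_gt (m.+1%:R * x).
rewrite intrD mulr1z in h2; move: h1 h2; move: (_%:~R) => z h1 h2.
have -> : x - z / m.+1%:R = (m.+1%:R * x - z) / m.+1%:R.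
  by rewrite mulrBl mulrAC mulfV ?mul1r// gt_eqF.
rewrite ger0_norm ?divr_ge0 ?subr_ge0 ?(ltW m0)//.
by rewrite ler_pdivrMr// mulVf ?gt_eqF//; lra.
Qed.

Lemma nearest_int (w : T) : exists l : Z, forall i, `|tnth w i - (l 0 i)%:~R| <= 2^-1.
Proof.
exists (\row_i Num.floor (tnth w i + 2^-1)) => i; rewrite mxE.
have h1 := floor_le_tmp (tnth w i + 2^-1); have h2 := floorD1_gt (tnth w i + 2^-1).
move: h1 h2; rewrite intrD mulr1z; move: (_%:~R) => z h1 h2.
by rewrite ler_norml; apply/andP; split; lra.
Qed.

End Lipschitz.

(** * Fejer means on the torus *)

Section Fejer.
Variables (R : realType) (n : nat).
Local Notation T := (Tn R n).
Local Notation Z := (Zn n).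
Local Notation haar := (haar R n).

Definition fc (f : T -> R[i]) (l : Z) : R[i] := cint haar (fun w => f w * chr (- l) w).

Section Kernel.
Variable M : nat.
Local Notation Q := {ffun 'I_n -> 'I_M.+1}.
Definition freq (q : Q) : Z := \row_i (q i : int).
Local Notation N := (#|{: Q}|%:R : R).

(** Among pairs of frequencies in the cube {0, ..., M}^n the difference k occurs prod_i (M + 1 -
    |k_i|) times if all |k_i| <= M, and never otherwise. Divided by N = (M + 1)^n, these counts are
    the Fejer weights. *)
Definition fejer (f : T -> R[i]) (w : T) : R[i] := N^-1%:C%C *
  \sum_(q : Q) \sum_(q' : Q) fc f (freq q - freq q') * chr (freq q - freq q') w.

(** A one-sided Dirichlet kernel. Its squared modulus over N is the n-dimensional Fejer kernel, in a
    form that is visibly nonnegative. *)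
Definition dkernel (w : T) : R[i] := \sum_(q : Q) chr (freq q) w.
Definition kernel (w : T) : R := N^-1 * cmod (dkernel w) ^+ 2.

Lemma N_gt0 : 0 < N.
Proof. by rewrite ltr0n; apply/card_gt0P; exists [ffun=> ord0]. Qed.

Lemma kernel_ge0 w : 0 <= kernel w.
Proof. by rewrite mulr_ge0 ?invr_ge0 ?sqr_ge0// ltW// N_gt0. Qed.

Lemma kernelE w : (kernel w)%:C%C = N^-1%:C%C *
  \sum_(q : Q) \sum_(q' : Q) chr (- (freq q - freq q')) w.
Proof.
rewrite /kernel rmorphM/= -mulJ /dkernel rmorph_sum; congr (_ * _).
rewrite mulr_suml exchange_big; apply: eq_bigr => q _; rewrite mulr_sumr.
by apply: eq_bigr => q' _ /=; rewrite -chrN opprB chrD.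
Qed.

Lemma dkernel_le w : cmod (dkernel w) <= N.
Proof.
apply: le_trans (cmod_sum _ _ _) _.
rewrite (eq_bigr (fun=> 1)); last by move=> q _; rewrite cmod_chr.
by rewrite sumr_const.
Qed.

Lemma kernel_le w : kernel w <= N.
Proof.
rewrite /kernel ler_pdivrMl ?N_gt0// -expr2.
by rewrite ler_sqr ?nnegrE ?cmod_ge0// ?dkernel_le// ltW// N_gt0.
Qed.

Lemma cmeas_dkernel : cmeasurable dkernel.
Proof. by apply: cmeas_sum => q; exact: cmeas_chr. Qed.

Lemma cmeas_real d (X : measurableType d) (h : X -> R) :
  measurable_fun setT h -> cmeasurable (fun x => (h x)%:C%C).
Proof. by move=> mh; split. Qed.

Lemma meas_kernel : measurable_fun [set: T] kernel.
Proof.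
apply: measurable_funM => //; apply: measurable_funX.
exact: (cmeas_cmod cmeas_dkernel).
Qed.

Lemma cmeas_shift (f : T -> R[i]) t : cmeasurable f -> cmeasurable (fun w => f (addT w t)).
Proof. by move=> mf; apply: (cmeas_comp _ mf); exact: meas_addT. Qed.

Lemma cmeas_shiftr (f : T -> R[i]) t : cmeasurable f -> cmeasurable (fun w => f (addT t w)).
Proof.
move=> mf; apply: (cmeas_comp _ mf); rewrite (_ : addT t = fun w => addT w t).
  exact: meas_addT.
by apply/funext => w; apply: eq_from_tnth => i; rewrite !tnth_mktuple addrC.
Qed.

Lemma fejer_conv (f : T -> R[i]) B w : cmeasurable f -> periodicT f ->
  (forall w, cmod (f w) <= B) ->
  fejer f w = cint haar (fun s => f (addT w s) * (kernel s)%:C%C).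
Proof.
move=> mf pf fB.
have fi l : cintegrable haar (fun s => f s * chr l s).
  apply: (@haar_integrable _ _ _ B); first by apply: cmeasM => //; exact: cmeas_chr.
  by move=> s; rewrite cmodM cmod_chr mulr1.
have fi' l : cintegrable haar (fun s => f (addT w s) * chr l s).
  apply: (@haar_integrable _ _ _ B).
    by apply: cmeasM; [exact: cmeas_shiftr|exact: cmeas_chr].
  by move=> s; rewrite cmodM cmod_chr mulr1.
have e l : cint haar (fun s => f (addT w s) * chr (- l) s) = fc f l * chr l w.
  rewrite /fc -cintZr//.
  rewrite -(@haar_cshift _ _ (fun s => f s * chr (- l) s * chr l w) w).
  - apply: eq_cint => s; rewrite (addTC s) -mulrA; congr (_ * _).
    by rewrite addTC chr_addT -mulrA -chrD addNr chr0 mulr1.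
  - apply: cmeasM; last exact: cmeas_cst.
    by apply: cmeasM => //; exact: cmeas_chr.
  - by move=> s l'; rewrite pf chr_periodic.
rewrite /fejer; under [RHS]eq_cint do rewrite kernelE mulrCA mulr_sumr.
rewrite cintZ; last first.
  apply: cintegrable_sum => q; under eq_fun do rewrite mulr_sumr.
  by apply: cintegrable_sum => q'.
congr (_ * _); rewrite cint_sum; last first.
  move=> q; under eq_fun do rewrite mulr_sumr.
  by apply: cintegrable_sum => q'.
apply: eq_bigr => q _; under [RHS]eq_cint do rewrite mulr_sumr.
by rewrite cint_sum//; apply: eq_bigr => q' _; rewrite e.
Qed.

Lemma kernel_fc (k : Z) : cint haar (fun s => chr k s * (kernel s)%:C%C) =
  N^-1%:C%C * \sum_(q : Q) \sum_(q' : Q) (k == freq q - freq q')%:R.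
Proof.
have fi l : cintegrable haar (fun s => chr k s * chr l s).
  by under eq_fun do rewrite -chrD; exact: chr_integrable.
under eq_cint do rewrite kernelE mulrCA mulr_sumr.
rewrite cintZ; last first.
  apply: cintegrable_sum => q; under eq_fun do rewrite mulr_sumr.
  by apply: cintegrable_sum => q'.
congr (_ * _); rewrite cint_sum; last first.
  move=> q; under eq_fun do rewrite mulr_sumr.
  by apply: cintegrable_sum => q'.
apply: eq_bigr => q _; under eq_cint do rewrite mulr_sumr.
rewrite cint_sum//; apply: eq_bigr => q' _.
by under eq_cint do rewrite -chrD; rewrite cint_chr subr_eq0.
Qed.

Lemma freq_inj : injective freq.
Proof.
move=> q q' h; apply/ffunP => i; apply: val_inj.
by have /rowP/(_ i) := h; rewrite !mxE => -[].
Qed.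

Lemma kernel_int : cint haar (fun s => (kernel s)%:C%C) = 1.
Proof.
have := kernel_fc 0; under eq_cint do rewrite chr0 mul1r.
move=> ->; rewrite (eq_bigr (fun=> 1)).
  rewrite sumr_const -(rmorph_nat (real_complex R)) -rmorphM mulVf ?rmorph1//.
  by rewrite gt_eqF// N_gt0.
move=> q _; rewrite (bigD1 q)//= subrr eqxx big1 ?addr0// => q' qq'.
rewrite eq_sym subr_eq0; case: eqVneq => // /freq_inj e.
by rewrite e eqxx in qq'.
Qed.

(** The indicator of q_i = M is a product over the coordinates, so its sum over all q factors. *)
Lemma card_top (i : 'I_n) : (#|[pred q : Q | q i == ord_max]| * M.+1 = #|{: Q}|)%N.
Proof.
have -> : #|[pred q : Q | q i == ord_max]| = (\sum_(q : Q) \prod_(j < n)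
    (if j == i then (q j == ord_max : nat) else 1))%N.
  rewrite -sum1_card big_mkcond; apply: eq_bigr => q _ /=.
  rewrite (bigD1 i)//= eqxx big1 ?muln1; first by rewrite inE; case: (q i == ord_max).
  by move=> j /negPf ->.
rewrite -(bigA_distr_bigA (fun j a => if j == i then (a == ord_max : nat) else 1%N)).
rewrite (bigD1 i)//= (eq_bigr (fun a : 'I_M.+1 => (a == ord_max : nat))); last first.
  by move=> a _; rewrite eqxx.
rewrite (bigD1 ord_max)//= eqxx big1 ?addn0 ?mul1n; last by move=> a /negPf ->.
rewrite card_ffun !card_ord.
rewrite (eq_bigr (fun=> M.+1)); last first.
  by move=> j /negPf ->; rewrite sum1_card card_ord.
rewrite prod_nat_const cardC1 card_ord -expnSr; congr (_ ^ _)%N.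
by case: n i => // -[].
Qed.

Definition unitZ (i : 'I_n) : Z := \row_j ((j == i)%:R : int).

(** The coefficient at the unit vector e_i counts pairs that differ by e_i: each q' with q'_i < M
    has the partner q' + e_i, and only the fraction 1 / (M + 1) of the cube has q'_i = M. It
    measures how far the kernel concentrates at 0 in the i-th coordinate. *)
Lemma kernel_unit (i : 'I_n) :
  1 - M.+1%:R^-1 <= complex.Re (cint haar (fun s => chr (unitZ i) s * (kernel s)%:C%C)).
Proof.
rewrite kernel_fc.
have -> : \sum_(q : Q) \sum_(q' : Q) ((unitZ i == freq q - freq q')%:R : R[i]) =
   (\sum_(q' : Q) \sum_(q : Q) (unitZ i == freq q - freq q')%:R : R)%:C%C.
  rewrite exchange_big rmorph_sum; apply: eq_bigr => q' _.
  by rewrite rmorph_sum; apply: eq_bigr => q _; rewrite rmorph_nat.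
rewrite -rmorphM/= ler_pdivlMl ?N_gt0//.
apply: (@le_trans _ _ (\sum_(q' : Q) (q' i != ord_max)%:R)); last first.
  apply: ler_sum => q' _; case: (boolP (q' i == ord_max)) => [_|h].
    by apply: sumr_ge0 => q _; rewrite ler0n.
  have lt : ((q' i).+1 < M.+1)%N.
    rewrite ltn_neqAle ltn_ord andbT; apply: contra h => /eqP[e].
    by apply/eqP/val_inj.
  pose q : Q := [ffun j => if j == i then Ordinal lt else q' j].
  have -> : unitZ i = freq q - freq q'.
    apply/rowP => j; rewrite !mxE ffunE; case: eqVneq => [->|_] /=.
      by rewrite intS addrK.
    by rewrite subrr.
  rewrite (bigD1 q)//= eqxx lerDl.
  by apply: sumr_ge0 => ? _; rewrite ler0n.
have -> : \sum_(q' : Q) ((q' i != ord_max)%:R : R) = N - #|[pred q : Q | q i == ord_max]|%:R.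
  rewrite -sum1_card -sum1_card !natr_sum [X in _ - X]big_mkcond/= -sumrB.
  apply: eq_bigr => q _; rewrite inE/=; case: (q i == ord_max) => /=; first by rewrite subrr.
  by rewrite subr0.
rewrite mulrBr mulr1 lerD2l lerN2.
by rewrite -(card_top i) natrM mulfK ?pnatr_eq0.
Qed.

End Kernel.

Lemma cmod_cint_le_Re d (X : measurableType d) (mu : {measure set X -> \bar R})
    (F G : X -> R[i]) : cintegrable mu F -> cintegrable mu G ->
  (forall x, cmod (F x) <= complex.Re (G x)) ->
  cmod (cint mu F) <= complex.Re (cint mu G).
Proof.
move=> iF iG FG; apply: cmod_cint_bound => //; rewrite Re_cint.
have [iGr _] := iG; rewrite /Rintegral fineK ?integrable_fin_num//.
apply: le_integral => //; last by move=> x _; rewrite lee_fin.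
apply/integrableP; split; first by apply: cmeas_cmodE; exact: cintegrable_meas iF.
under eq_integral do rewrite gee0_abs ?lee_fin ?cmod_ge0//.
exact: cintegrable_lty.
Qed.

(** Beyond distance dl, 1 - cos (2 pi x) is at least 1 - cos (2 pi dl), while the distance is at
    most 1/2. This majorant replaces the splitting of the kernel integral into a near and a far
    region. *)
Lemma dist_cos (x dl : R) (z : int) : 0 < dl < 2^-1 -> `|x - z%:~R| <= 2^-1 ->
  `|x - z%:~R| <= dl + (1 - cos (2 * pi * dl))^-1 * (1 - complex.Re (expi x)).
Proof.
move=> /andP[d0 d1] xz.
have pi0 := pi_gt0 R.
have -> : complex.Re (expi x) = cos (2 * pi * `|x - z%:~R|).
  rewrite -[x in LHS](subrK z%:~R) expiD expi_int mulr1 /=.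
  have [h|h] := ger0P (x - z%:~R); first by [].
  by rewrite mulrN cosN.
move: `|_| (normr_ge0 (x - z%:~R)) xz => y y0 y1.
have r1 : 0 < 2 * pi * dl by rewrite !mulr_gt0.
have r2 : 2 * pi * dl <= pi by nra.
have cd : cos (2 * pi * dl) < 1.
  by rewrite -[ltRHS]cos0 ltr_cos ?in_itv/= ?lexx ?(ltW r1) ?(ltW pi0).
have cy : cos (2 * pi * y) <= 1 by exact: cos_le1.
have [yd|dy] := leP y dl.
  by rewrite (le_trans yd)// lerDl mulr_ge0// ?invr_ge0 subr_ge0// ltW.
have cc : cos (2 * pi * y) < cos (2 * pi * dl).
  rewrite ltr_cos ?in_itv/=.
  - by rewrite ltr_pM2l ?mulr_gt0.
  - by apply/andP; split; nra.
  - by apply/andP; split; nra.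
have : 1 <= (1 - cos (2 * pi * dl))^-1 * (1 - cos (2 * pi * y)).
  by rewrite mulrC ler_pdivlMr ?subr_gt0// mul1r lerD2l lerN2 ltW.
lra.
Qed.

(** The kernel has mass 1, so the error is at most K times the sum over i of the kernel average of
    the distance from s_i to the integers. [dist_cos] bounds each average by dl plus a multiple of
    the average of 1 - cos (2 pi s_i), which is at most 1 / (M + 1) by [kernel_unit]. *)
Lemma fejer_bound M (f : T -> R[i]) (w : T) (B K dl : R) : 0 <= K -> 0 < dl < 2^-1 ->
  periodicT f -> lipT K f -> (forall w, cmod (f w) <= B) ->
  cmod (fejer M f w - f w) <=
  K * n%:R * (dl + (1 - cos (2 * pi * dl))^-1 * M.+1%:R^-1).
Proof.
move=> K0 dl0 pf lf fB; have mf := lip_cmeas K0 lf.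
have mk := cmeas_real (meas_kernel M).
have ik : cintegrable haar (fun s => (kernel M s)%:C%C).
  apply: (@haar_integrable _ _ _ #|{: {ffun 'I_n -> 'I_M.+1}}|%:R) => // s.
  by rewrite cmod_real ger0_norm ?kernel_ge0// kernel_le.
have ick k : cintegrable haar (fun s => chr k s * (kernel M s)%:C%C).
  apply: (@haar_integrable _ _ _ #|{: {ffun 'I_n -> 'I_M.+1}}|%:R) => [|s].
    by apply: cmeasM => //; exact: cmeas_chr.
  by rewrite cmodM cmod_chr mul1r cmod_real ger0_norm ?kernel_ge0// kernel_le.
have ifk : cintegrable haar (fun s => f (addT w s) * (kernel M s)%:C%C).
  apply: (@haar_integrable _ _ _ (B * #|{: {ffun 'I_n -> 'I_M.+1}}|%:R)) => [|s].
    by apply: cmeasM => //; exact: cmeas_shiftr.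
  rewrite cmodM cmod_real ger0_norm ?kernel_ge0// ler_pM ?cmod_ge0 ?kernel_ge0//.
  exact: kernel_le.
rewrite (fejer_conv M w mf pf fB) -[f w]mulr1 -(kernel_int M) -cintZ//.
rewrite -cintB//; last exact: cintegrableZ.
set c := (1 - cos (2 * pi * dl))^-1.
pose g i s : R[i] := dl%:C%C * (kernel M s)%:C%C +
  c%:C%C * ((kernel M s)%:C%C - chr (unitZ i) s * (kernel M s)%:C%C).
have ig i : cintegrable haar (g i).
  apply: cintegrableD; first exact: cintegrableZ.
  by apply: cintegrableZ; exact: cintegrableB.
pose G s : R[i] := K%:C%C * \sum_(i < n) g i s.
apply: (@le_trans _ _ (complex.Re (cint haar G))).
  apply: cmod_cint_le_Re.
  - by apply: cintegrableB => //; exact: cintegrableZ.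
  - by apply: cintegrableZ; exact: cintegrable_sum.
  move=> s; rewrite -mulrBl cmodM cmod_real ger0_norm ?kernel_ge0//.
  have [l hl] := nearest_int s.
  rewrite ReM /= mul0r subr0 Re_sum.
  apply: (@le_trans _ _ (K * \sum_(i < n) `|tnth s i - (l 0 i)%:~R| * kernel M s)).
    rewrite -mulr_suml (mulrA K) ler_wpM2r ?kernel_ge0//.
    (* Periodicity lets s be replaced by a representative in [-1/2, 1/2]^n before the Lipschitz
       bound is applied. *)
    have := lf w (translT s (- l)).
    have -> : addT w (translT s (- l)) = translT (addT w s) (- l).
      by apply: eq_from_tnth => i; rewrite !tnth_mktuple addrA.
    rewrite pf => /le_trans; apply; rewrite ler_wpM2l//; apply: ler_sum => i _.
    by rewrite tnth_mktuple mxE mulrNz.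
  rewrite ler_wpM2l//; apply: ler_sum => i _.
  rewrite /= !mul0r !mulr0 !subr0.
  rewrite -[X in _ + c * (X - _)]mul1r -mulrBl (mulrA c) -mulrDl ler_wpM2r ?kernel_ge0//.
  have -> : cos (2 * pi * dotT s (unitZ i)) = complex.Re (expi (tnth s i)).
    rewrite /= /dotT (bigD1 i)//= big1 => [|j /negPf ji].
      by rewrite mxE eqxx mulr1 addr0.
    by rewrite mxE ji mulr0.
  exact: dist_cos.
rewrite /G cintZ; last exact: cintegrable_sum.
rewrite cint_sum// ReM /= mul0r subr0 -mulrA ler_wpM2l//.
rewrite Re_sum.
rewrite mulr_natl -[X in _ *+ X]card_ord -sumr_const; apply: ler_sum => i _.
rewrite /g cintD//; first last.
- by apply: cintegrableZ; exact: cintegrableB.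
- exact: cintegrableZ.
rewrite cintZ// cintZ; last exact: cintegrableB.
rewrite cintB// kernel_int.
have [dp dlt] := andP dl0; have pi0 := pi_gt0 R.
move: (kernel_unit M i); set v := cint _ (fun s => chr _ s * _); move: v => v h.
rewrite ReD !ReM ReD ReN /= !mul0r !subr0 mulr1 lerD2l.
apply: ler_wpM2l; last by rewrite lerBlDl -lerBlDr.
by rewrite invr_ge0 subr_ge0 cos_le1.
Qed.

(** The threshold does not depend on f, and the error scales with K; one M thus serves all
    derivatives up to a given order at once. *)
Lemma fejer_unif (e : R) : 0 < e -> exists M0, forall M, (M0 <= M)%N ->
  forall (f : T -> R[i]) (B K : R) w, 0 <= K -> periodicT f -> lipT K f ->
  (forall w, cmod (f w) <= B) -> cmod (fejer M f w - f w) <= K * e.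
Proof.
move=> e0; have n0 : (0 : R) < n.+1%:R by rewrite ltr0n.
(* 1/4 keeps dl below 1/2, and n + 1 in place of n avoids division by 0 for n = 0. *)
pose dl : R := Num.min 4^-1 (e / (2 * n.+1%:R)).
have q0 : 0 < e / (2 * n.+1%:R) by rewrite divr_gt0// mulr_gt0.
have dl0 : 0 < dl < 2^-1.
  rewrite lt_min q0 gt_min invr_gt0 ltr0n /=; apply/orP; left; lra.
have dle : dl <= e / (2 * n.+1%:R) by rewrite ge_min lexx orbT.
set c := (1 - cos (2 * pi * dl))^-1.
have c0 : 0 <= c by rewrite invr_ge0 subr_ge0 cos_le1.
have /cvg_eps h := cvg0_scale c (@cvg_harmonic R).
have [|M0 hM] := h _ _ q0; first by move=> m; rewrite mulr_ge0// /harmonic/= invr_ge0.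
exists M0 => M M0M f B K w K0 pf lf fB.
apply: le_trans (fejer_bound M w K0 dl0 pf lf fB) _.
rewrite -mulrA ler_wpM2l// -/c.
have := hM M M0M; rewrite /harmonic/= => hc.
apply: (@le_trans _ _ (n%:R * (e / (2 * n.+1%:R) + e / (2 * n.+1%:R)))).
  by rewrite ler_wpM2l// lerD.
rewrite (_ : _ + _ = e / n.+1%:R); last by rewrite invfM mulrA mulrAC -splitr.
by rewrite mulrCA ger_pMr// ler_pdivrMr// mul1r ler_nat.
Qed.

End Fejer.

(** * Schwartz functions on Z^n x T^n *)

Section Partials.
Variables (R : realType) (n : nat).
Local Notation T := (Tn R n).
Local Notation Z := (Zn n).
Implicit Types (f g : T -> R[i]) (w : T) (i : 'I_n) (d : R[i]).

(** [has_partial] and [partial] merged into one relation carrying the value, so that the rules of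
    [is_derive] yield existence and value together. *)
Definition isp i f w d :=
  is_derive (0 : R) 1 (fun t => complex.Re (f (bumpT w i t))) (complex.Re d) /\
  is_derive (0 : R) 1 (fun t => complex.Im (f (bumpT w i t))) (complex.Im d).

Lemma ispP i f w d : isp i f w d -> has_partial i f w /\ partial i f w = d.
Proof.
move=> [hr hi]; split; first by split; [case: hr|case: hi].
by apply: eqRI; rewrite /partial/= derive1E derive_val.
Qed.

Lemma has_isp i f w : has_partial i f w -> isp i f w (partial i f w).
Proof.
by move=> [hr hi]; split; rewrite /partial/= derive1E; exact: derivableP.
Qed.

Lemma bumpT0 w i : bumpT w i 0 = w.
Proof.
by apply: eq_from_tnth => j; rewrite tnth_mktuple mul0rn addr0.
Qed.

Lemma bumpTD w i (s t : R) : bumpT (bumpT w i s) i t = bumpT w i (s + t).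
Proof. by apply: eq_from_tnth => j; rewrite !tnth_mktuple -addrA -mulrnDl. Qed.

Definition bump0 i (t : R) : T := [tuple t *+ (j == i) | j < n].

Lemma bumpT_addT w i t : bumpT w i t = addT w (bump0 i t).
Proof. by apply: eq_from_tnth => j; rewrite !tnth_mktuple. Qed.

Lemma bumpT_translT w i t l : bumpT (translT w l) i t = translT (bumpT w i t) l.
Proof. by rewrite !bumpT_addT addT_translT. Qed.

Lemma bumpT_subT w i t x : bumpT (subT w x) i t = subT (bumpT w i t) x.
Proof. by apply: eq_from_tnth => j; rewrite !tnth_mktuple addrAC. Qed.

Lemma isp_lin i f g w d e (a : R[i]) : isp i f w d -> isp i g w e ->
  isp i (fun x => a * f x + g x) w (a * d + e).
Proof.
move=> [fr fi] [gr gi]; split.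
  have -> : (fun t => complex.Re (a * f (bumpT w i t) + g (bumpT w i t))) =
      (complex.Re a \*: (fun t => complex.Re (f (bumpT w i t)) : R^o)) -
      (complex.Im a \*: (fun t => complex.Im (f (bumpT w i t)) : R^o)) +
      (fun t => complex.Re (g (bumpT w i t)) : R^o).
    by apply/funext => t; rewrite ReD ReM.
  by rewrite ReD ReM; apply: is_deriveD.
have -> : (fun t => complex.Im (a * f (bumpT w i t) + g (bumpT w i t))) =
    (complex.Re a \*: (fun t => complex.Im (f (bumpT w i t)) : R^o)) +
    (complex.Im a \*: (fun t => complex.Re (f (bumpT w i t)) : R^o)) +
    (fun t => complex.Im (g (bumpT w i t)) : R^o).
  by apply/funext => t; rewrite ImD ImM.
by rewrite ImD ImM; apply: is_deriveD.
Qed.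

Lemma isp_cst i w (a : R[i]) : isp i (fun _ => a) w 0.
Proof. by split; exact: is_derive_cst. Qed.

Lemma isp_mul i f g w d e : isp i f w d -> isp i g w e ->
  isp i (fun x => f x * g x) w (f w * e + d * g w).
Proof.
move=> [fr fi] [gr gi]; split.
  have -> : (fun t => complex.Re (f (bumpT w i t) * g (bumpT w i t))) =
      ((fun t => complex.Re (f (bumpT w i t)) : R^o) * (fun t => complex.Re (g (bumpT w i t)) : R^o)) -
      ((fun t => complex.Im (f (bumpT w i t)) : R^o) * (fun t => complex.Im (g (bumpT w i t)) : R^o)).
    by apply/funext => t; rewrite ReM.
  apply: is_derive_eq; rewrite !bumpT0 ReD !ReM /GRing.scale/=; ring.
have -> : (fun t => complex.Im (f (bumpT w i t) * g (bumpT w i t))) =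
    ((fun t => complex.Re (f (bumpT w i t)) : R^o) * (fun t => complex.Im (g (bumpT w i t)) : R^o)) +
    ((fun t => complex.Im (f (bumpT w i t)) : R^o) * (fun t => complex.Re (g (bumpT w i t)) : R^o)).
  by apply/funext => t; rewrite ImM.
apply: is_derive_eq; rewrite !bumpT0 ImD !ImM /GRing.scale/=; ring.
Qed.

Lemma isp_conj i f w d : isp i f w d -> isp i (fun x => (f x)^*) w d^*.
Proof.
move=> [fr fi]; split.
  by rewrite ReJ; under eq_fun do rewrite ReJ.
rewrite ImJ; under eq_fun do rewrite ImJ.
exact: (is_deriveN fi).
Qed.

Lemma isp_subT i f x w d : isp i f (subT w x) d -> isp i (fun v => f (subT v x)) w d.
Proof.
by move=> [fr fi]; split; under eq_fun do rewrite -bumpT_subT.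
Qed.

Lemma isp_translT i f w l d : periodicT f -> isp i f w d -> isp i f (translT w l) d.
Proof.
by move=> pf [fr fi]; split; under eq_fun do rewrite bumpT_translT pf.
Qed.

Definition dfac i (k : Z) : R[i] := (0 +i* (2 * pi * (k 0 i)%:~R))%C.

Lemma dotT_bumpT w i t k : dotT (bumpT w i t) k = dotT w k + t * (k 0 i)%:~R.
Proof.
rewrite bumpT_addT dotT_addT; congr (_ + _); rewrite /dotT (bigD1 i)//= big1.
  by rewrite tnth_mktuple eqxx addr0.
by move=> j /negPf ji; rewrite tnth_mktuple ji mul0r.
Qed.

Lemma isp_chr i k w : isp i (chr k) w (dfac i k * chr k w).
Proof.
pose h (t : R) : R := 2 * pi * (dotT w k + t * (k 0 i)%:~R).
have dh : is_derive (0 : R) 1 h (2 * pi * (k 0 i)%:~R).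
  have -> : h = (cst (2 * pi * dotT w k) : R -> R^o) + ((2 * pi * (k 0 i)%:~R) \*: (id : R -> R^o)).
    by apply/funext => t; rewrite /h mulrDr (mulrC t) mulrA.
  apply: is_derive_eq; rewrite add0r /GRing.scale/=; ring.
have h0 : h 0 = 2 * pi * dotT w k by rewrite /h mul0r addr0.
split.
  have -> : (fun t => complex.Re (chr k (bumpT w i t))) = cos \o h.
    by apply/funext => t; rewrite /chr dotT_bumpT.
  apply: is_derive_eq; rewrite h0 ReM /=; ring.
have -> : (fun t => complex.Im (chr k (bumpT w i t))) = sin \o h.
  by apply/funext => t; rewrite /chr dotT_bumpT.
apply: is_derive_eq; rewrite h0 ImM /=; ring.
Qed.

(** [isp] speaks only of the parameter 0; re-centring at [bumpT w i t] gives the derivative along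
    the whole line. *)
Lemma isp_at i f : (forall w, has_partial i f w) -> forall w (t : R),
  is_derive t 1 (fun s => complex.Re (f (bumpT w i s)))
    (complex.Re (partial i f (bumpT w i t))) /\
  is_derive t 1 (fun s => complex.Im (f (bumpT w i s)))
    (complex.Im (partial i f (bumpT w i t))).
Proof.
move=> hf w t; have [hr hi] := has_isp (hf (bumpT w i t)).
have sh (u : R -> R) (d : R) : is_derive (0 : R) 1 (fun s => u (t + s)) d -> is_derive t 1 u d.
  move=> du; have -> : u = (fun s => u (t + s)) \o (fun s => s - t).
    by apply/funext => s /=; rewrite addrC subrK.
  have d1 : is_derive t 1 (fun s : R => s - t) 1 by exact: (@is_derive_shift R t 1 (- t)).
  rewrite -[d]mulr1; apply: is_derive1_comp.
  by rewrite subrr.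
split; apply: sh; by under eq_fun do rewrite -bumpTD.
Qed.

(** The mean value theorem is applied to the real and the imaginary part separately, whence the
    factor 2. *)
Lemma bump_lip i f (K : R) : (forall w, has_partial i f w) ->
  (forall w, cmod (partial i f w) <= K) -> forall w t,
  cmod (f (bumpT w i t) - f w) <= 2 * K * `|t|.
Proof.
move=> hf fK w t.
have mvt (u du : R -> R) : (forall s : R, is_derive s 1 u (du s)) -> (forall s, `|du s| <= K) ->
    `|u t - u 0| <= K * `|t|.
  move=> hu duK; have cu a b : {within `[a, b], continuous u}.
    by apply: derivable_within_continuous => x _; case: (hu x).
  case: (leP 0 t) => t0.
    have [c _ ->] := MVT_segment t0 (fun x _ => hu x) (cu _ _).
    by rewrite subr0 normrM ler_wpM2r.
  have [c _ e] := MVT_segment (ltW t0) (fun x _ => hu x) (cu _ _).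
  by rewrite distrC e sub0r normrM normrN ler_wpM2r.
rewrite -{2}(bumpT0 w i); apply: le_trans (cmod_le_ReIm _) _.
rewrite ReD ReN ImD ImN (_ : 2 * K * `|t| = K * `|t| + K * `|t|); last by ring.
apply: lerD.
- apply: (mvt (fun s => complex.Re (f (bumpT w i s)))
    (fun s => complex.Re (partial i f (bumpT w i s)))) => s.
    by have [] := isp_at hf w s.
  exact: le_trans (Re_le_cmod _) (fK _).
- apply: (mvt (fun s => complex.Im (f (bumpT w i s)))
    (fun s => complex.Im (partial i f (bumpT w i s)))) => s.
    by have [] := isp_at hf w s.
  exact: le_trans (Im_le_cmod _) (fK _).
Qed.

Lemma partial_lip f (K : R) : (forall i w, has_partial i f w) ->
  (forall i w, cmod (partial i f w) <= K) -> lipT (2 * K) f.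
Proof.
move=> hf fK w t.
(* The path from w to w + t moves one coordinate at a time; [p m] has completed the first m
   moves. *)
pose p (m : nat) : T := [tuple (if (j < m)%N then tnth t j else 0) | j < n].
have p0 : addT w (p 0%N) = w.
  by apply: eq_from_tnth => j; rewrite !tnth_mktuple ltn0 addr0.
have pn : p n = t by apply: eq_from_tnth => j; rewrite tnth_mktuple ltn_ord.
have key m : (m <= n)%N -> cmod (f (addT w (p m)) - f w) <=
    2 * K * \sum_(j < n | (j < m)%N) `|tnth t j|.
  elim: m => [_|m IH mn].
    by rewrite p0 subrr cmod0 big1 ?mulr0.
  pose i := Ordinal mn.
  have -> : addT w (p m.+1) = bumpT (addT w (p m)) i (tnth t i).
    apply: eq_from_tnth => j; rewrite !tnth_mktuple ltnS leq_eqVlt -addrA; congr (_ + _).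
    rewrite -val_eqE/=; case: eqVneq => [jm|_] /=; last by rewrite mulr0n addr0.
    by rewrite jm ltnn add0r mulr1n; congr (tnth t _); exact: val_inj.
  rewrite (bigD1 i)/= ?ltnSn// mulrDr.
  have -> : f (bumpT (addT w (p m)) i (tnth t i)) - f w =
    (f (bumpT (addT w (p m)) i (tnth t i)) - f (addT w (p m))) + (f (addT w (p m)) - f w).
    by rewrite addrA subrK.
  apply: le_trans (cmodD _ _) _; apply: lerD; first exact: bump_lip.
  apply: le_trans (IH (ltnW mn)) _.
  rewrite le_eqVlt; apply/orP; left; apply/eqP; congr (_ * _); apply: eq_bigl => j.
  by rewrite ltn_neqAle -val_eqE ltnS andbC.
have := key n (leqnn n); rewrite pn => /le_trans; apply.
rewrite le_eqVlt; apply/orP; left; apply/eqP; congr (_ * _); apply: eq_bigl => j.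
by rewrite ltn_ord.
Qed.

End Partials.

Section SchwartzClass.
Variables (R : realType) (n : nat).
Local Notation T := (Tn R n).
Local Notation Z := (Zn n).
Local Notation weight := (@weight R n).
Implicit Types (F G : Z * T -> R[i]) (w : T) (i : 'I_n).

Definition pF i F : Z * T -> R[i] := fun y => partial i (fun eta => F (y.1, eta)) y.2.

Lemma weight_ge1 (k : Z) : 1 <= (weight k : R).
Proof. by rewrite lerDl sumr_ge0. Qed.

Lemma weight_gt0 (k : Z) : 0 < (weight k : R).
Proof. exact: lt_le_trans ltr01 (weight_ge1 k). Qed.

Lemma weight_ge0 (k : Z) : 0 <= (weight k : R).
Proof. exact: ltW (weight_gt0 k). Qed.

Lemma weightX_ge0 (k : Z) N : 0 <= (weight k : R) ^+ N.
Proof. by rewrite exprn_ge0// weight_ge0. Qed.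

(** From 1 + a <= (1 + b) (1 + c) for a <= b + c and b, c >= 0. It makes rapid decrease invariant
    under translation. *)
Lemma weight_add (j m : Z) : (weight j : R) <= weight (j - m) * weight m.
Proof.
have abc : \sum_(i < n) `|(j 0 i)%:~R : R| <=
    \sum_(i < n) `|((j - m) 0 i)%:~R : R| + \sum_(i < n) `|(m 0 i)%:~R : R|.
  rewrite -big_split/=; apply: ler_sum => i _; rewrite !mxE intrD mulrNz.
  by have := ler_normD ((j 0 i)%:~R - (m 0 i)%:~R : R) (m 0 i)%:~R; rewrite subrK.
have b0 : 0 <= \sum_(i < n) `|((j - m) 0 i)%:~R : R| by exact: sumr_ge0.
have c0 : 0 <= \sum_(i < n) `|(m 0 i)%:~R : R| by exact: sumr_ge0.
rewrite /Defs.weight; move: abc b0 c0.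
set a := \sum_(i < n) `|(j 0 i)%:~R|; set b := \sum_(i < n) `|((j - m) 0 i)%:~R|.
set c := \sum_(i < n) `|(m 0 i)%:~R|; move: a b c => a b c abc b0 c0; nra.
Qed.

(** Coinduction for the Schwartz class: a closure property requires a single differentiation, with C
    the set of all functions of the given shape, and no formula for iterated derivatives. *)
Lemma schwartz_coind (C : set (Z * T -> R[i])) :
  (forall F, C F -> [/\ forall j, periodicT (fun eta => F (j, eta)),
     forall j i w, has_partial i (fun eta => F (j, eta)) w,
     forall N : nat, exists B : R, forall j w, weight j ^+ N * cmod (F (j, w)) <= B &
     forall i, C (pF i F)]) ->
  C `<=` @schwartzZT R n.
Proof.
move=> hC.
have key s F : C F -> exists2 G, C G &
    forall j, partials s (fun eta => F (j, eta)) = (fun eta => G (j, eta)).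
  elim: s => [|i s IH] CF; first by exists F.
  have [G CG GE] := IH CF; have [_ _ _ CG'] := hC _ CG.
  by exists (pF i G) => // j; rewrite /= -/(partials s _) GE.
move=> F CF; split.
- by move=> j w l; have [h _ _ _] := hC _ CF; exact: h.
- move=> j s i w; have [G CG ->] := key s F CF.
  by have [_ h _ _] := hC _ CG; exact: h.
- move=> N s; have [G CG GE] := key s F CF; have [_ _ h _] := hC _ CG.
  by have [B hB] := h N; exists B => j w; rewrite GE.
Qed.

Lemma schwartz_dest F : schwartzZT F -> [/\ forall j, periodicT (fun eta => F (j, eta)),
     forall j i w, has_partial i (fun eta => F (j, eta)) w,
     forall N : nat, exists B : R, forall j w, weight j ^+ N * cmod (F (j, w)) <= B &
     forall i, schwartzZT (pF i F)].
Proof.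
move=> [pf hf bf].
have pE s i j : partials s (fun eta => pF i F (j, eta)) =
    partials (rcons s i) (fun eta => F (j, eta)).
  by rewrite /partials foldr_rcons.
split=> // [j i w|N|i].
- exact: (hf j [::]).
- exact: (bf N [::]).
split.
- move=> j w l; rewrite /pF/=.
  have /ispP[_ ->//] := isp_translT l (pf j) (has_isp (hf j [::] i w)).
- by move=> j s i' w; rewrite pE.
- by move=> N s; have [B hB] := bf N (rcons s i); exists B => j w; rewrite pE.
Qed.

Lemma schwartz_lin (a : R[i]) F G : schwartzZT F -> schwartzZT G ->
  schwartzZT (fun y => a * F y + G y).
Proof.
move=> SF SG.
apply: (@schwartz_coind [set K | exists F' G', [/\ schwartzZT F', schwartzZT G' &
    K = fun y => a * F' y + G' y]]); last by exists F, G.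
move=> _ [{}F [{}G [{}SF {}SG ->]]].
have [p1 h1 b1 d1] := schwartz_dest SF; have [p2 h2 b2 d2] := schwartz_dest SG.
split.
- by move=> j w l; rewrite p1 p2.
- by move=> j i w; have /ispP[] := isp_lin a (has_isp (h1 j i w)) (has_isp (h2 j i w)).
- move=> N; have [B1 hB1] := b1 N; have [B2 hB2] := b2 N.
  exists (cmod a * B1 + B2) => j w.
  apply: (@le_trans _ _ (weight j ^+ N * (cmod a * cmod (F (j, w)) + cmod (G (j, w))))).
    by rewrite ler_wpM2l ?weightX_ge0// -cmodM cmodD.
  by rewrite mulrDr mulrCA lerD// ler_wpM2l ?cmod_ge0.
- move=> i; exists (pF i F), (pF i G); split=> //; apply/funext => -[j w].
  by rewrite /pF/=; have /ispP[_ ->] := isp_lin a (has_isp (h1 j i w)) (has_isp (h2 j i w)).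
Qed.

Lemma schwartz0 : schwartzZT (fun _ : Z * T => 0 : R[i]).
Proof.
apply: (@schwartz_coind [set K | K = fun _ => 0]); last by [].
move=> _ ->; split; first by [].
- by move=> j i w; have /ispP[] := isp_cst i w (0 : R[i]).
- by move=> N; exists 0 => j w; rewrite cmod0 mulr0.
- by move=> i; apply/funext => -[j w]; rewrite /pF/=; have /ispP[] := isp_cst i w (0 : R[i]).
Qed.

Lemma schwartz_scale (a : R[i]) F : schwartzZT F -> schwartzZT (fun y => a * F y).
Proof.
by move=> SF; have := schwartz_lin a SF schwartz0; under eq_fun do rewrite addr0.
Qed.

Lemma schwartz_add F G : schwartzZT F -> schwartzZT G -> schwartzZT (fun y => F y + G y).
Proof.
by move=> SF SG; have := schwartz_lin 1 SF SG; under eq_fun do rewrite mul1r.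
Qed.

Lemma schwartz_sub F G : schwartzZT F -> schwartzZT G -> schwartzZT (fun y => F y - G y).
Proof.
move=> SF SG; have := schwartz_lin (-1) SG SF.
by under eq_fun do rewrite mulN1r addrC.
Qed.

Lemma schwartz_sum (I : Type) (s : seq I) (F : I -> Z * T -> R[i]) :
  (forall q, schwartzZT (F q)) -> schwartzZT (fun y => \sum_(q <- s) F q y).
Proof.
move=> SF; elim: s => [|q s IH].
  by under eq_fun do rewrite big_nil; exact: schwartz0.
by under eq_fun do rewrite big_cons; exact: schwartz_add.
Qed.

Lemma schwartz_conj F : schwartzZT F -> schwartzZT (conjf F).
Proof.
move=> SF.
apply: (@schwartz_coind [set K | exists2 F', schwartzZT F' & K = conjf F']); last by exists F.
move=> _ [{}F {}SF ->]; have [p1 h1 b1 d1] := schwartz_dest SF; split.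
- by move=> j w l; rewrite /conjf p1.
- by move=> j i w; have /ispP[] := isp_conj (has_isp (h1 j i w)).
- by move=> N; have [B hB] := b1 N; exists B => j w; rewrite /conjf cmodJ.
- move=> i; exists (pF i F) => //; apply/funext => -[j w].
  by rewrite /pF/= /conjf; have /ispP[_ ->] := isp_conj (has_isp (h1 j i w)).
Qed.

Lemma schwartz_shift (m : Z) (t : T) F : schwartzZT F ->
  schwartzZT (fun y => F (y.1 - m, subT y.2 t)).
Proof.
move=> SF.
apply: (@schwartz_coind [set K | exists2 F', schwartzZT F' &
    K = fun y => F' (y.1 - m, subT y.2 t)]); last by exists F.
move=> _ [{}F {}SF ->]; have [p1 h1 b1 d1] := schwartz_dest SF.
have h j i w := isp_subT (has_isp (h1 (j - m) i (subT w t))).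
split.
- by move=> j w l; rewrite /= subT_translT p1.
- by move=> j i w; have /ispP[] := h j i w.
- move=> N; have [B hB] := b1 N; exists (weight m ^+ N * B) => j w.
  apply: (@le_trans _ _ ((weight (j - m) * weight m) ^+ N * cmod (F (j - m, subT w t)))).
    by rewrite ler_wpM2r ?cmod_ge0// lerXn2r ?nnegrE ?mulr_ge0 ?weight_ge0 ?weight_add.
  by rewrite exprMn mulrAC mulrC ler_wpM2l ?weightX_ge0.
- move=> i; exists (pF i F) => //; apply/funext => -[j w].
  by rewrite /pF/=; have /ispP[_ ->] := h j i w.
Qed.

Lemma schwartz_chr (a : Z -> R[i]) (k : Z) F : (forall j, cmod (a j) <= 1) ->
  schwartzZT F -> schwartzZT (fun y => a y.1 * (chr k y.2 * F y)).
Proof.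
move=> a1 SF.
apply: (@schwartz_coind [set K | exists2 F', schwartzZT F' &
    K = fun y => a y.1 * (chr k y.2 * F' y)]); last by exists F.
move=> _ [{}F {}SF ->]; have [p1 h1 b1 d1] := schwartz_dest SF.
have h j i w : isp i (fun eta => a j * (chr k eta * F (j, eta))) w
    (a j * (chr k w * (dfac R i k * F (j, w) + pF i F (j, w)))).
  have := isp_lin (a j) (isp_mul (isp_chr i k w) (has_isp (h1 j i w))) (isp_cst i w 0).
  under eq_fun do rewrite addr0.
  by congr isp; rewrite addr0 /pF/=; ring.
split.
- by move=> j w l; rewrite /= p1 chr_periodic.
- by move=> j i w; have /ispP[] := h j i w.
- move=> N; have [B hB] := b1 N; exists B => j w; apply: le_trans (hB j w).
  rewrite ler_wpM2l ?weightX_ge0// !cmodM cmod_chr mul1r.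
  by rewrite ler_piMl ?cmod_ge0.
- move=> i; exists (fun y => dfac R i k * F y + pF i F y); first exact: schwartz_lin.
  by apply/funext => -[j w]; rewrite /pF/=; have /ispP[_ ->] := h j i w.
Qed.

Lemma schwartz_mulZ (a : Z -> R[i]) F : (forall j, cmod (a j) <= 1) ->
  schwartzZT F -> schwartzZT (fun y => a y.1 * F y).
Proof.
move=> a1 SF; have := schwartz_chr 0 a1 SF.
by under eq_fun do rewrite chr0 mul1r.
Qed.

(** A character on the single row j. The values of a tempered distribution on these functions are
    its Fourier coefficients and determine it, see [tz_zero]. *)
Definition mono (j l : Z) : Z * T -> R[i] := fun y => (y.1 == j)%:R * chr l y.2.

Lemma schwartz_mono j l : schwartzZT (mono j l).
Proof.
apply: (@schwartz_coind [set K | exists a : R[i], K = fun y => a * mono j l y]); last first.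
  by exists 1; apply/funext => y; rewrite mul1r.
move=> _ [a ->].
have h k i w : isp i (fun eta => a * mono j l (k, eta)) w (a * dfac R i l * mono j l (k, w)).
  have := isp_lin (a * (k == j)%:R) (isp_chr i l w) (isp_cst i w 0).
  under eq_fun do rewrite addr0.
  rewrite /mono/=; under eq_fun do rewrite -mulrA.
  by congr isp; rewrite addr0; ring.
split.
- by move=> k w t; rewrite /mono/= chr_periodic.
- by move=> k i w; have /ispP[] := h k i w.
- move=> N; exists (weight j ^+ N * cmod a) => k w.
  rewrite /mono/= !cmodM cmod_chr mulr1; case: eqVneq => [->|_].
    by rewrite cmod1 mulr1.
  by rewrite cmod0 !mulr0 mulr_ge0 ?weightX_ge0 ?cmod_ge0.
- move=> i; exists (a * dfac R i l); apply/funext => -[k w].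
  by rewrite /pF/=; have /ispP[_ ->] := h k i w.
Qed.

(* The seminorms through which continuity is expressed in temperedZT. *)
Definition snle (N : nat) F (K : R) := forall s : seq 'I_n, (size s <= N)%N ->
  forall j w, weight j ^+ N * cmod (partials s (fun eta => F (j, eta)) w) <= K.

(** The order p and the exponent N are kept apart because tails need one more power of the weight
    and Lipschitz constants one more derivative. *)
Lemma schwartz_partials_bound p N F : schwartzZT F -> exists2 K, 0 <= K &
  forall s : seq 'I_n, (size s <= p)%N ->
  forall j w, weight j ^+ N * cmod (partials s (fun eta => F (j, eta)) w) <= K.
Proof.
elim: p F => [|p IH] F SF.
  have [_ _ b1 _] := schwartz_dest SF; have [B hB] := b1 N.
  exists (Num.max B 0); first by rewrite le_max lexx orbT.
  by move=> s; rewrite leqn0 => /nilP -> j w; rewrite le_max hB.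
have [_ _ _ d1] := schwartz_dest SF.
have [K0 K00 hK0] := IH F SF.
have /choice[K hK] i : exists K, 0 <= K /\ forall s : seq 'I_n, (size s <= p)%N ->
    forall j w, weight j ^+ N * cmod (partials s (fun eta => pF i F (j, eta)) w) <= K.
  by have [K K0' hK] := IH _ (d1 i); exists K.
exists (K0 + \sum_i K i).
  by rewrite addr_ge0// sumr_ge0// => i _; have [] := hK i.
have K_ge0 i : 0 <= K i by have [] := hK i.
(* [pF i] performs the innermost derivative, which is the last entry of the list. *)
elim/last_ind => [_ j w|s i _].
  apply: le_trans (hK0 [::] (leq0n p) j w) _.
  by rewrite lerDl sumr_ge0.
rewrite size_rcons ltnS => sp j w; rewrite /partials foldr_rcons.
have [_ h] := hK i; apply: le_trans (h s sp j w) _.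
rewrite (bigD1 i)//= addrCA lerDl addr_ge0// sumr_ge0//.
Qed.

Lemma schwartz_sn N F : schwartzZT F -> exists2 K, 0 <= K & snle N F K.
Proof. by move=> SF; have [K K0 hK] := schwartz_partials_bound N N SF; exists K. Qed.

Lemma schwartz_bounded F : schwartzZT F -> exists2 B, 0 <= B & forall y, cmod (F y) <= B.
Proof.
move=> SF; have [K K0 hK] := schwartz_sn 0 SF; exists K => // -[j w].
by have := hK [::] (leqnn 0) j w; rewrite expr0 mul1r.
Qed.

Lemma schwartz_lip F : schwartzZT F -> exists2 K, 0 <= K & forall j, lipT K (fun eta => F (j, eta)).
Proof.
move=> SF; have [_ h1 _ _] := schwartz_dest SF.
have [K K0 hK] := schwartz_partials_bound 1 0 SF; exists (2 * K); first by rewrite mulr_ge0.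
move=> j; apply: partial_lip => [i w|i w]; first exact: h1.
by have := hK [:: i] (leqnn 1) j w; rewrite expr0 mul1r.
Qed.

Lemma schwartz_cmeas_sec F j : schwartzZT F -> cmeasurable (fun eta => F (j, eta)).
Proof. by move=> SF; have [K K0 hK] := schwartz_lip SF; exact: lip_cmeas (hK j). Qed.

Lemma schwartz_cmeas F : schwartzZT F -> cmeasurable F.
Proof. by move=> SF; apply: cmeas_ZX => k; exact: schwartz_cmeas_sec. Qed.

Lemma weight_finite (r : R) : exists J : seq Z, uniq J /\ forall k, weight k <= r -> k \in J.
Proof.
pose b := `|Num.ceil r|%N.
pose f (q : {ffun 'I_n -> 'I_(2 * b).+1}) : Z := \row_i ((q i : int) - b%:Z).
exists (undup [seq f q | q <- enum {: {ffun 'I_n -> 'I_(2 * b).+1}}]); split.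
  exact: undup_uniq.
move=> k kr; rewrite mem_undup.
have kb i : (`|k 0 i| <= b%:Z)%R.
  have h : `|(k 0 i)%:~R : R| <= r.
    apply: le_trans kr; rewrite /Defs.weight (bigD1 i)//= addrCA lerDl.
    by rewrite addr_ge0// sumr_ge0.
  have r0 : 0 <= r by exact: le_trans h.
  rewrite -(ler_int R) intr_norm; apply: le_trans h _.
  apply: le_trans (ceil_ge _) _; rewrite /b; rewrite ler_int.
  exact: ler_norm.
have kq i : (absz (k 0%R i + b%:Z)%R < (2 * b).+1)%N.
  have := kb i; rewrite ler_norml => /andP[h1 h2]; lia.
apply/mapP; exists [ffun i => Ordinal (kq i)]; first by rewrite mem_enum.
apply/rowP => i; rewrite mxE ffunE/=.
have := kb i; rewrite ler_norml => /andP[h1 h2]; lia.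
Qed.

Lemma schwartz_tail N F (e : R) : schwartzZT F -> 0 < e ->
  exists J : seq Z, uniq J /\ forall s : seq 'I_n, (size s <= N)%N ->
  forall j w, j \notin J -> weight j ^+ N * cmod (partials s (fun eta => F (j, eta)) w) <= e.
Proof.
move=> SF e0; have [K K0 hK] := schwartz_partials_bound N N.+1 SF.
have [J [uJ hJ]] := weight_finite (K / e); exists J; split=> // s sN j w jJ.
have wj : K / e < weight j by rewrite ltNge; apply: contra jJ => /hJ.
have := hK s sN j w; rewrite exprS -mulrA => h.
have wp := weight_gt0 j.
rewrite -(ler_pM2l wp); apply: le_trans h _.
by move: wj; rewrite ltr_pdivrMr// => /ltW.
Qed.

End SchwartzClass.

Section DifferenceQuotients.
Variables (R : realType) (n : nat).
Local Notation T := (Tn R n).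
Local Notation Z := (Zn n).
Implicit Types (f : T -> R[i]) (w : T) (i : 'I_n).

Lemma cvg_inv_dnbhs : (fun m => m.+1%:R^-1 : R) @ \oo --> (0 : R)^'.
Proof.
move=> P [e e0 hP]; have /cvgrPdist_lt/(_ _ e0) h := @cvg_harmonic R.
case: h => N _ hN; exists N => // m Nm; apply: hP; first exact: hN.
by rewrite invr_eq0 pnatr_eq0.
Qed.

Lemma quot_cvg (h : R -> R) (d : R) : is_derive (0 : R) 1 h d ->
  (fun m => m.+1%:R * (h m.+1%:R^-1 - h 0)) @ \oo --> d.
Proof.
move=> [dh dv]; have := cvg_comp _ _ cvg_inv_dnbhs dh.
rewrite -/(derive h 0 1) dv; set a := (X in X @ _ --> _ -> _).
set b := (X in _ -> X @ _ --> _); suff -> : a = b by [].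
by apply/funext => m /=; rewrite /a /b /= invrK addr0 /GRing.scale/= mulr1.
Qed.

Lemma isp_quot i f w d : isp i f w d ->
  (fun m => cmod (m.+1%:R * (f (bumpT w i m.+1%:R^-1) - f w) - d)) @ \oo --> (0 : R).
Proof.
move=> [/quot_cvg hr /quot_cvg hi]; apply/cvg_cmodP; split.
  move: hr; rewrite bumpT0; set a := (X in X @ _ --> _ -> _).
  set b := (X in _ -> X @ _ --> _); suff -> : a = b by [].
  apply/funext => m; rewrite /a /b -(rmorph_nat (real_complex R)) ReM ReD ReN /=.
  by rewrite mul0r subr0.
move: hi; rewrite bumpT0; set a := (X in X @ _ --> _ -> _).
set b := (X in _ -> X @ _ --> _); suff -> : a = b by [].
apply/funext => m; rewrite /a /b -(rmorph_nat (real_complex R)) ImM ImD ImN /=.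
by rewrite mul0r addr0.
Qed.

Lemma fc_shift f t l B : cmeasurable f -> periodicT f -> (forall w, cmod (f w) <= B) ->
  cint (haar R n) (fun w => f (addT w t) * chr (- l) w) = chr l t * fc f l.
Proof.
move=> mf pf fB.
have fi : cintegrable (haar R n) (fun s => f s * chr (- l) s).
  apply: (@haar_integrable _ _ _ B); first by apply: cmeasM => //; exact: cmeas_chr.
  by move=> s; rewrite cmodM cmod_chr mulr1.
rewrite /fc mulrC -cintZr// -(@haar_cshift _ _ (fun s => f s * chr (- l) s * chr l t) t).
- apply: eq_cint => s; rewrite -mulrA; congr (_ * _).
  by rewrite chr_addT -mulrA -chrD addNr chr0 mulr1.
- apply: cmeasM; last exact: cmeas_cst.
  by apply: cmeasM => //; exact: cmeas_chr.
- by move=> s l'; rewrite pf chr_periodic.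
Qed.

(* Differentiate int f(w + t e_i) chr(-l)(w) dw = chr(l)(t e_i) fc f l at t = 0. *)
Lemma fc_partial f i l (B K : R) : periodicT f -> (forall w, cmod (f w) <= B) ->
  0 <= K -> lipT K f -> (forall w, has_partial i f w) ->
  fc (partial i f) l = dfac R i l * fc f l.
Proof.
move=> pf fB K0 lf hf; have mf := lip_cmeas K0 lf.
(* Difference quotients along 1 / (m + 1) are bounded by the Lipschitz constant, so dominated
   convergence gives the coefficient of their limit. *)
pose D m w : R[i] := m.+1%:R * (f (bumpT w i m.+1%:R^-1) - f w).
have mfb t : cmeasurable (fun w => f (bumpT w i t)).
  by under eq_fun do rewrite bumpT_addT; exact: cmeas_shift.
have mD m : cmeasurable (D m).
  by apply: cmeasM; [exact: cmeas_cst|apply: cmeasD => //; exact: cmeasN].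
have DK m w : cmod (D m w) <= K.
  rewrite cmodM cmod_nat bumpT_addT.
  apply: (@le_trans _ _ (m.+1%:R * (K * m.+1%:R^-1))); last first.
    by rewrite mulrCA mulfV ?mulr1// pnatr_eq0.
  rewrite ler_wpM2l//; apply: le_trans (lf _ _) _; rewrite ler_wpM2l//.
  rewrite (bigD1 i)//= big1 => [|j /negPf ji].
    by rewrite tnth_mktuple eqxx addr0 mulr1n ger0_norm ?invr_ge0.
  by rewrite tnth_mktuple ji normr0.
have [_ h1] : cintegrable (haar R n) (fun w => partial i f w * chr (- l) w) /\
    (fun m => cmod (cint (haar R n) (fun w => D m w * chr (- l) w) - fc (partial i f) l))
    @ \oo --> (0 : R).
  apply: (cint_dominated (g := fun=> K)).
  - by move=> m; apply: cmeasM => //; exact: cmeas_chr.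
  - move=> w; have := isp_quot (has_isp (hf w)); apply: cvg0_le => m.
    by rewrite cmod_ge0/= -mulrBl cmodM cmod_chr mulr1.
  - exact: measurable_cst.
  - by rewrite integral_cst//= [X in (_ * X)%E]probability_setT mule1 ltry.
  - by move=> m w; rewrite cmodM cmod_chr mulr1.
apply: (cvg_cmod_unique h1).
pose w0 : T := [tuple 0 | j < n].
have chr0w : chr l w0 = 1.
  by rewrite /chr /dotT big1 ?expi0// => j _; rewrite tnth_mktuple mul0r.
have := isp_quot (isp_chr i l w0); rewrite chr0w mulr1.
move=> /(cvg0_scale (cmod (fc f l))); apply: cvg0_le => m; rewrite cmod_ge0 andTb -cmodM.
have fi : cintegrable (haar R n) (fun w => f (addT w (bump0 i m.+1%:R^-1)) * chr (- l) w).
  apply: (@haar_integrable _ _ _ B).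
    by apply: cmeasM; [exact: cmeas_shift|exact: cmeas_chr].
  by move=> s; rewrite cmodM cmod_chr mulr1.
have fi' : cintegrable (haar R n) (fun s => f s * chr (- l) s).
  apply: (@haar_integrable _ _ _ B); first by apply: cmeasM => //; exact: cmeas_chr.
  by move=> s; rewrite cmodM cmod_chr mulr1.
rewrite /D; under eq_cint do rewrite bumpT_addT -mulrA mulrBl.
rewrite cintZ; last exact: cintegrableB.
rewrite cintB// (fc_shift _ _ mf pf fB) -/(fc f l) bumpT_addT.
have -> : addT w0 (bump0 i m.+1%:R^-1) = bump0 i m.+1%:R^-1.
  by apply: eq_from_tnth => j; rewrite !tnth_mktuple add0r.
by rewrite le_eqVlt; apply/orP; left; apply/eqP; congr cmod; ring.
Qed.

End DifferenceQuotients.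

Section FejerSchwartz.
Variables (R : realType) (n : nat).
Local Notation T := (Tn R n).
Local Notation Z := (Zn n).
Local Notation weight := (@weight R n).
Implicit Types (F G : Z * T -> R[i]) (w : T) (i : 'I_n).

Lemma isp_sum i (I : Type) (s : seq I) (f : I -> T -> R[i]) w (d : I -> R[i]) :
  (forall q, isp i (f q) w (d q)) ->
  isp i (fun x => \sum_(q <- s) f q x) w (\sum_(q <- s) d q).
Proof.
move=> h; elim: s => [|q s IH].
  by rewrite big_nil; under eq_fun do rewrite big_nil; exact: isp_cst.
rewrite big_cons; under eq_fun do rewrite big_cons.
by have := isp_lin 1 (h q) IH; rewrite mul1r; under eq_fun do rewrite mul1r.
Qed.

Lemma isp_scale i (a : R[i]) f w d : isp i f w d -> isp i (fun x => a * f x) w (a * d).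
Proof.
move=> h; have := isp_lin a h (isp_cst i w 0); rewrite addr0.
by under eq_fun do rewrite addr0.
Qed.

Lemma schwartz_partials s F : schwartzZT F -> exists2 G, schwartzZT G &
  forall j, partials s (fun eta => F (j, eta)) = (fun eta => G (j, eta)).
Proof.
elim: s => [|i s IH] SF; first by exists F.
have [G SG GE] := IH SF; have [_ _ _ d] := schwartz_dest SG.
by exists (pF i G) => // j; rewrite /= -/(partials s _) GE.
Qed.

Lemma partials_lin s (a : R[i]) F G j : schwartzZT F -> schwartzZT G ->
  partials s (fun eta => a * F (j, eta) + G (j, eta)) =
  (fun eta => a * partials s (fun eta => F (j, eta)) eta +
              partials s (fun eta => G (j, eta)) eta).
Proof.
move=> SF SG; elim: s => [//|i s IH].
have [F' SF' FE] := schwartz_partials s SF; have [G' SG' GE] := schwartz_partials s SG.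
rewrite /= -!/(partials s _) IH FE GE; apply/funext => w.
have [_ h1 _ _] := schwartz_dest SF'; have [_ h2 _ _] := schwartz_dest SG'.
by have /ispP[_ ->] := isp_lin a (has_isp (h1 j i w)) (has_isp (h2 j i w)).
Qed.

Lemma partials0 s : partials s (fun _ : T => 0 : R[i]) = (fun _ => 0).
Proof.
elim: s => // i s IH; rewrite /= -/(partials s _) IH; apply/funext => w.
by have /ispP[_ ->] := isp_cst i w (0 : R[i]).
Qed.

Lemma partials_scale s (a : R[i]) F j : schwartzZT F ->
  partials s (fun eta => a * F (j, eta)) =
  (fun eta => a * partials s (fun eta => F (j, eta)) eta).
Proof.
move=> SF; have := partials_lin s a j SF (schwartz0 R n); rewrite partials0.
by under eq_fun do rewrite addr0; move=> ->; apply/funext => w; rewrite addr0.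
Qed.

Definition trZT (t : T) F : Z * T -> R[i] := fun y => F (y.1, subT y.2 t).

Lemma schwartz_tr t F : schwartzZT F -> schwartzZT (trZT t F).
Proof.
by move=> SF; have := schwartz_shift 0 t SF; under eq_fun do rewrite subr0.
Qed.

Lemma partials_tr s t F j : schwartzZT F ->
  partials s (fun eta => trZT t F (j, eta)) =
  (fun eta => partials s (fun eta => F (j, eta)) (subT eta t)).
Proof.
move=> SF; elim: s => [//|i s IH].
have [F' SF' FE] := schwartz_partials s SF.
rewrite /= -!/(partials s _) IH FE; apply/funext => w.
have [_ h1 _ _] := schwartz_dest SF'.
by have /ispP[_ ->] := isp_subT (has_isp (h1 j i (subT w t))).
Qed.

Lemma snle_tr N t F K : schwartzZT F -> snle N F K -> snle N (trZT t F) K.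
Proof. by move=> SF h s sN j w; rewrite partials_tr//; exact: h. Qed.

Definition cutZ (j : Z) F : Z * T -> R[i] := fun y => (y.1 == j)%:R * F y.

Lemma schwartz_cut j F : schwartzZT F -> schwartzZT (cutZ j F).
Proof.
move=> SF; apply: (@schwartz_mulZ _ _ (fun k => (k == j)%:R)) => // k.
by case: (k == j); rewrite ?cmod1 ?cmod0.
Qed.

Definition cutfejer M (j : Z) F : Z * T -> R[i] := fun y =>
  (y.1 == j)%:R * fejer M (fun eta => F (j, eta)) y.2.

Local Notation Q M := {ffun 'I_n -> 'I_M.+1}.

Lemma cutfejerE M j F : cutfejer M j F = (fun y => \sum_(q : Q M) \sum_(q' : Q M)
  ((#|{: Q M}|%:R : R)^-1%:C%C * fc (fun eta => F (j, eta)) (freq q - freq q')) *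
    mono j (freq q - freq q') y).
Proof.
apply/funext => y; rewrite /cutfejer /fejer mulrCA mulr_sumr mulr_sumr.
apply: eq_bigr => q _; rewrite !mulr_sumr; apply: eq_bigr => q' _.
by rewrite /mono -!mulrA; congr (_ * _); rewrite mulrCA.
Qed.

Lemma schwartz_cutfejer M j F : schwartzZT (cutfejer M j F).
Proof.
rewrite cutfejerE; apply: schwartz_sum => q; apply: schwartz_sum => q'.
by apply: schwartz_scale; exact: schwartz_mono.
Qed.

Lemma partials_fejer M s F j : schwartzZT F ->
  partials s (fejer M (fun eta => F (j, eta))) =
  fejer M (partials s (fun eta => F (j, eta))).
Proof.
move=> SF; elim: s => [//|i s IH].
have [G SG GE] := schwartz_partials s SF.
rewrite /= -!/(partials s _) IH GE; apply/funext => w.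
have [pG hG _ dG] := schwartz_dest SG.
have [B B0 hB] := schwartz_bounded SG; have [K K0 hK] := schwartz_lip SG.
suff /ispP[_ ->] : isp i (fejer M (fun eta => G (j, eta))) w
   (fejer M (partial i (fun eta => G (j, eta))) w) by [].
rewrite /fejer; apply: isp_scale; apply: isp_sum => q; apply: isp_sum => q'.
rewrite (fc_partial _ (pG j) (fun w => hB (j, w)) K0 (hK j) (hG j i)).
by rewrite mulrAC mulrC; apply: isp_scale; exact: isp_chr.
Qed.

(* Fejer means commute with the partial derivatives, hence converge in all seminorms. *)
Lemma fejer_snle N F (e : R) j : schwartzZT F -> 0 < e ->
  exists M0, forall M, (M0 <= M)%N -> snle N (fun y => cutZ j F y - cutfejer M j F y) e.
Proof.
move=> SF e0; have [K K0 hK] := schwartz_partials_bound N.+1 N SF.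
have e'0 : 0 < e / (2 * K + 1) by rewrite divr_gt0// ltr_wpDl// mulr_ge0.
have [M0 hM0] := fejer_unif n e'0; exists M0 => M M0M s sN k w.
have Sc := schwartz_cut j SF; have Sf := schwartz_cutfejer M j F.
have -> : (fun eta => cutZ j F (k, eta) - cutfejer M j F (k, eta)) =
    (fun eta => -1 * cutfejer M j F (k, eta) + cutZ j F (k, eta)).
  by apply/funext => eta; rewrite mulN1r addrC.
rewrite partials_lin// mulN1r addrC; case: (eqVneq k j) => [->|kj]; last first.
  have -> : (fun eta => cutfejer M j F (k, eta)) = (fun=> 0).
    by apply/funext => eta; rewrite /cutfejer/= (negPf kj) mul0r.
  have -> : (fun eta => cutZ j F (k, eta)) = (fun=> 0).
    by apply/funext => eta; rewrite /cutZ/= (negPf kj) mul0r.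
  by rewrite partials0 subrr cmod0 mulr0 ltW.
have -> : (fun eta => cutfejer M j F (j, eta)) = fejer M (fun eta => F (j, eta)).
  by apply/funext => eta; rewrite /cutfejer/= eqxx mul1r.
have -> : (fun eta => cutZ j F (j, eta)) = (fun eta => F (j, eta)).
  by apply/funext => eta; rewrite /cutZ/= eqxx mul1r.
rewrite partials_fejer// cmodC.
have [G SG GE] := schwartz_partials s SF; rewrite GE.
have [pG hG _ _] := schwartz_dest SG; have [B B0 hB] := schwartz_bounded SG.
have wp : 0 < weight j ^+ N by rewrite exprn_gt0// weight_gt0.
(* The decay of one further derivative yields a Lipschitz constant with the factor [weight j ^- N],
   which cancels the weight of the seminorm. *)
have lG : lipT (2 * (K / weight j ^+ N)) (fun eta => G (j, eta)).
  apply: partial_lip => [i v|i v]; first exact: hG.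
  rewrite ler_pdivlMr// mulrC -GE.
  exact: (hK (i :: s) sN j v).
have h := hM0 M M0M _ B _ w _ (pG j) lG (fun v => hB (j, v)).
rewrite mulrC -ler_pdivlMr//; apply: le_trans (h _) _.
  by rewrite mulr_ge0// divr_ge0// ltW.
rewrite ler_pdivlMr// [X in X <= _](_ : _ = 2 * K * (e / (2 * K + 1))); last first.
  by field; rewrite !gt_eqF// ltr_wpDl// mulr_ge0.
rewrite mulrA ler_pdivrMr; last by rewrite ltr_wpDl// mulr_ge0.
by rewrite mulrC ler_wpM2l ?(ltW e0)// lerDl.
Qed.

End FejerSchwartz.

(** * Tempered distributions and their Fourier coefficients *)

Section FourierCoefficients.
Variables (R : realType) (n : nat).
Local Notation T := (Tn R n).
Local Notation Z := (Zn n).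

Lemma chr_subT k (w t : T) : chr k (subT w t) = chr k w * chr (- k) t.
Proof. by rewrite -{2}(subTK w t) chr_addT -mulrA -chrD subrr chr0 mulr1. Qed.

(** The approximation runs along finite subsets of Z^n, as truncation of test functions delivers it,
    and is uniform in xi. Orthogonality of the characters then leaves an error e in each
    coefficient. *)
Lemma coef_extract (h : T -> R[i]) (c : Z -> R[i]) : cmeasurable h ->
  (forall e : R, 0 < e -> exists J : seq Z, forall J' : seq Z, uniq J' ->
    {subset J <= J'} -> forall xi, cmod (h xi - \sum_(j <- J') chr (- j) xi * c j) <= e) ->
  forall j, cint (haar R n) (fun xi => h xi * chr j xi) = c j.
Proof.
move=> mh hc j; apply/eqP; rewrite -subr_eq0 -cmod_eq0; apply/eqP/le_anti.
rewrite cmod_ge0 andbT; apply/ler_addgt0Pr => e e0; rewrite add0r.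
have [J hJ] := hc e e0; pose J' := undup (j :: J).
have uJ' : uniq J' by exact: undup_uniq.
have jJ' : j \in J' by rewrite mem_undup mem_head.
have sJ : {subset J <= J'} by move=> k kJ; rewrite mem_undup inE kJ orbT.
have {}hJ := hJ J' uJ' sJ.
pose p xi := \sum_(k <- J') chr (- k) xi * c k.
have mp : cmeasurable p.
  by apply: cmeas_sum => k; apply: cmeasM; [exact: cmeas_chr|exact: cmeas_cst].
have pi_ : cintegrable (haar R n) (fun xi => p xi * chr j xi).
  apply: (@haar_integrable _ _ _ (\sum_(k <- J') cmod (c k))).
    by apply: cmeasM => //; exact: cmeas_chr.
  move=> xi; rewrite cmodM cmod_chr mulr1; apply: le_trans (cmod_sum _ _ _) _.
  by apply: ler_sum => k _; rewrite cmodM cmod_chr mul1r.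
have hi : cintegrable (haar R n) (fun xi => h xi * chr j xi).
  apply: (@haar_integrable _ _ _ (e + \sum_(k <- J') cmod (c k))).
    by apply: cmeasM => //; exact: cmeas_chr.
  move=> xi; rewrite cmodM cmod_chr mulr1 -(subrK (p xi) (h xi)).
  apply: le_trans (cmodD _ _) _; apply: lerD; first exact: hJ.
  apply: le_trans (cmod_sum _ _ _) _.
  by apply: ler_sum => k _; rewrite cmodM cmod_chr mul1r.
have pc : cint (haar R n) (fun xi => p xi * chr j xi) = c j.
  rewrite /p; under eq_cint do rewrite mulr_suml.
  have e1 k : (fun xi => chr (- k) xi * c k * chr j xi) = (fun xi : T => c k * chr (j - k) xi).
    by apply/funext => xi; rewrite mulrAC -chrD mulrC addrC.
  rewrite cint_sum; last by move=> k; rewrite e1; apply: cintegrableZ; exact: chr_integrable.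
  rewrite (bigD1_seq j)//= big1_seq ?addr0 => [|k /andP[kj _]].
    by rewrite e1 subrr cintZ ?cint_chr ?eqxx ?mulr1//; exact: chr_integrable.
  rewrite e1 cintZ ?cint_chr ?subr_eq0; last exact: chr_integrable.
  by rewrite eq_sym (negPf kj) mulr0.
rewrite -pc -cintB//; apply: haar_cint_le.
  by apply: cmeasD; [|apply: cmeasN]; apply: cmeasM => //; exact: cmeas_chr.
by move=> xi; rewrite -mulrBl cmodM cmod_chr mulr1.
Qed.

Lemma chr_lip (k : Z) : exists2 K : R, 0 <= K & lipT K (chr k : T -> R[i]).
Proof.
have [K K0 hK] := schwartz_lip (schwartz_mono R 0 k); exists K => //.
have := hK 0; rewrite /mono/= eqxx.
by under eq_fun do rewrite mul1r.
Qed.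

Local Notation Q M := {ffun 'I_n -> 'I_M.+1}.

Lemma fejer_chr M (k : Z) (w : T) : fejer M (chr k) w =
  chr k w * cint (haar R n) (fun s => chr k s * (kernel M s)%:C%C).
Proof.
rewrite (@fejer_conv _ _ _ _ 1); first last.
- by move=> s; rewrite cmod_chr.
- exact: chr_periodic.
- exact: cmeas_chr.
rewrite -cintZ; first by apply: eq_cint => s; rewrite chr_addT mulrA.
apply: (@haar_integrable _ _ _ (#|{: Q M}|%:R)) => [|s].
  by apply: cmeasM; [exact: cmeas_chr|apply: cmeas_real; exact: meas_kernel].
by rewrite cmodM cmod_chr mul1r cmod_real ger0_norm ?kernel_ge0// kernel_le.
Qed.

Definition fejer_mult M (k : Z) : R[i] := cint (haar R n) (fun s => chr k s * (kernel M s)%:C%C).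

Lemma fejer_mult_le1 M k : cmod (fejer_mult M k) <= 1.
Proof.
have ik : cintegrable (haar R n) (fun s => (kernel M s)%:C%C).
  apply: (@haar_integrable _ _ _ #|{: Q M}|%:R) => [|s].
    by apply: cmeas_real; exact: meas_kernel.
  by rewrite cmod_real ger0_norm ?kernel_ge0// kernel_le.
have -> : 1 = complex.Re (cint (haar R n) (fun s => (kernel M s)%:C%C)).
  by rewrite kernel_int.
apply: cmod_cint_le_Re => //; last first.
  by move=> s; rewrite cmodM cmod_chr mul1r cmod_real ger0_norm ?kernel_ge0.
apply: (@haar_integrable _ _ _ (#|{: Q M}|%:R)) => [|s].
  by apply: cmeasM; [exact: cmeas_chr|apply: cmeas_real; exact: meas_kernel].
by rewrite cmodM cmod_chr mul1r cmod_real ger0_norm ?kernel_ge0// kernel_le.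
Qed.

(** This is the Fejer error of the character [chr k], evaluated at the origin. *)
Lemma fejer_mult_cvg k : (fun M => cmod (fejer_mult M k - 1)) @ \oo --> (0 : R).
Proof.
have [K K0 lK] := chr_lip k.
apply/cvg_eps => [M|e e0]; first exact: cmod_ge0.
have e'0 : 0 < e / (K + 1) by rewrite divr_gt0// ltr_wpDl.
have [M0 hM0] := fejer_unif n e'0; exists M0 => M M0M.
pose w0 : T := [tuple 0 | j < n].
have c0 : chr k w0 = 1.
  by rewrite /chr /dotT big1 ?expi0// => j _; rewrite tnth_mktuple mul0r.
have := hM0 M M0M (chr k) 1 K w0 K0 (@chr_periodic _ _ k) lK.
rewrite fejer_chr c0 mul1r => h.
apply: le_trans (h _) _; first by move=> w; rewrite cmod_chr.
rewrite mulrA ler_pdivrMr ?ltr_wpDl//.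
by rewrite mulrC ler_wpM2l ?(ltW e0)// lerDl.
Qed.

Lemma intZ_sum_single (s : seq Z) (c : Z -> R[i]) :
  cint (@muZ R n) (fun k => \sum_(l <- s) (k == l)%:R * c k) = \sum_(l <- s) c l.
Proof.
have h l : cintegrable (@muZ R n) (fun k => (k == l)%:R * c k) /\
    cint (@muZ R n) (fun k => (k == l)%:R * c k) = c l.
  have [|a ->] := @cintZ_single R n l (fun k => (k == l)%:R * c k).
    by move=> k /negPf ->; rewrite mul0r.
  by split=> //; rewrite eqxx mul1r.
rewrite cint_sum; last by move=> l; have [] := h l.
by apply: eq_bigr => l _; have [] := h l.
Qed.

(** Fejer means are the Fourier series damped by multipliers of modulus at most 1 that tend to 1.
    They converge to the full series by dominated convergence and to f by the Lipschitz estimate. *)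
Lemma fourier_inversion (f : T -> R[i]) (B K : R) (w : T) : 0 <= K -> periodicT f ->
  lipT K f -> (forall w, cmod (f w) <= B) ->
  (\int[@muZ R n]_k (cmod (fc f k))%:E < +oo)%E ->
  cint (@muZ R n) (fun k => fc f k * chr k w) = f w.
Proof.
move=> K0 pf lf fB foo.
have [_ h1] : cintegrable (@muZ R n) (fun k => fc f k * chr k w) /\
  (fun M => cmod (cint (@muZ R n) (fun k => fejer_mult M k * (fc f k * chr k w)) -
     cint (@muZ R n) (fun k => fc f k * chr k w))) @ \oo --> (0 : R).
  apply: (cint_dominated (g := fun k => cmod (fc f k))) => //.
  - move=> k; have := cvg0_scale (cmod (fc f k)) (fejer_mult_cvg k).
    apply: cvg0_le => M; rewrite cmod_ge0 andTb.
    have -> : fejer_mult M k * (fc f k * chr k w) - fc f k * chr k w = fc f k * chr k w * (fejer_mult M k - 1) by ring.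
    by rewrite !cmodM cmod_chr mulr1.
  - move=> M k; rewrite !cmodM cmod_chr mulr1 ler_piMl ?cmod_ge0//.
    exact: fejer_mult_le1.
apply: (cvg_cmod_unique h1).
(* The multiplier vanishes off the differences of cube frequencies, so the series is the finite sum
   that defines [fejer]. *)
have E M : cint (@muZ R n) (fun k => fejer_mult M k * (fc f k * chr k w)) = fejer M f w.
  pose c k := (#|{: Q M}|%:R : R)^-1%:C%C * (fc f k * chr k w).
  pose s := [seq freq p.1 - freq p.2 | p <- enum {: Q M * Q M}].
  have := intZ_sum_single s c.
  rewrite /s big_map big_enum/=.
  have -> : (fun k => \sum_(l <- [seq freq p.1 - freq p.2 | p <- enum {: Q M * Q M}])
       (k == l)%:R * c k) = (fun k => fejer_mult M k * (fc f k * chr k w)).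
    apply/funext => k; rewrite big_map big_enum/= /fejer_mult kernel_fc /c -mulr_suml.
    rewrite pair_bigA/=; set A : R[i] := (\sum_p _); ring.
  move=> ->; rewrite /c /fejer -mulr_sumr; congr (_ * _).
  by rewrite pair_bigA.
apply/cvg_eps => [M|e e0]; first exact: cmod_ge0.
have e'0 : 0 < e / (K + 1) by rewrite divr_gt0// ltr_wpDl.
have [M0 hM0] := fejer_unif n e'0; exists M0 => M M0M; rewrite E.
apply: le_trans (hM0 M M0M f B K w K0 pf lf fB) _.
rewrite mulrA ler_pdivrMr ?ltr_wpDl//.
by rewrite mulrC ler_wpM2l ?(ltW e0)// lerDl.
Qed.

End FourierCoefficients.

Section Tempered.
Variables (R : realType) (n : nat).
Local Notation T := (Tn R n).
Local Notation Z := (Zn n).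
Local Notation weight := (@weight R n).
Variable u : (Z * T -> R[i]) -> R[i].
Hypothesis hu : temperedZT u.
Implicit Types (F G : Z * T -> R[i]).
Local Notation Q M := {ffun 'I_n -> 'I_M.+1}.

Lemma tz_lin (a : R[i]) F G : schwartzZT F -> schwartzZT G ->
  u (fun y => a * F y + G y) = a * u F + u G.
Proof. by move=> SF SG; have [h _] := hu; exact: h. Qed.

Lemma tz0 : u (fun _ => 0) = 0.
Proof.
have := tz_lin 1 (schwartz0 R n) (schwartz0 R n).
have -> : (fun y : Z * T => 1 * (fun=> 0) y + (fun=> 0) y) = (fun=> 0 : R[i]).
  by apply/funext => y; rewrite mulr0 addr0.
by rewrite mul1r => h; apply: (addrI (u (fun _ => 0))); rewrite -h addr0.
Qed.

Lemma tz_scale (a : R[i]) F : schwartzZT F -> u (fun y => a * F y) = a * u F.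
Proof.
move=> SF; have := tz_lin a SF (schwartz0 R n); rewrite tz0 addr0.
by move=> <-; congr u; apply/funext => y; rewrite addr0.
Qed.

Lemma tz_sub F G : schwartzZT F -> schwartzZT G -> u (fun y => F y - G y) = u F - u G.
Proof.
move=> SF SG; have := tz_lin (-1) SG SF; rewrite mulN1r addrC => <-.
by congr u; apply/funext => y; rewrite mulN1r addrC.
Qed.

Lemma tz_sum (I : Type) (s : seq I) (F : I -> Z * T -> R[i]) :
  (forall q, schwartzZT (F q)) -> u (fun y => \sum_(q <- s) F q y) = \sum_(q <- s) u (F q).
Proof.
move=> SF; elim: s => [|q s IH].
  by rewrite big_nil; under eq_fun do rewrite big_nil; exact: tz0.
rewrite big_cons -IH -[u (F q)]mul1r -tz_lin//; last exact: schwartz_sum.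
by congr u; apply/funext => y; rewrite big_cons mul1r.
Qed.

Lemma tz_bound : exists (N : nat) (B : R), 0 <= B /\
  forall F, schwartzZT F -> forall K, 0 <= K -> snle N F K -> cmod (u F) <= B * K.
Proof.
have [_ [N [B hB]]] := hu; exists N, `|B|; split=> // F SF K K0 hK.
by apply: le_trans (hB F SF K hK) _; rewrite ler_wpM2r// ler_norm.
Qed.

(** The threshold is uniform in t because the seminorms are invariant under translations of the
    torus. *)
Lemma tz_fejer F j (e : R) : schwartzZT F -> 0 < e ->
  exists M0, forall M, (M0 <= M)%N -> forall t,
  cmod (u (trZT t (cutZ j F)) - u (trZT t (cutfejer M j F))) <= e.
Proof.
move=> SF e0; have [N [B [B0 hB]]] := tz_bound.
have e'0 : 0 < e / (B + 1) by rewrite divr_gt0// ltr_wpDl.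
have [M0 hM0] := fejer_snle N j SF e'0; exists M0 => M M0M t.
have Sc := schwartz_cut j SF; have Sf := schwartz_cutfejer M j F.
rewrite -tz_sub; [|exact: schwartz_tr|exact: schwartz_tr].
have Sd := schwartz_sub Sc Sf.
have := hB _ (schwartz_tr t Sd) _ (ltW e'0) (snle_tr t Sd (hM0 M M0M)).
move=> /le_trans; apply; rewrite mulrA ler_pdivrMr ?ltr_wpDl//.
by rewrite mulrC ler_wpM2l ?(ltW e0)// lerDl.
Qed.

Lemma trZT_mono (t : T) (j l : Z) : trZT t (mono j l) = fun y => chr (- l) t * mono j l y.
Proof.
by apply/funext => y; rewrite /trZT /mono/= chr_subT mulrA mulrC.
Qed.

Lemma tz_cutfejer M j F t : u (trZT t (cutfejer M j F)) =
  \sum_(q : Q M) \sum_(q' : Q M)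
  ((#|{: Q M}|%:R : R)^-1%:C%C * fc (fun eta => F (j, eta)) (freq q - freq q')) *
    (chr (- (freq q - freq q')) t * u (mono j (freq q - freq q'))).
Proof.
rewrite cutfejerE.
have -> : trZT t (fun y => \sum_(q : Q M) \sum_(q' : Q M)
  ((#|{: Q M}|%:R : R)^-1%:C%C * fc (fun eta => F (j, eta)) (freq q - freq q')) *
    mono j (freq q - freq q') y) = (fun y => \sum_(q : Q M) \sum_(q' : Q M)
  ((#|{: Q M}|%:R : R)^-1%:C%C * fc (fun eta => F (j, eta)) (freq q - freq q')) *
    trZT t (mono j (freq q - freq q')) y) by [].
have S1 (l : Z) : schwartzZT (trZT t (mono j l) : Z * T -> R[i]).
  by apply: schwartz_tr; exact: schwartz_mono.
rewrite tz_sum; last first.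
  by move=> q; apply: schwartz_sum => q'; apply: schwartz_scale.
apply: eq_bigr => q _; rewrite tz_sum; last by move=> q'; apply: schwartz_scale.
apply: eq_bigr => q' _; rewrite tz_scale//; congr (_ * _).
by rewrite trZT_mono tz_scale//; exact: schwartz_mono.
Qed.

Lemma tz_tr_cmeas F j : schwartzZT F -> cmeasurable (fun t => u (trZT t (cutZ j F))).
Proof.
move=> SF; apply: (@cmeas_cvg _ _ _ (fun M t => u (trZT t (cutfejer M j F)))).
  move=> M; under eq_fun do rewrite tz_cutfejer.
  apply: cmeas_sum => q; apply: cmeas_sum => q'.
  apply: cmeasM; first exact: cmeas_cst.
  by apply: cmeasM; [exact: cmeas_chr|exact: cmeas_cst].
move=> t; apply/cvg_eps => [M|e e0]; first exact: cmod_ge0.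
have [M0 hM0] := tz_fejer j SF e0; exists M0 => M M0M.
by rewrite cmodC; exact: hM0.
Qed.

(** As a function of t this is the convolution of the j-th row of u with the reflected F(j, .), so
    Fourier coefficients multiply. For the trigonometric polynomials [cutfejer] the identity is
    finite algebra, and both sides converge as M grows. *)
Lemma tz_coef F j l : schwartzZT F ->
  cint (haar R n) (fun t => u (trZT t (cutZ j F)) * chr (- l) t) =
  u (mono j (- l)) * fc (fun eta => F (j, eta)) (- l).
Proof.
move=> SF; set f := (fun eta => F (j, eta)); set a := u (mono j (- l)).
have [pF_ _ _ _] := schwartz_dest SF.
have [B B0 hB] := schwartz_bounded SF; have [K K0 hK] := schwartz_lip SF.
have mf : cmeasurable f by exact: schwartz_cmeas_sec.
have mtr := tz_tr_cmeas j SF.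
have fE (M : nat) : cint (haar R n) (fun t => u (trZT t (cutfejer M j F)) * chr (- l) t) =
    a * cint (haar R n) (fun t => fejer M f t * chr l t).
  have e1 (c : R[i]) k : (fun t : T => c * (chr (- k) t * u (mono j k)) * chr (- l) t) =
      (fun t => c * u (mono j k) * chr (- k - l) t).
    by apply/funext => t; rewrite chrD; ring.
  have e2 (N c : R[i]) k : (fun t : T => N * (c * chr k t) * chr l t) =
      (fun t => N * c * chr (k + l) t).
    by apply/funext => t; rewrite chrD; ring.
  have i1 (c : R[i]) k : cintegrable (haar R n) (fun t : T => c * chr k t).
    by apply: cintegrableZ; exact: chr_integrable.
  under eq_cint do rewrite tz_cutfejer mulr_suml.
  rewrite cint_sum; last first.
    move=> q; under eq_fun do rewrite mulr_suml.
    by apply: cintegrable_sum => q'; rewrite e1; exact: i1.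
  rewrite /fejer; under [in RHS]eq_cint do rewrite mulr_sumr mulr_suml.
  rewrite cint_sum; last first.
    move=> q; under eq_fun do rewrite mulr_sumr mulr_suml.
    by apply: cintegrable_sum => q'; rewrite e2; exact: i1.
  rewrite mulr_sumr; apply: eq_bigr => q _.
  under eq_cint do rewrite mulr_suml.
  under [in RHS]eq_cint do rewrite mulr_sumr mulr_suml.
  rewrite cint_sum; last by move=> q'; rewrite e1; exact: i1.
  rewrite cint_sum; last by move=> q'; rewrite e2; exact: i1.
  rewrite mulr_sumr; apply: eq_bigr => q' _.
  rewrite e1 e2 !cintZ ?cint_chr; try exact: chr_integrable.
  set k := freq q - freq q'.
  rewrite -[- k - l]opprD oppr_eq0; case: eqVneq => [kl|_]; last by rewrite !mulr0.
  by rewrite /a (_ : - l = k); [ring|apply/eqP; rewrite eq_sym -addr_eq0 kl].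
apply: (@cvg_cmod_unique _ _ \oo _
  (fun M => cint (haar R n) (fun t => u (trZT t (cutfejer M j F)) * chr (- l) t))).
  apply/cvg_eps => [M|e e0]; first exact: cmod_ge0.
  have [M0 hM0] := tz_fejer j SF e0; exists M0 => M M0M.
  have mfj : cmeasurable (fun t => u (trZT t (cutfejer M j F))).
    under eq_fun do rewrite tz_cutfejer.
    apply: cmeas_sum => q; apply: cmeas_sum => q'.
    apply: cmeasM; first exact: cmeas_cst.
    by apply: cmeasM; [exact: cmeas_chr|exact: cmeas_cst].
  have [N [Bu [Bu0 hBu]]] := tz_bound.
  have bd G : schwartzZT G -> exists C, forall t, cmod (u (trZT t G)) <= C.
    move=> SG; have [C C0 hC] := schwartz_sn N SG; exists (Bu * C) => t.
    by apply: hBu => //; [exact: schwartz_tr|exact: snle_tr].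
  have [C1 hC1] := bd _ (schwartz_cut j SF); have [C2 hC2] := bd _ (schwartz_cutfejer M j F).
  rewrite cmodC -cintB; first last.
  - apply: (haar_integrable (B := C2)); first by apply: cmeasM => //; exact: cmeas_chr.
    by move=> t; rewrite cmodM cmod_chr mulr1.
  - apply: (haar_integrable (B := C1)); first by apply: cmeasM => //; exact: cmeas_chr.
    by move=> t; rewrite cmodM cmod_chr mulr1.
  apply: haar_cint_le.
    by apply: cmeasD; [|apply: cmeasN]; apply: cmeasM => //; exact: cmeas_chr.
  by move=> t; rewrite -mulrBl cmodM cmod_chr mulr1; exact: hM0.
under eq_fun do rewrite fE -mulrBr cmodM.
apply: cvg0_scale.
apply/cvg_eps => [M|e e0]; first exact: cmod_ge0.
have e'0 : 0 < e / (K + 1) by rewrite divr_gt0// ltr_wpDl.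
have [M0 hM0] := fejer_unif n e'0; exists M0 => M M0M.
have hf t : cmod (fejer M f t - f t) <= e.
  apply: le_trans (hM0 M M0M f B K t K0 (pF_ j) (hK j) (fun w => hB (j, w))) _.
  rewrite mulrA ler_pdivrMr ?ltr_wpDl//.
  by rewrite mulrC ler_wpM2l ?(ltW e0)// lerDl.
have mfe : cmeasurable (fejer M f).
  apply: cmeasM; first exact: cmeas_cst.
  apply: cmeas_sum => q; apply: cmeas_sum => q'.
  by apply: cmeasM; [exact: cmeas_cst|exact: cmeas_chr].
rewrite /fc opprK -cintB; first last.
- apply: (haar_integrable (B := B)); first by apply: cmeasM => //; exact: cmeas_chr.
  by move=> t; rewrite cmodM cmod_chr mulr1; exact: hB.
- apply: (haar_integrable (B := e + B)); first by apply: cmeasM => //; exact: cmeas_chr.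
  move=> t; rewrite cmodM cmod_chr mulr1 -(subrK (f t) (fejer M f t)).
  by apply: le_trans (cmodD _ _) _; apply: lerD => //; exact: hB.
apply: haar_cint_le.
  by apply: cmeasD; [|apply: cmeasN]; apply: cmeasM => //; exact: cmeas_chr.
by move=> t; rewrite -mulrBl cmodM cmod_chr mulr1.
Qed.

(** One finite set J serves all multipliers a of modulus at most 1. With a j = [chr (- j) xi] this
    is the uniformity in xi that [coef_extract] demands. *)
Lemma tz_trunc F (e : R) : schwartzZT F -> 0 < e -> exists J : seq Z,
  forall J' : seq Z, uniq J' -> {subset J <= J'} ->
  forall a : Z -> R[i], (forall j, cmod (a j) <= 1) ->
  cmod (u (fun y => a y.1 * F y) - \sum_(j <- J') a j * u (cutZ j F)) <= e.
Proof.
move=> SF e0; have [N [B [B0 hB]]] := tz_bound.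
have e'0 : 0 < e / (B + 1) by rewrite divr_gt0// ltr_wpDl.
have [J [uJ hJ]] := schwartz_tail N SF e'0; exists J => J' uJ' sJ a a1.
have Sa := schwartz_mulZ a1 SF.
have -> : \sum_(j <- J') a j * u (cutZ j F) =
    u (fun y => \sum_(j <- J') a j * cutZ j F y).
  rewrite tz_sum; last by move=> j; apply: schwartz_scale; exact: schwartz_cut.
  by apply: eq_bigr => j _; rewrite tz_scale//; exact: schwartz_cut.
have Ss : schwartzZT (fun y => \sum_(j <- J') a j * cutZ j F y).
  by apply: schwartz_sum => j; apply: schwartz_scale; exact: schwartz_cut.
rewrite -tz_sub//.
(* Removing the rows in J' from a F leaves b F, whose seminorms see only rows outside J. *)
pose b j := if j \in J' then 0 else a j.
have b1 j : cmod (b j) <= 1 by rewrite /b; case: ifP => // _; rewrite cmod0.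
have -> : (fun y => a y.1 * F y - \sum_(j <- J') a j * cutZ j F y) = (fun y => b y.1 * F y).
  apply/funext => -[j w] /=; rewrite /b; case: ifPn => jJ.
    rewrite (bigD1_seq j)//= big1 => [|k /negPf kj].
      by rewrite /cutZ/= eqxx mul1r addr0 subrr mul0r.
    by rewrite /cutZ/= eq_sym kj mul0r mulr0.
  rewrite big1_seq ?subr0// => k /andP[_ kJ].
  rewrite /cutZ/=; case: eqVneq => [jk|_]; last by rewrite mul0r mulr0.
  by rewrite -jk (negPf jJ) in kJ.
have := hB _ (schwartz_mulZ b1 SF) _ (ltW e'0).
move=> h; apply: (le_trans (h _)).
  move=> s sN j w /=; rewrite partials_scale// cmodM.
  rewrite /b; case: ifPn => jJ; first by rewrite cmod0 mul0r mulr0 ltW.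
  rewrite mulrCA; apply: (@le_trans _ _ (1 * (weight j ^+ N *
     cmod (partials s (fun eta => F (j, eta)) w)))).
    by rewrite ler_wpM2r// mulr_ge0 ?cmod_ge0 ?weightX_ge0.
  by rewrite mul1r; apply: hJ => //; apply: contra jJ => /sJ.
rewrite mulrA ler_pdivrMr ?ltr_wpDl//.
by rewrite mulrC ler_wpM2l ?(ltW e0)// lerDl.
Qed.

(** F is approximated by finitely many of its rows, and each row by Fejer means, which are
    combinations of monomials. *)
Lemma tz_zero F : (forall j l, u (mono j l) = 0) -> schwartzZT F -> u F = 0.
Proof.
move=> u0 SF.
have t0 (w : T) : subT w [tuple 0 | j < n] = w.
  by apply: eq_from_tnth => i; rewrite !tnth_mktuple subr0.
have trE G : trZT [tuple 0 | j < n] G = G by apply/funext => -[k w]; rewrite /trZT/= t0.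
have cut0 j : u (cutZ j F) = 0.
  apply/eqP; rewrite -cmod_eq0; apply/eqP/le_anti; rewrite cmod_ge0 andbT.
  apply/ler_addgt0Pr => e e0; rewrite add0r.
  have [M0 hM0] := tz_fejer j SF e0; have := hM0 M0 (leqnn _) [tuple 0 | j < n].
  rewrite trE tz_cutfejer big1 ?subr0// => q _; rewrite big1// => q' _.
  by rewrite u0 !mulr0.
apply/eqP; rewrite -cmod_eq0; apply/eqP/le_anti; rewrite cmod_ge0 andbT.
apply/ler_addgt0Pr => e e0; rewrite add0r.
have [J hJ] := tz_trunc SF e0.
have := hJ (undup J) (undup_uniq J) (fun k => _) (fun=> 1) (fun=> _).
rewrite big1 ?subr0; last by move=> j _; rewrite cut0 mulr0.
have -> : (fun y => 1 * F y) = F by apply/funext => y; rewrite mul1r.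
by apply=> [k|j]; rewrite ?mem_undup ?cmod1.
Qed.

End Tempered.

(** * Moyal's identity and M^1(Z^n) *)

Section Moyal.
Variables (R : realType) (n : nat).
Local Notation T := (Tn R n).
Local Notation Z := (Zn n).
Local Notation mZ := (@muZ R n).
Local Notation hT := (haar R n).
Implicit Types (c f g : Z -> R[i]).

(** The sign follows [stft]: for fixed m the transform is the series with coefficients f(k) conj g(k
    - m). *)
Definition fser c (w : T) : R[i] := cint mZ (fun k => c k * chr (- k) w).

Lemma abn_chr c (e : Z -> Z) (w : T) : abn (fun k => c k * chr (e k) w) = abn c.
Proof. by apply: eq_integral => k _; rewrite cmodM cmod_chr mulr1. Qed.

Lemma fser_cmeas c : cmeasurable (fser c).
Proof.
apply: (cmeas_cint2 mZ (f := fun x : Z * T => c x.1 * chr (- x.1) x.2)).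
by apply: cmeas_ZX => k /=; apply: cmeasM; [exact: cmeas_cst|exact: cmeas_chr].
Qed.

Lemma fser_le c w : (abn c < +oo)%E -> cmod (fser c w) <= fine (abn c).
Proof.
move=> coo; rewrite -(abn_chr c -%R w); apply: cmod_cint_le_fine.
by apply: cintegrable_Z; rewrite abn_chr.
Qed.

Lemma cint_chr_swap c (h : T -> R[i]) (e : Z -> Z) (B : R) : (abn c < +oo)%E ->
  cmeasurable h -> (forall w, cmod (h w) <= B) ->
  cint hT (fun w => cint mZ (fun k => c k * (chr (e k) w * h w))) =
  cint mZ (fun k => c k * cint hT (fun w => chr (e k) w * h w)).
Proof.
move=> coo mh hB; pose f x := c x.1 * (chr (e x.1) x.2 * h x.2).
have hB' k w : cmod (chr (e k) w * h w) <= B by rewrite cmodM cmod_chr mul1r.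
have B0 : 0 <= B by apply: le_trans (hB [tuple 0 | i < n]); exact: cmod_ge0.
have ms k : cmeasurable (fun w => chr (e k) w * h w).
  by apply: cmeasM => //; exact: cmeas_chr.
have mf : cmeasurable f.
  by apply: cmeas_ZX => k; rewrite /f/=; apply: cmeasM; [exact: cmeas_cst|].
have fi : cintegrable (mZ \x hT)%E f.
  apply/cintegrableP; split=> //; rewrite tonelli1//.
  apply: (@le_lt_trans _ _ (\int[mZ]_k (B * cmod (c k))%:E)%E).
    apply: ge0_le_integral => //.
      by move=> k _; apply: integral_ge0; nonneg.
    move=> k _; apply: haar_int_le; first by rewrite /f/=; apply: cmeasM; [exact: cmeas_cst|].
    by move=> w; rewrite /f/= cmodM mulrC ler_wpM2r// cmod_ge0.
  rewrite gint_scale//; last by move=> k; exact: cmod_ge0.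
  by rewrite lte_mul_pinfty// lee_fin.
have := cint_swap fi; rewrite /f/= => <-.
by apply: eq_cint => k; rewrite cintZ//; exact: haar_integrable (hB' k).
Qed.

Lemma fser_coef c k : (abn c < +oo)%E -> cint hT (fun w => chr k w * fser c w) = c k.
Proof.
move=> coo.
have -> : (fun w => chr k w * fser c w) =
    (fun w => cint mZ (fun j => c j * (chr (- j) w * chr k w))).
  apply/funext => w; rewrite /fser -cintZ; last first.
    by apply: cintegrable_Z; rewrite abn_chr.
  by apply: eq_cint => j; ring.
rewrite (@cint_chr_swap c (chr k) -%R 1)//; last first.
  by move=> w; rewrite cmod_chr.
  exact: cmeas_chr.
have ej j : cint hT (fun w => chr (- j) w * chr k w) = (k == j)%:R.
  by under eq_cint do rewrite -chrD; rewrite cint_chr addrC subr_eq0.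
have [|_ ->] := @cintZ_single R n k (fun j => c j * cint hT (fun w => chr (- j) w * chr k w)).
  by move=> j jk; rewrite ej eq_sym (negPf jk) mulr0.
by rewrite ej eqxx mulr1.
Qed.

(** Summability makes the series bounded and Fubini applicable. For f and g in l^2 the products f(k)
    conj g(k - m) are summable, which is the case Moyal's identity needs. *)
Lemma parseval c : (abn c < +oo)%E -> (\int[hT]_w (cmod (fser c w) ^+ 2)%:E)%E = sqn c.
Proof.
move=> coo; have [l2c _] := abn_l2 coo.
have mS := fser_cmeas c.
have h : cint hT (fun w => fser c w * (fser c w)^*) = cint mZ (fun k => c k * (c k)^*).
  have -> : (fun w => fser c w * (fser c w)^*) =
      (fun w => cint mZ (fun k => (c k)^* * (chr k w * fser c w))).
    apply/funext => w; rewrite {2}/fser -cintJ; last first.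
      by apply: cintegrable_Z; rewrite abn_chr.
    rewrite -cintZ; last first.
      apply: cintegrableJ; by apply: cintegrable_Z; rewrite abn_chr.
    by apply: eq_cint => k; rewrite rmorphM/= -chrN opprK; ring.
  rewrite (@cint_chr_swap (fun k => (c k)^*) (fser c) id (fine (abn c)))//; last first.
    by move=> w; exact: fser_le.
    by rewrite /abn; under eq_integral do rewrite cmodJ.
  by apply: eq_cint => k; rewrite fser_coef// mulrC.
have := congr1 (@complex.Re R) h; rewrite !Re_cint.
under eq_Rintegral do rewrite Re_mulJ.
under [in RHS]eq_Rintegral do rewrite Re_mulJ.
rewrite /Rintegral => E.
have fS : (\int[hT]_w (cmod (fser c w) ^+ 2)%:E)%E \is a fin_num.
  rewrite ge0_fin_numE; last by apply: integral_ge0 => w _; rewrite lee_fin sqr_ge0.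
  have := @haar_int_le R n (fun w => fser c w * fser c w) (fine (abn c) ^+ 2).
  under eq_integral do rewrite cmodM -expr2.
  move=> h2; apply: le_lt_trans (h2 _ _) (ltry _); first exact: cmeasM.
  by move=> w; rewrite cmodM -expr2 lerXn2r// ?nnegrE ?cmod_ge0 ?fser_le// fine_ge0// abn_ge0.
by rewrite -(fineK fS) E fineK//; exact: l2_sqn_fin.
Qed.

Lemma stftE g f (x : Z * T) : stft g f x = fser (fun k => f k * (g (k - x.1))^*) x.2.
Proof.
apply: eq_cint => k; rewrite /tfshift -/(chr k x.2) rmorphM/= chrN; ring.
Qed.

Lemma stft_abn g f m : l2 f -> l2 g -> (abn (fun k => (f k * (g (k - m))^*)%R) < +oo)%E.
Proof. by move=> lf lg; apply: abn_mul => //; apply: l2_conj; exact: l2_shift. Qed.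

Lemma stft_cmeas g f : cmeasurable (stft g f).
Proof.
apply: cmeas_ZX => m.
have -> : (fun w => stft g f (m, w)) = fser (fun k => f k * (g (k - m))^*).
  by apply/funext => w; rewrite stftE.
exact: fser_cmeas.
Qed.

Lemma dotl2_CS f g : l2 f -> l2 g ->
  cmod (dotl2 f g) <= Num.sqrt (fine (sqn f)) * Num.sqrt (fine (sqn g)).
Proof.
move=> lf lg; have := dot_CS (dotH_ip R n) (mkl2 lf) (mkl2 lg).
by rewrite /nrm /nsq /dotH !Re_dotl2.
Qed.

Lemma sqn_tfshift m (w : T) g : sqn (tfshift m w g) = sqn g.
Proof.
rewrite /sqn -(intZ_shift m (h := fun k => (cmod (g k) ^+ 2)%:E)); last by nonneg.
by apply: eq_integral => k _; rewrite /tfshift cmodM -/(chr k w) cmod_chr mul1r.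
Qed.

Lemma l2_tfshift m (w : T) g : l2 g -> l2 (tfshift m w g).
Proof. by move=> /l2P lg; apply/l2P; rewrite sqn_tfshift. Qed.

Lemma stft_le g f x : l2 f -> l2 g ->
  cmod (stft g f x) <= Num.sqrt (fine (sqn f)) * Num.sqrt (fine (sqn g)).
Proof.
move=> lf lg; rewrite -(sqn_tfshift x.1 x.2 g); apply: dotl2_CS => //.
exact: l2_tfshift.
Qed.

(** For fixed m, Parseval in w gives sum_k |f(k)|^2 |g(k - m)|^2; summing over m first separates the
    two factors. *)
Lemma moyal g f : l2 f -> l2 g ->
  (\int[@muZT R n]_x (cmod (stft g f x) ^+ 2)%:E = sqn f * sqn g)%E.
Proof.
move=> lf lg.
have := @tonelli1 _ _ _ _ _ mZ hT (fun x => stft g f x * stft g f x).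
under eq_integral do rewrite cmodM -expr2.
move=> ->; last by apply: cmeasM; exact: stft_cmeas.
have E m : (\int[hT]_w (cmod (stft g f (m, w) * stft g f (m, w))%R)%:E =
    sqn (fun k => f k * (g (k - m))^*)%R)%E.
  rewrite -(parseval (stft_abn m lf lg)); apply: eq_integral => w _.
  by rewrite cmodM -expr2 stftE.
under eq_integral do rewrite E.
pose q (x : Z * Z) := (f x.2 * (g (x.2 - x.1))^*) ^+ 2.
have mq : cmeasurable q by apply: cmeas_ZX => k; exact: cmeas_Z.
have := tonelli1 mZ mZ mq; rewrite (tonelli2 mZ mZ mq) /q/=.
under [X in _ = X -> _]eq_integral do under eq_integral do rewrite cmodX.
rewrite /sqn => <-.
under eq_integral => k _.
  under eq_integral do rewrite cmodX cmodM cmodJ exprMn.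
  rewrite gint_scale; [|exact: meas_Z|exact: sqr_ge0|by move=> m; exact: sqr_ge0].
  rewrite (intZ_refl k (h := fun m => (cmod (g m) ^+ 2)%:E)); last by nonneg.
  over.
rewrite -/(sqn g) -(fineK (l2_sqn_fin lg)).
under eq_integral do rewrite -EFinM mulrC.
rewrite gint_scale; [by rewrite muleC|exact: meas_Z| |by move=> k; exact: sqr_ge0].
by rewrite fine_ge0// sqn_ge0.
Qed.

End Moyal.

Section Exhaustion.
Variables (R : realType) (n : nat).
Local Notation Z := (Zn n).
Local Notation mZ := (@muZ R n).

(** Increasing finite sets covering Z^n; they turn convergence along finite subsets into convergence
    of sequences. *)
Definition exhaust (N : nat) : seq Z := pmap (@pickle_inv Z) (iota 0 N).

Lemma exhaust_uniq N : uniq (exhaust N).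
Proof. by apply: (pmap_uniq (@pickle_invK Z)); exact: iota_uniq. Qed.

Lemma mem_exhaust N k : (k \in exhaust N) = (pickle k < N)%N.
Proof.
rewrite /exhaust mem_pmap; apply/mapP/idP => [[j]|kN].
  by rewrite mem_iota add0n => /andP[_ jN] hk; have := @pickle_invK Z j; rewrite -hk /= => ->.
by exists (pickle k); rewrite ?mem_iota//= pickleK_inv.
Qed.

Lemma exhaust_cover (J : seq Z) : exists N0, forall N, (N0 <= N)%N -> {subset J <= exhaust N}.
Proof.
exists (\max_(k <- J) (pickle k).+1)%N => N hN k kJ; rewrite mem_exhaust.
by apply: leq_trans hN; rewrite (big_rem k)//= leq_maxl.
Qed.

Lemma cintZ_exhaust (c : Z -> R[i]) : (abn c < +oo)%E ->
  (fun N => cmod (\sum_(k <- exhaust N) c k - cint mZ c)) @ \oo --> (0 : R).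
Proof.
move=> coo.
have hE N k : \sum_(l <- exhaust N) (k == l)%:R * c k = (pickle k < N)%:R * c k :> R[i].
  rewrite -mulr_suml -mem_exhaust; congr (_ * _).
  have [kN|kN] := boolP (k \in exhaust N).
    rewrite (bigD1_seq k)//= ?exhaust_uniq// eqxx big1 ?addr0// => l /negPf lk.
    by rewrite eq_sym lk.
  rewrite big1_seq// => l /andP[_ lN]; case: eqVneq => // kl.
  by rewrite kl lN in kN.
pose F N k := \sum_(l <- exhaust N) (k == l)%:R * c k : R[i].
have cF k : (fun N => cmod (F N k - c k)) @ \oo --> (0 : R).
  apply/cvg_eps => [M|e e0]; first exact: cmod_ge0.
  exists (pickle k).+1 => N kN; rewrite /F hE kN mul1r subrr cmod0; exact: ltW.
have bF N k : cmod (F N k) <= cmod (c k).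
  rewrite /F hE; case: (_ < _)%N; first by rewrite mul1r.
  by rewrite mul0r cmod0 cmod_ge0.
have [_] := cint_dominated (fun N => cmeas_Z (F N)) cF (meas_Z (fun k => cmod (c k))) coo bF.
have -> : (fun N => cmod (cint mZ (F N) - cint mZ c)) =
    (fun N => cmod (\sum_(k <- exhaust N) c k - cint mZ c)) by
  apply/funext => N; rewrite /F intZ_sum_single.
by [].
Qed.

End Exhaustion.

(** * Tempered distributions on Z^n with integrable transform *)

Section TemperedZ.
Variables (R : realType) (n : nat).
Local Notation T := (Tn R n).
Local Notation Z := (Zn n).
Local Notation mZ := (@muZ R n).
Local Notation hT := (haar R n).
Local Notation weight := (@weight R n).
Variable v : (Z -> R[i]) -> R[i].
Hypothesis hv : temperedZ v.
Implicit Types (f : Z -> R[i]).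
Local Notation G := (seq_of v).

Lemma schwartzZ_lin (a : R[i]) f h : schwartzZ f -> schwartzZ h ->
  schwartzZ (fun k => a * f k + h k).
Proof.
move=> Sf Sh N; have [B hB] := Sf N; have [C hC] := Sh N.
exists (cmod a * B + C) => k; apply: le_trans (ler_wpM2l (weightX_ge0 _ _ _) (cmodD _ _)) _.
rewrite mulrDr lerD// cmodM mulrCA ler_wpM2l ?cmod_ge0//.
Qed.

Lemma schwartzZ_finite (s : seq Z) (c : Z -> R[i]) :
  schwartzZ (fun k => \sum_(j <- s) c j * (k == j)%:R).
Proof.
elim: s => [|j s IH] N.
  by exists 0 => k; rewrite big_nil cmod0 mulr0.
have Sd : schwartzZ (fun k : Z => (k == j)%:R : R[i]).
  move=> M; exists (weight j ^+ M) => k; case: eqVneq => [->|_].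
    by rewrite cmod1 mulr1.
  by rewrite cmod0 mulr0 weightX_ge0.
have [B hB] := schwartzZ_lin (c j) Sd IH N; exists B => k.
by have := hB k; rewrite big_cons.
Qed.

Lemma temperedZ_finite (s : seq Z) (c : Z -> R[i]) :
  v (fun k => \sum_(j <- s) c j * (k == j)%:R) = \sum_(j <- s) c j * G j.
Proof.
have [lin _] := hv.
have Sd (j : Z) : schwartzZ (fun k : Z => (k == j)%:R : R[i]).
  have := @schwartzZ_finite [:: j] (fun=> 1).
  by congr schwartzZ; apply/funext => k; rewrite big_seq1 mul1r.
have S0 : schwartzZ (fun _ : Z => 0 : R[i]).
  have := @schwartzZ_finite [::] (fun=> 1).
  by congr schwartzZ; apply/funext => k; rewrite big_nil.
elim: s => [|j s IH].
  rewrite big_nil; under eq_fun do rewrite big_nil.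
  have e : 1 * 0 + 0 = 0 :> R[i] by rewrite mulr0 addr0.
  have := lin 1 _ _ S0 S0; rewrite e mul1r => h.
  by apply: (addrI (v (fun=> 0))); rewrite -h addr0.
rewrite big_cons -IH -lin//; last exact: schwartzZ_finite.
by congr v; apply/funext => k; rewrite big_cons.
Qed.

Lemma temperedZ_trunc f (e : R) : schwartzZ f -> 0 < e -> exists J : seq Z,
  forall J' : seq Z, uniq J' -> {subset J <= J'} ->
  forall a : Z -> R[i], (forall j, cmod (a j) <= 1) ->
  cmod (v (fun k => a k * f k) - \sum_(j <- J') a j * (f j * G j)) <= e.
Proof.
move=> Sf e0; have [lin [N [B hB]]] := hv.
pose B' := `|B| + 1; have B'0 : 0 < B' by rewrite ltr_wpDl.
have e'0 : 0 < e / B' by rewrite divr_gt0.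
have [C hC] := Sf N.+1.
have C0 : 0 <= C.
  by apply: le_trans (hC 0); rewrite mulr_ge0 ?cmod_ge0 ?weightX_ge0.
have [J [uJ hJ]] := weight_finite n (C / (e / B')).
exists J => J' uJ' sJ a a1.
have Sa : schwartzZ (fun k => a k * f k).
  move=> M; have [D hD] := Sf M; exists D => k; apply: le_trans (hD k).
  by rewrite ler_wpM2l ?weightX_ge0// cmodM ler_piMl ?cmod_ge0.
have -> : \sum_(j <- J') a j * (f j * G j) = \sum_(j <- J') (a j * f j) * G j.
  by apply: eq_bigr => j _; rewrite mulrA.
rewrite -temperedZ_finite.
set p := (fun k => _); set q := (fun k => \sum_(j <- J') _).
have Sq : schwartzZ q by exact: schwartzZ_finite.
have -> : v p - v q = v (fun k => -1 * q k + p k) by rewrite lin// mulN1r addrC.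
apply: le_trans (hB _ (schwartzZ_lin (-1) Sq Sa) (e / B') _) _; last first.
  apply: (@le_trans _ _ (B' * (e / B'))); last by rewrite mulrC divfK// gt_eqF.
  rewrite ler_wpM2r ?(ltW e'0)// (le_trans (ler_norm _))// lerDl//.
move=> k; rewrite mulN1r addrC /p /q.
have [kJ|kJ] := boolP (k \in J').
  rewrite (bigD1_seq k)//= eqxx mulr1 big1 ?addr0 ?subrr ?cmod0 ?mulr0 ?ltW//.
  by move=> j /negPf jk; rewrite eq_sym jk mulr0.
rewrite big1_seq ?subr0; last first.
  move=> j /andP[_ jJ]; case: eqVneq => [kj|]; last by rewrite mulr0.
  by rewrite kj jJ in kJ.
apply: (@le_trans _ _ (weight k ^+ N * cmod (f k))).
  by rewrite ler_wpM2l ?weightX_ge0// cmodM ler_piMl ?cmod_ge0.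
have wk : C / (e / B') < weight k.
  by rewrite ltNge; apply: contra kJ => /hJ /sJ.
rewrite -(ler_pM2l (weight_gt0 R k)) mulrA -exprS.
apply: le_trans (hC k) _; rewrite -ler_pdivrMr//.
exact: ltW.
Qed.

Variable phi : Z -> R[i].
Hypothesis hphi : schwartzZ phi.
Local Notation V := (dstft phi v).

Lemma schwartzZ_win m : schwartzZ (fun k => (phi (k - m))^*).
Proof.
move=> N; have [B hB] := hphi N; exists (weight m ^+ N * B) => k; rewrite cmodJ.
apply: le_trans (ler_wpM2l (weightX_ge0 _ m N) (hB (k - m))).
rewrite mulrA ler_wpM2r ?cmod_ge0// -exprMn mulrC.
by rewrite lerXn2r ?nnegrE ?weight_ge0 ?mulr_ge0 ?weight_ge0//; exact: weight_add.
Qed.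

Lemma dstft_trunc m (e : R) : 0 < e -> exists J : seq Z,
  forall J' : seq Z, uniq J' -> {subset J <= J'} -> forall w,
  cmod (V (m, w) - \sum_(j <- J') chr (- j) w * ((phi (j - m))^* * G j)) <= e.
Proof.
move=> e0; have [J hJ] := temperedZ_trunc (schwartzZ_win m) e0.
exists J => J' uJ' sJ w.
have := hJ J' uJ' sJ (fun j => chr (- j) w) (fun j => _).
have -> : V (m, w) = v (fun k => chr (- k) w * (phi (k - m))^*).
  congr v; apply/funext => k; rewrite /conjf /tfshift/= -/(chr k w).
  by rewrite rmorphM/= chrN.
by apply=> j; rewrite cmod_chr.
Qed.

Hypothesis hV : inLp (@muZT R n) 1%:E V.

Lemma dstft_cmeas : cmeasurable V.
Proof. by case: hV. Qed.

Lemma dstft_coef m k :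
  cint hT (fun w => V (m, w) * chr k w) = (phi (k - m))^* * G k.
Proof.
apply: (coef_extract (h := fun w => V (m, w)) (c := fun k => (phi (k - m))^* * G k)).
  by apply: cmeas_xsection; exact: dstft_cmeas.
by move=> e e0; exact: dstft_trunc.
Qed.

Lemma dstft_norm1E : lpnorm (@muZT R n) 1%:E V = (\int[mZ]_m \int[hT]_w (cmod (V (m, w)))%:E)%E.
Proof. by rewrite lp1E; apply: tonelli1; exact: dstft_cmeas. Qed.

Lemma dstft_sec_bounded m : exists B : R, forall w, cmod (V (m, w)) <= B.
Proof.
have [J hJ] := dstft_trunc m ltr01.
exists (1 + \sum_(j <- undup J) cmod ((phi (j - m))^* * G j)) => w'.
have {}hJ := hJ (undup J) (undup_uniq J) _ w'.
rewrite -(subrK (\sum_(j <- undup J) chr (- j) w' * ((phi (j - m))^* * G j)) (V (m, w'))).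
apply: le_trans (cmodD _ _) _; apply: lerD; first by apply: hJ => k; rewrite mem_undup.
apply: le_trans (cmod_sum _ _ _) _; apply: ler_sum => j _.
by rewrite cmodM cmod_chr mul1r.
Qed.

(** On the diagonal k - m = z the k-th coefficient of V(m, .) is conj phi(z) G(k), and a coefficient
    is at most the L^1-norm of the row. Summation over k gives |phi(z)| |G|_1 <= |V|_1. *)
Lemma seq_of_abn z : phi z != 0 -> (abn G < +oo)%E.
Proof.
move=> z0.
have h : (\int[mZ]_k (cmod (phi z) * cmod (G k))%:E <= lpnorm (@muZT R n) 1%:E V)%E.
  rewrite dstft_norm1E -(intZ_shift z (h := fun m => \int[hT]_w (cmod (V (m, w)))%:E)%E); last first.
    by move=> k; apply: integral_ge0; nonneg.
  apply: ge0_le_integral => //.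
    by nonneg.
  move=> k _; have := dstft_coef (k - z) k.
  rewrite (_ : k - (k - z) = z); last by rewrite opprB addrC subrK.
  move=> E; rewrite -(cmodJ (phi z)) -cmodM -E.
  have [B hB] := dstft_sec_bounded (k - z).
  have mk : cmeasurable (fun w => V (k - z, w)).
    by apply: cmeas_xsection; exact: dstft_cmeas.
  apply: le_trans (cmod_cint_le _) _.
    apply: (haar_integrable (B := B)); first by apply: cmeasM => //; exact: cmeas_chr.
    by move=> w; rewrite cmodM cmod_chr mulr1.
  by under eq_integral do rewrite cmodM cmod_chr mulr1.
have Voo : (lpnorm (@muZT R n) 1%:E V < +oo)%E by case: hV.
move: (le_lt_trans h Voo); rewrite gint_scale; [|exact: meas_Z|exact: cmod_ge0|by move=> k; exact: cmod_ge0].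
rewrite -/(abn G); move: (abn_ge0 G); case: (abn G) => [r _ _|_|//]; first exact: ltry.
by rewrite gt0_muley// lte_fin cmod_gt0.
Qed.

Lemma temperedZ_cint f : schwartzZ f ->
  (abn G < +oo)%E -> v f = cint mZ (fun k => f k * G k).
Proof.
move=> Sf Goo; have [B hB] := Sf 0%N.
have fGoo : (abn (fun k => (f k * G k)%R) < +oo)%E.
  apply: (@le_lt_trans _ _ (\int[mZ]_k (B * cmod (G k))%:E)%E).
    apply: ge0_le_integral => //; first by nonneg.
    move=> k _; rewrite lee_fin cmodM ler_wpM2r ?cmod_ge0//.
    by have := hB k; rewrite expr0 mul1r.
  have B0 : 0 <= B by rewrite (le_trans _ (hB 0))// expr0 mul1r cmod_ge0.
  rewrite gint_scale//; last by move=> k; exact: cmod_ge0.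
  by rewrite lte_mul_pinfty// ?abn_ge0.
apply/eqP; rewrite -subr_eq0 -cmod_eq0; apply/eqP.
apply: le_anti; rewrite cmod_ge0 andbT; apply/ler_addgt0Pr => e e0; rewrite add0r.
have e20 : 0 < e / 2 by rewrite divr_gt0.
have [J hJ] := temperedZ_trunc Sf e20.
have [N0 hN0] := exhaust_cover J.
have [N1 hN1] := (cvg_eps (fun N => cmod_ge0 _)).1 (cintZ_exhaust fGoo) _ e20.
pose N := maxn N0 N1.
have c1 (j : Z) : cmod (1 : R[i]) <= 1 by rewrite cmod1.
have := hJ (exhaust n N) (exhaust_uniq n N) (hN0 N (leq_maxl _ _)) (fun=> 1) c1.
rewrite (eq_bigr (fun k => f k * G k)); last by move=> k _; rewrite mul1r.
have -> : (fun k => 1 * f k) = f by apply/funext => k; rewrite mul1r.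
have := hN1 N (leq_maxr _ _).
set S := \sum_(k <- _) _ => h1 h2.
have -> : v f - cint mZ (fun k => f k * G k) = (v f - S) + (S - cint mZ (fun k => f k * G k)).
  by rewrite addrA subrK.
apply: le_trans (cmodD _ _) _; rewrite [leRHS]splitr; exact: lerD.
Qed.

Lemma dstft_stft x : (abn G < +oo)%E -> V x = stft phi G x.
Proof.
move=> Goo; case: x => m w; rewrite /dstft temperedZ_cint//.
  by rewrite /stft /dotl2; apply: eq_cint => k; rewrite /conjf mulrC.
move=> N; have [B hB] := schwartzZ_win m N; exists B => k.
by rewrite /conjf /tfshift/= -/(chr k w) rmorphM/= cmodM cmodJ cmod_chr mul1r.
Qed.

Lemma seq_of_neq0 f : schwartzZ f -> (abn G < +oo)%E -> v f != 0 -> exists k, G k != 0.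
Proof.
move=> Sf Goo; apply: contra_neqP => /forallNP G0; rewrite temperedZ_cint//.
rewrite -[RHS](cint0 mZ); apply: eq_cint => k.
by have /negP/negPn/eqP -> := G0 k; rewrite mulr0.
Qed.

(** The same coefficients with k fixed and m varying: |G(k)| |phi|_1 <= |V|_1. *)
Lemma window_abn k : G k != 0 -> (abn phi < +oo)%E.
Proof.
move=> Gk.
have h : (\int[mZ]_m (cmod (G k) * cmod (phi (k - m)))%:E <= lpnorm (@muZT R n) 1%:E V)%E.
  rewrite dstft_norm1E; apply: ge0_le_integral => //; first by nonneg.
  move=> m _; have -> : cmod (G k) * cmod (phi (k - m)) = cmod ((phi (k - m))^* * G k).
    by rewrite cmodM cmodJ mulrC.
  have [B hB] := dstft_sec_bounded m.
  have mk : cmeasurable (fun w => V (m, w)).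
    by apply: cmeas_xsection; exact: dstft_cmeas.
  rewrite -dstft_coef; apply: le_trans (cmod_cint_le _) _.
    apply: (haar_integrable (B := B)); first by apply: cmeasM => //; exact: cmeas_chr.
    by move=> w; rewrite cmodM cmod_chr mulr1.
  by under eq_integral do rewrite cmodM cmod_chr mulr1.
have Voo : (lpnorm (@muZT R n) 1%:E V < +oo)%E by case: hV.
move: (le_lt_trans h Voo); rewrite gint_scale; [|exact: meas_Z|exact: cmod_ge0|by nonneg].
rewrite (intZ_refl k (h := fun m => (cmod (phi m))%:E)); last by nonneg.
rewrite -/(abn phi); move: (abn_ge0 phi); case: (abn phi) => [r _ _|_|//]; first exact: ltry.
by rewrite gt0_muley// lte_fin cmod_gt0.
Qed.

(** Moyal's identity and the pointwise bound |V| <= |G|_2 |phi|_2 give (|G|_2 |phi|_2)^2 <= |G|_2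
    |phi|_2 |V|_1; one factor cancels. *)
Lemma window_bound : l2 G -> l2 phi -> (abn G < +oo)%E ->
  (sqn G * sqn phi <= lpnorm (@muZT R n) 1%:E V ^+ 2)%E.
Proof.
move=> lG lphi Goo.
pose st := Num.sqrt (fine (sqn G)) * Num.sqrt (fine (sqn phi)).
have st0 : 0 <= st by rewrite mulr_ge0.
have stE : (sqn G * sqn phi = (st ^+ 2)%:E)%E.
  rewrite /st exprMn !sqr_sqrtr ?fine_ge0 ?sqn_ge0//.
  by rewrite EFinM !fineK//; exact: l2_sqn_fin.
have := moyal lG lphi; rewrite stE => mo.
have Voo : (lpnorm (@muZT R n) 1%:E V < +oo)%E by case: hV.
have V0 : (0 <= lpnorm (@muZT R n) 1%:E V)%E by rewrite lp1E; apply: integral_ge0; nonneg.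
have h : ((st ^+ 2)%:E <= st%:E * lpnorm (@muZT R n) 1%:E V)%E.
  rewrite -mo lp1E -gint_scale//; last 2 first.
  - by apply: cmeas_cmod; exact: dstft_cmeas.
  - by move=> x; exact: cmod_ge0.
  apply: gint_le.
  - have := cmeas_cmod (cmeasM (stft_cmeas phi G) (stft_cmeas phi G)).
    by congr measurable_fun; apply/funext => x; rewrite cmodM expr2.
  - by apply: measurable_funM => //; apply: cmeas_cmod; exact: dstft_cmeas.
  - by move=> x; exact: sqr_ge0.
  move=> x; rewrite dstft_stft// expr2 ler_wpM2r ?cmod_ge0//.
  exact: stft_le.
move: h Voo V0; case: (lpnorm _ _ _) => [r|//|//]; rewrite -EFinM !lee_fin => h _ r0.
have [->|st1] := eqVneq st 0; first by rewrite expr0n sqr_ge0.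
rewrite lerXn2r ?nnegrE//.
by rewrite -(ler_pM2l (x := st)) -?expr2// lt_neqAle eq_sym st1.
Qed.

End TemperedZ.

(** * Symbols in M^1(Z^n x T^n) *)

Lemma sigma_finite_muZT (R : realType) (n : nat) :
  sigma_finite [set: Zn n * Tn R n] (@muZT R n).
Proof.
have /sigma_finiteP[F [TF ndF Foo]] := sigma_finiteT (@muZ R n).
exists (fun i => F i `*` [set: Tn R n]).
  apply/seteqP; split=> [[k w] _|//].
  by have [i _ Fik] : (\bigcup_i F i) k by [rewrite -TF]; exists i.
move=> i; have [mF Fi] := Foo i; split; first exact: measurableX.
rewrite /muZT product_measure1E//.
by rewrite [X in (_ * X)%E]probability_setT mule1.
Qed.

HB.instance Definition _ (R : realType) (n : nat) :=
  @Measure_isSigmaFinite.Build _ _ _ (@muZT R n) (sigma_finite_muZT R n).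

Lemma cmod_cint_le_ext d (X : measurableType d) (R : realType)
    (mu : {measure set X -> \bar R}) (f : X -> R[i]) : cmeasurable f ->
  ((cmod (cint mu f))%:E <= \int[mu]_x (cmod (f x))%:E)%E.
Proof.
move=> mf; have [foo|] := ltP (\int[mu]_x (cmod (f x))%:E)%E +oo%E.
  by apply: cmod_cint_le; apply/cintegrableP.
by rewrite leye_eq => /eqP ->; rewrite leey.
Qed.

Section Symbol.
Variables (R : realType) (n : nat).
Local Notation T := (Tn R n).
Local Notation Z := (Zn n).
Local Notation mZ := (@muZ R n).
Local Notation hT := (haar R n).
Local Notation mTZ := (@muTZ R n).
Local Notation mZT := (@muZT R n).
Local Notation weight := (@weight R n).
Variable u : (Z * T -> R[i]) -> R[i].
Hypothesis hu : temperedZT u.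
Variable Phi : Z * T -> R[i].
Hypothesis hPhi : schwartzZT Phi.
Local Notation V := (dstftZT Phi u).
Hypothesis hV : inLp (@muZTTZ R n) 1%:E V.
Variables (p : Z) (zeta : T).
Hypothesis Phi_neq0 : Phi (p, zeta) != 0.
Implicit Types (m j k l : Z) (omega xi eta w : T).

(** The conjugated time-frequency shift of Phi without its modulation in the discrete variable. That
    modulation is a multiplier [chr (- j) xi] on the rows, which [tz_trunc] handles uniformly in
    xi. *)
Definition atom m omega k : Z * T -> R[i] := fun y =>
  chr (- k) y.2 * (Phi (y.1 - m, subT y.2 omega))^*.

Lemma schwartz_atom m omega k : schwartzZT (atom m omega k).
Proof.
have h := schwartz_conj (schwartz_shift m omega hPhi).
have c1 (j : Z) : cmod ((fun=> 1) j : R[i]) <= 1 by rewrite cmod1.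
have := schwartz_chr (- k) c1 h.
by congr schwartzZT; apply/funext => y; rewrite /atom /conjf mul1r.
Qed.

Lemma dstftZT_atom m omega xi k :
  V ((m, omega), (xi, k)) = u (fun y => chr (- y.1) xi * atom m omega k y).
Proof.
congr u; apply/funext => y; rewrite /conjf /tfshiftZT/= /atom expiD -/(chr _ _) -/(chr _ _).
by rewrite !rmorphM/= !chrN mulrA.
Qed.

Lemma dstftZT_cmeas : cmeasurable V.
Proof. by case: hV. Qed.

Lemma dstftZT_sec_cmeas m omega k : cmeasurable (fun xi => V ((m, omega), (xi, k))).
Proof.
apply: (cmeas_ysection (f := fun x => V ((m, omega), x)) k).
by apply: cmeas_xsection; exact: dstftZT_cmeas.
Qed.

Lemma dstftZT_bounded m omega k : exists B : R, forall xi,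
  cmod (V ((m, omega), (xi, k))) <= B.
Proof.
have [J hJ] := tz_trunc hu (schwartz_atom m omega k) ltr01.
exists (1 + \sum_(j <- undup J) cmod (u (cutZ j (atom m omega k)))) => xi.
have sJ : {subset J <= undup J} by move=> i; rewrite mem_undup.
have c1 i : cmod (chr (- i) xi) <= 1 by rewrite cmod_chr.
have := hJ (undup J) (undup_uniq J) sJ (fun j => chr (- j) xi) c1.
rewrite -dstftZT_atom; set S := \sum_(j <- _) _ => h.
rewrite -(subrK S (V _)); apply: le_trans (cmodD _ _) _; apply: lerD => //.
apply: le_trans (cmod_sum _ _ _) _; apply: ler_sum => j _.
by rewrite cmodM cmod_chr mul1r.
Qed.

(** The Fourier coefficients in xi separate the rows of the distribution. *)
Lemma dstftZT_coef m omega k j :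
  cint hT (fun xi => V ((m, omega), (xi, k)) * chr j xi) = u (cutZ j (atom m omega k)).
Proof.
apply: (coef_extract (h := fun xi => V ((m, omega), (xi, k)))
  (c := fun j => u (cutZ j (atom m omega k)))).
  exact: dstftZT_sec_cmeas.
move=> e e0; have [J hJ] := tz_trunc hu (schwartz_atom m omega k) e0.
exists J => J' uJ' sJ xi; rewrite dstftZT_atom.
by apply: (hJ J' uJ' sJ (fun j => chr (- j) xi)) => i; rewrite cmod_chr.
Qed.

(** Shifted by j - p, so that its row j carries the row p of the window. *)
Definition win j k : Z * T -> R[i] := atom (j - p) [tuple 0 | i < n] k.

(** Moving the centre of the atom is a translation up to the phase [chr (- k) omega], which brings
    the row into the form of [tz_coef]. *)
Lemma cutZ_atom j omega k :
  cutZ j (atom (j - p) omega k) = fun y => chr (- k) omega * trZT omega (cutZ j (win j k)) y.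
Proof.
apply/funext => -[i w]; rewrite /cutZ /trZT /win /atom/= chr_subT opprK.
have -> : subT (subT w omega) [tuple 0 | i0 < n] = subT w omega.
  by apply: eq_from_tnth => q; rewrite !tnth_mktuple subr0.
have rg (a b x y z : R[i]) : b * (x * (y * a * z)) = (a * b) * (x * (y * z)) by ring.
by rewrite rg chr_mulN mul1r.
Qed.

Local Notation chi := (fun w => (Phi (p, w))^*).

Lemma fc_win j k l : fc (fun eta => win j k (j, eta)) (- l) = fc chi (k - l).
Proof.
apply: eq_cint => w; rewrite /win /atom/= opprB addrC subrK.
have -> : subT w [tuple 0 | i0 < n] = w.
  by apply: eq_from_tnth => q; rewrite !tnth_mktuple subr0.
rewrite opprB opprK addrC chrD; ring.
Qed.

Lemma dstftZT_periodic m omega l x : V ((m, translT omega l), x) = V ((m, omega), x).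
Proof.
have [pF_ _ _ _] := schwartz_dest hPhi.
case: x => xi k; rewrite !dstftZT_atom; congr u; apply/funext => y.
by rewrite /atom subTr_translT pF_.
Qed.

(** Finite for almost every omega only; the majorant of the inversion integral at (m, omega). *)
Definition absV m omega : \bar R := (\int[mTZ]_x (cmod (V ((m, omega), x)))%:E)%E.

Lemma absV_ge0 m omega : (0 <= absV m omega)%E.
Proof. by apply: integral_ge0; nonneg. Qed.

Lemma absV_meas2 : measurable_fun [set: Z * T] (fun y => absV y.1 y.2).
Proof.
have := meas_tonelli1 mTZ dstftZT_cmeas.
by congr measurable_fun; apply/funext => -[m w].
Qed.

Lemma absV_meas m : measurable_fun [set: T] (absV m).
Proof.
have := measurableT_comp absV_meas2 (@measurable_pair1 _ _ Z T m).
exact.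
Qed.

Lemma normVE : lpnorm (@muZTTZ R n) 1%:E V = (\int[mZ]_m \int[hT]_w absV m w)%E.
Proof.
rewrite lp1E; have := tonelli1 mZT mTZ dstftZT_cmeas.
move=> /= ->; rewrite (@fubini_tonelli1 _ _ _ _ _ mZ hT _ _ (fun y => absV_ge0 y.1 y.2)).
  by [].
exact: absV_meas2.
Qed.

Lemma absV_int_lty m : (\int[hT]_w absV m w < +oo)%E.
Proof.
have [_] := hV; rewrite normVE; apply: le_lt_trans.
apply: (@intZ_ge R n m (fun m => \int[hT]_w absV m w)%E) => k.
by apply: integral_ge0 => w _; exact: absV_ge0.
Qed.

Lemma absV_sec m omega k :
  (\int[hT]_xi (cmod (V ((m, omega), (xi, k))))%:E <= absV m omega)%E.
Proof.
have ms : cmeasurable (fun x => V ((m, omega), x)).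
  by apply: cmeas_xsection; exact: dstftZT_cmeas.
rewrite /absV (tonelli2 hT mZ ms).
apply: (@intZ_ge R n k (fun k => \int[hT]_xi (cmod (V ((m, omega), (xi, k))))%:E)%E) => q.
by apply: integral_ge0; nonneg.
Qed.

(* Summing V((j - p, eta - zeta), (xi, k)) against e(j xi + k eta) inverts the
   short-time Fourier transform through the single window value Phi(p, zeta). *)
Definition kern j l (x : T * (T * Z)) : R[i] :=
  V ((j - p, x.1), x.2) * (chr j x.2.1 * chr (x.2.2 - l) (addT x.1 zeta)).

Lemma kern_cmeas j l : cmeasurable (kern j l).
Proof.
apply: cmeasM.
  apply: (cmeas_comp (h := fun x : T * (T * Z) => ((j - p, x.1), x.2))); last exact: dstftZT_cmeas.
  apply: measurable_fun_pair; last exact: measurable_snd.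
  by apply: measurable_fun_pair => //; exact: measurable_fst.
apply: cmeasM.
  apply: (cmeas_comp (h := fun x : T * (T * Z) => x.2.1)); last exact: cmeas_chr.
  by apply: measurableT_comp => //; exact: measurable_fst.
apply: (cmeas_comp (h := fun x : T * (T * Z) => (x.1, x.2.2))
  (f := fun y : T * Z => chr (y.2 - l) (addT y.1 zeta))).
  by apply: measurable_fun_pair => //; apply: measurableT_comp => //; exact: measurable_snd.
apply: cmeas_XZ => k /=; apply: (cmeas_comp (h := fun w => addT w zeta)); last exact: cmeas_chr.
exact: meas_addT.
Qed.

Lemma kern_cmod j l x : cmod (kern j l x) = cmod (V ((j - p, x.1), x.2)).
Proof. by rewrite /kern !cmodM !cmod_chr !mulr1. Qed.

Lemma kern_integrable j l : cintegrable (hT \x mTZ)%E (kern j l).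
Proof.
apply/cintegrableP; split; first exact: kern_cmeas.
rewrite tonelli1; last exact: kern_cmeas.
apply: le_lt_trans (absV_int_lty (j - p)); rewrite /absV.
by under eq_integral do under eq_integral do rewrite kern_cmod.
Qed.

Lemma kern_sec_integrable j l k :
  cintegrable (hT \x hT)%E (fun x => kern j l (x.1, (x.2, k))).
Proof.
have ms : cmeasurable (fun x : T * T => kern j l (x.1, (x.2, k))).
  apply: (cmeas_comp (h := fun x : T * T => (x.1, (x.2, k)))); last exact: kern_cmeas.
  apply: measurable_fun_pair; first exact: measurable_fst.
  by apply: measurable_fun_pair => //; exact: measurable_snd.
apply/cintegrableP; split=> //; rewrite tonelli1//.
apply: le_lt_trans (absV_int_lty (j - p)).
apply: ge0_le_integral => //.
- by move=> w _; apply: integral_ge0; nonneg.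
- exact: (meas_tonelli1 hT ms).
- exact: absV_meas.
move=> w _; apply: le_trans (absV_sec _ _ k).
by under eq_integral do rewrite kern_cmod.
Qed.

(** Integration over xi extracts the row j of the atom. Its phase in omega cancels against the
    character in [kern], and omega remains only in the translation and in [chr (- l)]. *)
Lemma kern_xi j l k omega : cint hT (fun xi => kern j l (omega, (xi, k))) =
  chr (k - l) zeta * (u (trZT omega (cutZ j (win j k))) * chr (- l) omega).
Proof.
have -> : (fun xi => kern j l (omega, (xi, k))) = (fun xi =>
    V ((j - p, omega), (xi, k)) * chr j xi * chr (k - l) (addT omega zeta)).
  by apply/funext => xi; rewrite /kern/= mulrA.
have [B hB] := dstftZT_bounded (j - p) omega k.
rewrite cintZr; last first.
  apply: (haar_integrable (B := B)) => [|xi].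
    by apply: cmeasM; [exact: dstftZT_sec_cmeas|exact: cmeas_chr].
  by rewrite cmodM cmod_chr mulr1.
rewrite dstftZT_coef cutZ_atom tz_scale//; last first.
  by apply: schwartz_tr; apply: schwartz_cut; exact: schwartz_atom.
rewrite chr_addT !chrD.
have rg (a b x y z t : R[i]) : b * x * (a * y * (z * t)) = (a * b) * (z * t * (x * y)) by ring.
by rewrite rg chr_mulN mul1r.
Qed.

(** The inversion integral for the row j, still carrying the factor conj Phi(p, zeta). Where it
    diverges, on a null set of eta, the value is a default. *)
Definition symY j eta : R[i] := cint mTZ (fun x => kern j 0 (subT eta zeta, x)).

Lemma kern_periodic j l w l' x : kern j l (translT w l', x) = kern j l (w, x).
Proof. by rewrite /kern/= dstftZT_periodic addT_translT chr_periodic. Qed.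

Lemma symY_periodic j : periodicT (symY j).
Proof.
by move=> w l; apply: eq_cint => x; rewrite subT_translT kern_periodic.
Qed.

Lemma symY_cmeas_sec j : cmeasurable (symY j).
Proof.
have := cmeas_cint1 mTZ (kern_cmeas j 0).
by move=> /(cmeas_comp (meas_subT zeta)).
Qed.

Lemma symY_le j eta : ((cmod (symY j eta))%:E <= absV (j - p) (subT eta zeta))%E.
Proof.
apply: le_trans (cmod_cint_le_ext _ _) _.
  by apply: (cmeas_xsection (f := kern j 0)); exact: kern_cmeas.
by under eq_integral do rewrite kern_cmod.
Qed.

Lemma symY_int j :
  (\int[hT]_w (cmod (symY j w))%:E <= \int[hT]_w absV (j - p) w)%E.
Proof.
rewrite -(haar_shift (negT zeta) (f := absV (j - p))).
- apply: ge0_le_integral => //.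
  + by nonneg.
  + by apply: cmeas_cmodE; exact: symY_cmeas_sec.
  + by apply: measurableT_comp; [exact: absV_meas|exact: meas_addT].
  move=> w _; rewrite -subT_addT; exact: symY_le.
- exact: absV_meas.
- exact: absV_ge0.
- by move=> w l; apply: eq_integral => x _; rewrite dstftZT_periodic.
Qed.

(** The majorant a, being integrable, is finite almost everywhere. *)
Lemma cint_ae_eq d (X : measurableType d) (mu : {measure set X -> \bar R})
    (f g : X -> R[i]) (a : X -> \bar R) : cmeasurable f -> cmeasurable g ->
  measurable_fun [set: X] a -> (forall x, 0 <= a x)%E -> (\int[mu]_x a x < +oo)%E ->
  (forall x, (a x < +oo)%E -> f x = g x) -> cint mu f = cint mu g.
Proof.
move=> [mf1 mf2] [mg1 mg2] ma a0 aoo fg.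
have ai : mu.-integrable setT a.
  by apply/integrableP; split=> //; under eq_integral do rewrite gee0_abs//.
have h := integrable_ae measurableT ai.
have E (P : R[i] -> R) : measurable_fun setT (fun x => P (f x)) ->
    measurable_fun setT (fun x => P (g x)) -> \int[mu]_x P (f x) = \int[mu]_x P (g x).
  move=> m1 m2; congr fine; apply: ae_eq_integral => //; try exact/measurable_EFinP.
  by apply: filterS h => x /(_ I) xf _; rewrite fg// ltey_eq xf.
by rewrite /cint; congr (_ +i* _)%C; exact: E.
Qed.

Lemma cintZ_shift (m : Z) (f : Z -> R[i]) : cint mZ (fun k => f (k - m)) = cint mZ f.
Proof.
have E (g : Z -> R) : \int[mZ]_k g (k - m) = \int[mZ]_k g k.
  rewrite /Rintegral; congr fine; rewrite integralE [in RHS]integralE.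
  congr (_ - _)%E.
    rewrite -[RHS](intZ_shift m (h := funepos (EFin \o g))) => [|k]; first by apply: eq_integral => x _; rewrite !funeposE.
    exact: funepos_ge0.
  rewrite -[RHS](intZ_shift m (h := funeneg (EFin \o g))) => [|k]; first by apply: eq_integral => x _; rewrite !funenegE.
  exact: funeneg_ge0.
by rewrite /cint; congr (_ +i* _)%C; [exact: (E (fun k => complex.Re (f k)))|exact: (E (fun k => complex.Im (f k)))].
Qed.

(** Once the integrals are exchanged, each k contributes the coefficient of u at (j, - l) times
    [fc chi (k - l) * chr (k - l) zeta]. The sum over k is the Fourier series of the window row at
    zeta. *)
Lemma symY_coef j l :
  cint hT (fun eta => symY j eta * chr (- l) eta) = u (mono j (- l)) * chi zeta.
Proof.
have Ki := kern_integrable j l.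
set A := u _; pose h eta := symY j eta * chr (- l) eta.
have mh : cmeasurable h by apply: cmeasM; [exact: symY_cmeas_sec|exact: cmeas_chr].
have ph : periodicT h by move=> w k; rewrite /h symY_periodic chr_periodic.
rewrite -[LHS](haar_cshift zeta mh ph).
(* The character may be pulled under the integral where the section of [kern] is integrable, that
   is, where [absV] is finite. *)
have -> : cint hT (fun w => h (addT w zeta)) = cint hT (fun w => cint mTZ (fun x => kern j l (w, x))).
  apply: (@cint_ae_eq _ _ hT _ _ (absV (j - p))).
  - exact: cmeas_shift.
  - exact: (cmeas_cint1 mTZ (kern_cmeas j l)).
  - exact: absV_meas.
  - exact: absV_ge0.
  - exact: absV_int_lty.
  move=> w woo; rewrite /h /symY addTK -cintZr; last first.
    apply/cintegrableP; split; first by apply: cmeas_xsection; exact: kern_cmeas.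
    by under eq_integral do rewrite kern_cmod.
  by apply: eq_cint => -[xi k]; rewrite /kern/= subr0 chrD !mulrA.
rewrite (cint_swap Ki).
have [gi _] := cint_fubini2 Ki.
have [ki ->] := cint_fubini2 (m1 := hT) (m2 := mZ) gi.
have E k : cint hT (fun xi => cint hT (fun w => kern j l (w, (xi, k)))) =
    A * (fc chi (k - l) * chr (k - l) zeta).
  rewrite -(cint_swap (kern_sec_integrable j l k)).
  rewrite (eq_cint _ (kern_xi j l k)).
  have Sc : schwartzZT (cutZ j (win j k)) by apply: schwartz_cut; exact: schwartz_atom.
  rewrite cintZ; last first.
    have [N [B [B0 hB]]] := tz_bound hu; have [C C0 hC] := schwartz_sn N Sc.
    apply: (haar_integrable (B := B * C)) => [|w].
      apply: cmeasM; last exact: cmeas_chr.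
      by apply: tz_tr_cmeas => //; exact: schwartz_atom.
    rewrite cmodM cmod_chr mulr1; apply: hB => //; first exact: schwartz_tr.
    exact: snle_tr.
  rewrite tz_coef//; last exact: schwartz_atom.
  rewrite fc_win -/A; ring.
have {}ki : cintegrable mZ (fun k => A * (fc chi (k - l) * chr (k - l) zeta)).
  by move: ki; congr cintegrable; apply/funext => k; rewrite E.
rewrite (eq_cint _ E).
(* [kern] being integrable, the terms A [fc chi (k - l) * chr (k - l) zeta] are summable in k. Hence
   the coefficients of the window row are summable as soon as A is nonzero; for A = 0 both sides
   vanish. *)
have [A0|A0] := eqVneq A 0.
  by rewrite A0 mul0r; under eq_cint do rewrite mul0r; exact: cint0.
have foo : (\int[mZ]_k (cmod (fc chi k))%:E < +oo)%E.
  have := cintegrable_lty (cintegrableZ A^-1 ki).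
  rewrite -(intZ_shift l (h := fun k => (cmod (fc chi k))%:E)); last by nonneg.
  by under eq_integral do rewrite mulrA mulVf// mul1r cmodM cmod_chr mulr1.
rewrite cintZ; last first.
  have := cintegrableZ A^-1 ki; congr cintegrable; apply/funext => k.
  by rewrite mulrA mulVf// mul1r.
congr (_ * _); rewrite (cintZ_shift l (fun k => fc chi k * chr k zeta)).
have Sc := schwartz_conj hPhi.
have [pF_ _ _ _] := schwartz_dest Sc.
have [B B0 hB] := schwartz_bounded Sc; have [K K0 hK] := schwartz_lip Sc.
apply: (fourier_inversion (B := B) (K := K)) => //.
- exact: (pF_ p).
- exact: (hK p).
- by move=> w; exact: (hB (p, w)).
Qed.

Definition symF (y : Z * T) : R[i] := symY y.1 y.2 / (Phi (p, zeta))^*.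

Lemma chi_neq0 : (Phi (p, zeta))^* != 0.
Proof. by rewrite -cmod_eq0 cmodJ cmod_eq0. Qed.

Lemma symF_cmeas : cmeasurable symF.
Proof.
apply: cmeas_ZX => j; apply: cmeasM; first exact: symY_cmeas_sec.
exact: cmeas_cst.
Qed.

(** The shifts by p and by zeta preserve the integral, so the bound of [symY] by [absV] integrates
    to |V|_1. *)
Lemma symF_norm : ((cmod (Phi (p, zeta)))%:E * \int[mZT]_y (cmod (symF y))%:E <=
  lpnorm (@muZTTZ R n) 1%:E V)%E.
Proof.
rewrite -gint_scale; [|by apply: cmeas_cmod; exact: symF_cmeas|exact: cmod_ge0|by nonneg].
have -> : (\int[mZT]_y (cmod (Phi (p, zeta)) * cmod (symF y))%:E =
    \int[mZT]_y (cmod (symY y.1 y.2))%:E)%E.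
  apply: eq_integral => y _; rewrite /symF cmodM cmodV cmodJ mulrCA mulfV ?mulr1//.
  by rewrite cmod_eq0.
rewrite (tonelli1 mZ hT); last by apply: cmeas_ZX => j; exact: symY_cmeas_sec.
rewrite normVE -(intZ_shift p (h := fun m => \int[hT]_w absV m w)%E); last first.
  by move=> m /=; apply: integral_ge0 => w _; exact: absV_ge0.
apply: ge0_le_integral => //; first by move=> j _; apply: integral_ge0; nonneg.
move=> j _; exact: symY_int.
Qed.

Lemma symF_integrable : cintegrable mZT symF.
Proof.
apply/cintegrableP; split; first exact: symF_cmeas.
have [_] := hV; move/(le_lt_trans symF_norm).
have : (0 <= \int[mZT]_y (cmod (symF y))%:E)%E by apply: integral_ge0; nonneg.
case: (\int[_]_y _)%E => [r _ _|_|//]; first exact: ltry.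
by rewrite gt0_muley// lte_fin cmod_gt0.
Qed.

Lemma symF_mul psi : schwartzZT psi -> cintegrable mZT (fun y => symF y * psi y).
Proof.
move=> Sp; have [B B0 hB] := schwartz_bounded Sp.
have mF := symF_cmeas.
apply: (@le_cintegrable _ _ _ _ _ (fun y => B * cmod (symF y))).
- by apply: cmeasM => //; exact: schwartz_cmeas.
- by apply: measurable_funM => //; exact: cmeas_cmod.
- by move=> y; rewrite cmodM mulrC ler_wpM2r ?cmod_ge0.
rewrite gint_scale//; [|exact: cmeas_cmod|by nonneg].
rewrite lte_mul_pinfty//; exact: cintegrable_lty symF_integrable.
Qed.

Lemma symF_represents : represents mZT (@schwartzZT R n) u symF.
Proof.
split; first exact: symF_cmeas.
move=> psi Sp; split; first exact: symF_mul.
(* The difference of u and integration against [symF] is again tempered, so it suffices to test it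
   on monomials. *)
pose v F := u F - cint mZT (fun y => symF y * F y).
apply/eqP; rewrite -subr_eq0; apply/eqP; rewrite -/(v psi).
apply: tz_zero => //.
  split.
    move=> a F G SF SG; rewrite /v tz_lin//.
    have -> : (fun y => symF y * (a * F y + G y)) = (fun y => a * (symF y * F y) + symF y * G y).
      by apply/funext => y; ring.
    rewrite cintD; [|by apply: cintegrableZ; exact: symF_mul|exact: symF_mul].
    rewrite cintZ; last exact: symF_mul.
    ring.
  have [_ [N [B hB]]] := hu.
  exists N, (B + fine (\int[mZT]_y (cmod (symF y))%:E)%E) => F SF K hK.
  apply: le_trans (cmodB _ _) _; rewrite mulrDl lerD//; first exact: hB.
  have Fi := cintegrable_lty symF_integrable.
  have F0 : (0 <= \int[mZT]_y (cmod (symF y))%:E)%E by apply: integral_ge0; nonneg.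
  have FK y : cmod (F y) <= K.
    case: y => j w; apply: le_trans (hK [::] (leq0n _) j w).
    by rewrite ler_peMl ?cmod_ge0// exprn_ege1// weight_ge1.
  have K0 : 0 <= K by apply: le_trans (FK (p, zeta)); exact: cmod_ge0.
  apply: cmod_cint_bound; first exact: symF_mul.
  rewrite EFinM fineK ?ge0_fin_numE// muleC -gint_scale//; last 2 first.
  - by apply: cmeas_cmod; exact: symF_cmeas.
  - by nonneg.
  apply: gint_le.
  - by apply: cmeas_cmod; apply: cmeasM; [exact: symF_cmeas|exact: schwartz_cmeas].
  - by apply: measurable_funM => //; apply: cmeas_cmod; exact: symF_cmeas.
  - by nonneg.
  by move=> y; rewrite cmodM mulrC ler_wpM2r ?cmod_ge0.
move=> j l; rewrite /v.
have [_ ->] := cint_fubini1 (m1 := mZ) (m2 := hT) (symF_mul (schwartz_mono R j l)).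
have [|_ ->] := @cintZ_single R n j (fun k => cint hT (fun w => symF (k, w) * mono j l (k, w))).
  move=> k /negPf kj; rewrite -[RHS](cint0 hT); apply: eq_cint => w.
  by rewrite /mono/= kj mul0r mulr0.
have -> : (fun w => symF (j, w) * mono j l (j, w)) =
    (fun w => ((Phi (p, zeta))^*)^-1 * (symY j w * chr (- (- l)) w)).
  by apply/funext => w; rewrite /mono /symF/= eqxx mul1r opprK; ring.
rewrite cintZ; last first.
  apply/cintegrableP; split.
    by apply: cmeasM; [exact: symY_cmeas_sec|exact: cmeas_chr].
  under eq_integral do rewrite cmodM cmod_chr mulr1.
  exact: le_lt_trans (symY_int j) (absV_int_lty _).
by rewrite symY_coef opprK mulrCA mulVf ?chi_neq0// mulr1 subrr.
Qed.

End Symbol.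

(** * Localization operators with integrable symbols *)

Section Subsequences.
Variable R : realType.

(** By Tychonoff the sequence has a cluster point h in the product of the intervals [-c, c]. At
    stage N a later index is chosen inside the neighbourhood of h that controls the finitely many
    coordinates [J_ N]. *)
Lemma bounded_subsequence (I : choiceType) (J_ : nat -> seq I) (f : nat -> I -> R) (c : R) :
  (forall i a, `|f i a| <= c) ->
  exists (s : nat -> nat) (h : I -> R), {homo s : i j / (i < j)%N} /\
    forall N a, a \in J_ N -> `|f (s N) a - h a| <= N.+1%:R^-1.
Proof.
move=> fc.
pose X := prod_topology (fun _ : I => R : topologicalType).
have cX : compact [set x : X | forall a, `[- c, c]%classic (x a)].
  by apply: (@tychonoff I (fun=> R) (fun=> `[- c, c]%classic)) => a; exact: segment_compact.
have [h [_ hcl]] : [set x : X | forall a, `[- c, c]%classic (x a)] `&` cluster ((f : nat -> X) @ \oo) !=set0.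
  apply: cX; exists 0%N => // i _ a /=.
  by rewrite in_itv/= -ler_norml.
have near N m : exists2 i, (m < i)%N & forall a, a \in J_ N -> `|f i a - h a| <= N.+1%:R^-1.
  have nb (s : seq I) : nbhs h [set x : X | forall a, a \in s -> `|x a - h a| <= N.+1%:R^-1].
    elim: s => [|a s IH]; first by apply: filterS filterT.
    have : nbhs h [set x : X | `|x a - h a| <= N.+1%:R^-1].
      have := @proj_continuous I (fun=> R : topologicalType) a h.
      move=> /(_ [set y : R | `|y - h a| <= N.+1%:R^-1]); apply.
      apply/nbhs_ballP; exists N.+1%:R^-1; first by rewrite /= invr_gt0.
      by move=> y; rewrite /ball/= distrC => /ltW.
    move=> ha; apply: filterS2 IH ha => x xs xa b; rewrite inE => /predU1P[->//|]; exact: xs.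
  have hm : ((f : nat -> X) @ \oo) [set f i | i in [set i | (m < i)%N]].
    by exists m.+1 => // i mi; exists i.
  have [_ [[i mi <-] xi]] := hcl _ _ hm (nb (J_ N)).
  by exists i.
pose nxt N m := sval (cid2 (near N m)).
have nxtP N m : (m < nxt N m)%N /\ forall a, a \in J_ N -> `|f (nxt N m) a - h a| <= N.+1%:R^-1.
  by rewrite /nxt; case: cid2.
pose s := fix s N := if N is M.+1 then nxt N (s M) else nxt 0%N 0%N.
exists s, h; split.
  by apply: (homo_ltn ltn_trans) => i; have [] := nxtP i.+1 (s i).
by case=> [|N] a aJ; [have [_] := nxtP 0%N 0%N|have [_] := nxtP N.+1 (s N)]; exact.
Qed.

End Subsequences.

Section Synthesis.
Variables (R : realType) (n : nat).
Local Notation T := (Tn R n).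
Local Notation Z := (Zn n).
Local Notation mZ := (@muZ R n).
Local Notation hT := (haar R n).
Local Notation mZT := (@muZT R n).
Local Notation nm f := (Num.sqrt (fine (sqn f))).
Variable g : Z -> R[i].
Hypothesis g1 : (abn g < +oo)%E.
Implicit Types (H S : Z * T -> R[i]) (f h : Z -> R[i]) (k m : Z) (w : T).
Local Notation ga := (fine (abn g)).

Let lg : l2 g := (abn_l2 g1).1.

Lemma ga_ge0 : 0 <= ga. Proof. by rewrite fine_ge0// abn_ge0. Qed.

Lemma gaE : (ga%:E = abn g)%E.
Proof. by rewrite fineK// ge0_fin_numE// abn_ge0. Qed.

Lemma tfshift_cmod m w k : cmod (tfshift m w g k) = cmod (g (k - m)).
Proof. by rewrite /tfshift -/(chr k w) cmodM cmod_chr mul1r. Qed.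

Lemma abn_tfshift m w : abn (tfshift m w g) = abn g.
Proof.
rewrite /abn; under eq_integral do rewrite tfshift_cmod.
by rewrite (intZ_shift m (h := fun k => (cmod (g k))%:E))//; nonneg.
Qed.

Lemma g_le k : cmod (g k) <= ga.
Proof.
rewrite -lee_fin gaE; apply: (@intZ_ge R n k (fun k => (cmod (g k))%:E)); nonneg.
Qed.

Lemma tfshift_cmeas k : cmeasurable (fun x : Z * T => tfshift x.1 x.2 g k).
Proof.
apply: cmeas_ZX => m; apply: (cmeasM (f := chr k) (g := fun=> g (k - m))).
  exact: cmeas_chr.
exact: cmeas_cst.
Qed.

Lemma l2_coord_le f k : l2 f -> cmod (f k) <= nm f.
Proof.
move=> lf; have := coord_le (mkl2 lf) k.
by rewrite /nrm /nsq /dotH Re_dotl2.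
Qed.

(** The coordinatewise integral of H(m, w) M_w T_m g, formally adjoint to the transform. A
    localization operator is synthesis after multiplication of the transform by the symbol. *)
Definition synth H k : R[i] := cint mZT (fun x => H x * tfshift x.1 x.2 g k).

Lemma synth_int H k : cintegrable mZT H ->
  cintegrable mZT (fun x => H x * tfshift x.1 x.2 g k).
Proof.
move=> Hi; have mH := cintegrable_meas Hi.
apply: (@le_cintegrable _ _ _ _ _ (fun x => ga * cmod (H x))).
- by apply: cmeasM => //; exact: tfshift_cmeas.
- by apply: measurable_funM => //; exact: cmeas_cmod.
- by move=> x; rewrite cmodM tfshift_cmod mulrC ler_wpM2r ?cmod_ge0// g_le.
rewrite gint_scale//; [|exact: cmeas_cmod|exact: ga_ge0|by nonneg].
by rewrite lte_mul_pinfty// ?lee_fin ?ga_ge0//; exact: cintegrable_lty Hi.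
Qed.

Lemma synth_lin (a : R[i]) H1 H2 : cintegrable mZT H1 -> cintegrable mZT H2 ->
  synth (fun x => a * H1 x + H2 x) = (fun k => a * synth H1 k + synth H2 k).
Proof.
move=> i1 i2; apply/funext => k; rewrite /synth.
have -> : (fun x => (a * H1 x + H2 x) * tfshift x.1 x.2 g k) =
    (fun x => a * (H1 x * tfshift x.1 x.2 g k) + H2 x * tfshift x.1 x.2 g k).
  by apply/funext => x; ring.
rewrite cintD; [|by apply: cintegrableZ; exact: synth_int|exact: synth_int].
by rewrite cintZ//; exact: synth_int.
Qed.

Lemma synth_sec H x : (\int[mZ]_k (cmod (H x * tfshift x.1 x.2 g k))%:E =
  (ga * cmod (H x))%:E)%E.
Proof.
under eq_integral do rewrite cmodM.
rewrite gint_scale; [|exact: meas_Z|exact: cmod_ge0|by nonneg].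
by rewrite -/(abn (tfshift x.1 x.2 g)) abn_tfshift -gaE -EFinM mulrC.
Qed.

Lemma synth_cmeas2 H (c : Z -> R[i]) : cmeasurable H ->
  cmeasurable (fun y : Z * (Z * T) => c y.1 * (H y.2 * tfshift y.2.1 y.2.2 g y.1)).
Proof.
move=> mH; apply: cmeas_ZX => k.
apply: (cmeasM (f := fun=> c k) (g := fun x => H x * tfshift x.1 x.2 g k)).
  exact: cmeas_cst.
by apply: cmeasM => //; exact: tfshift_cmeas.
Qed.

(** Synthesis maps L^1 to l^1. Since |.|_2 <= |.|_1 on sequences, L^1 estimates of the integrand
    yield boundedness and norm convergence in l^2. *)
Lemma abn_synth H : cmeasurable H ->
  (abn (synth H) <= abn g * \int[mZT]_x (cmod (H x))%:E)%E.
Proof.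
move=> mH; have m2 := synth_cmeas2 (fun=> 1) mH.
have := tonelli1 mZ mZT m2; rewrite (tonelli2 mZ mZT m2)/=.
under eq_integral => x _ do under eq_integral do rewrite mul1r.
under eq_integral => x _ do rewrite synth_sec.
rewrite gint_scale; [|exact: cmeas_cmod|exact: ga_ge0|by nonneg].
rewrite gaE => ->; apply: ge0_le_integral => //; first by nonneg.
move=> k _; under eq_integral do rewrite mul1r.
by apply: cmod_cint_le_ext; apply: cmeasM => //; exact: tfshift_cmeas.
Qed.

Lemma dot_synth H h : cintegrable mZT H -> l2 h ->
  dotl2 (synth H) h = cint mZT (fun x => H x * (stft g h x)^*).
Proof.
move=> Hi lh; have mH := cintegrable_meas Hi.
pose q (y : Z * (Z * T)) := (h y.1)^* * (H y.2 * tfshift y.2.1 y.2.2 g y.1).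
have mq : cmeasurable q by exact: (synth_cmeas2 (fun k => (h k)^*)).
have qi : cintegrable (mZ \x mZT)%E q.
  apply/cintegrableP; split=> //; rewrite tonelli2//.
  apply: (@le_lt_trans _ _ (\int[mZT]_x ((nm h * ga) * cmod (H x))%:E)%E).
    apply: ge0_le_integral => //.
    - by move=> x _; apply: integral_ge0; nonneg.
    - exact: (meas_tonelli2 mZ mq).
    - by apply/measurable_EFinP; apply: measurable_funM => //; exact: cmeas_cmod.
    move=> x _; rewrite -mulrA EFinM -synth_sec -gint_scale; [|exact: meas_Z|by []|by nonneg].
    apply: gint_le => //; [by nonneg|] => k.
    rewrite /q [cmod (_ * (_ * _))]cmodM cmodJ ler_wpM2r ?cmod_ge0//; exact: l2_coord_le.
  rewrite gint_scale; [|exact: cmeas_cmod|by rewrite mulr_ge0// ga_ge0|by nonneg].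
  rewrite lte_mul_pinfty// ?lee_fin ?mulr_ge0 ?ga_ge0//; exact: cintegrable_lty Hi.
have := cint_swap qi; rewrite /q/= => E.
transitivity (cint mZT (fun x => cint mZ (fun k =>
   (h k)^* * (H x * tfshift x.1 x.2 g k)))).
  rewrite -E; apply: eq_cint => k; rewrite cintZ; last exact: synth_int.
  by rewrite mulrC.
apply: eq_cint => x; rewrite /stft /dotl2.
have hi := dotl2_integrable lh (l2_tfshift x.1 x.2 lg).
rewrite -cintJ// -cintZ; last exact: cintegrableJ.
by apply: eq_cint => k; rewrite rmorphM/= conjCK; ring.
Qed.

Lemma lp2_le_abn f : (abn f < +oo)%E -> (lpnorm mZ 2%:E f <= abn f)%E.
Proof.
move=> foo; have [lf le2] := abn_l2 foo; rewrite lp2_sqrt//.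
have a0 : 0 <= fine (abn f) by rewrite fine_ge0// abn_ge0.
have aE : abn f = (fine (abn f))%:E by rewrite fineK// ge0_fin_numE// abn_ge0.
rewrite aE lee_fin.
have -> : fine (abn f) = Num.sqrt (fine (abn f) ^+ 2) by rewrite sqrtr_sqr ger0_norm.
rewrite ler_wsqrtr// -lee_fin fineK; last exact: l2_sqn_fin.
by apply: le_trans le2 _; rewrite {1 2}aE -EFinM lee_fin expr2.
Qed.

Lemma stft_lin (a : R[i]) f h x : l2 f -> l2 h ->
  stft g (fun k => a * f k + h k) x = a * stft g f x + stft g h x.
Proof. by move=> lf lh; apply: dotl2_lin => //; exact: l2_tfshift. Qed.

Variable F : Z * T -> R[i].
Hypothesis Fi : cintegrable mZT F.

Lemma sym_mul S (C : R) : cmeasurable S -> (forall x, cmod (S x) <= C) ->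
  cintegrable mZT (fun x => F x * S x) /\
  (\int[mZT]_x (cmod (F x * S x))%:E <= C%:E * \int[mZT]_x (cmod (F x))%:E)%E.
Proof.
move=> mS SC; have mF := cintegrable_meas Fi.
have C0 : 0 <= C by apply: le_trans (SC (0, [tuple 0 | i < n])); exact: cmod_ge0.
have h : (\int[mZT]_x (cmod (F x * S x))%:E <= C%:E * \int[mZT]_x (cmod (F x))%:E)%E.
  rewrite -gint_scale//; [|exact: cmeas_cmod|by nonneg].
  apply: gint_le; [by apply: cmeas_cmod; exact: cmeasM| |by nonneg|].
    by apply: measurable_funM => //; exact: cmeas_cmod.
  by move=> x; rewrite cmodM mulrC ler_wpM2r ?cmod_ge0.
split=> //; apply/cintegrableP; split; first exact: cmeasM.
apply: le_lt_trans h _; rewrite lte_mul_pinfty//; exact: cintegrable_lty Fi.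
Qed.

Definition locop f : Z -> R[i] := synth (fun x => F x * stft g f x).

Lemma locop_int f : l2 f -> cintegrable mZT (fun x => F x * stft g f x).
Proof.
move=> lf; have [] // := @sym_mul (stft g f) (nm f * nm g) (stft_cmeas g f).
by move=> x; exact: stft_le.
Qed.

Lemma locop_abn f : l2 f ->
  (abn (locop f) <= (ga * nm g * fine (\int[mZT]_x (cmod (F x))%:E) * nm f)%:E)%E.
Proof.
move=> lf; have mS := stft_cmeas g f.
apply: le_trans (abn_synth (cintegrable_meas (locop_int lf))) _.
have [_ h] := sym_mul mS (fun x => stft_le x lf lg).
have F0 : (0 <= \int[mZT]_x (cmod (F x))%:E)%E by apply: integral_ge0; nonneg.
have FE : (\int[mZT]_x (cmod (F x))%:E = (fine (\int[mZT]_x (cmod (F x))%:E))%:E)%E.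
  by rewrite fineK// ge0_fin_numE//; exact: cintegrable_lty Fi.
rewrite -gaE; apply: (@le_trans _ _ (ga%:E * ((nm f * nm g)%:E * \int[mZT]_x (cmod (F x))%:E))%E).
  by rewrite lee_wpmul2l// lee_fin ga_ge0.
by rewrite FE -!EFinM lee_fin le_eqVlt; apply/orP; left; apply/eqP; ring.
Qed.

Lemma locop_bounded : bounded_op locop.
Proof.
split.
- by move=> f lf; have [] := abn_l2 (le_lt_trans (locop_abn lf) (ltry _)).
- move=> a f h lf lh; rewrite /locop -synth_lin; [|exact: locop_int|exact: locop_int].
  by congr synth; apply/funext => x; rewrite stft_lin//; ring.
exists (ga * nm g * fine (\int[mZT]_x (cmod (F x))%:E)%E) => f lf.
have h := locop_abn lf.
apply: le_trans (lp2_le_abn (le_lt_trans h (ltry _))) _.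
by rewrite (lp2_sqrt lf) -EFinM.
Qed.

Lemma locop_dot f h : l2 f -> l2 h ->
  cintegrable mZT (fun x => F x * stft g f x * (stft g h x)^*) /\
  dotl2 (locop f) h = cint mZT (fun x => F x * stft g f x * (stft g h x)^*).
Proof.
move=> lf lh; split; last by rewrite dot_synth//; exact: locop_int.
have [] := @sym_mul (fun x => stft g f x * (stft g h x)^*) (nm f * nm g * (nm h * nm g)).
- by apply: cmeasM; [exact: stft_cmeas|apply: cmeasJ; exact: stft_cmeas].
- by move=> x; rewrite cmodM cmodJ ler_pM ?cmod_ge0// ?stft_le.
by under eq_fun do rewrite mulrA.
Qed.

Lemma stft_bounded f (C : R) x : (forall k, cmod (f k) <= C) ->
  cmod (stft g f x) <= C * ga.
Proof.
move=> fC; have C0 : 0 <= C by apply: le_trans (fC 0); exact: cmod_ge0.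
rewrite -lee_fin; apply: le_trans (cmod_cint_le_ext _ (cmeas_Z _)) _.
rewrite EFinM gaE -(abn_tfshift x.1 x.2) /abn -gint_scale; [|exact: meas_Z|by []|by nonneg].
apply: gint_le => //; [by nonneg|] => k.
by rewrite cmodM cmodJ ler_wpM2r ?cmod_ge0.
Qed.

(* A bounded sequence converges coordinatewise along a subsequence; its
   transforms then converge pointwise, and the images converge in l^1. *)
Lemma locop_compact : compact_op locop.
Proof.
move=> f c fc.
have fk i k : cmod (f i k) <= c.
  have [lf] := fc i; rewrite lp2_sqrt// lee_fin; apply: le_trans; exact: l2_coord_le.
have c0 : 0 <= c by apply: le_trans (fk 0%N 0); exact: cmod_ge0.
(* Real and imaginary parts become separate real coordinates, told apart by the boolean. *)
pose q i (kb : Z * bool) : R := if kb.2 then complex.Re (f i kb.1) else complex.Im (f i kb.1).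
have qc i kb : `|q i kb| <= c.
  rewrite /q; case: kb.2; [apply: le_trans (Re_le_cmod _) _|apply: le_trans (Im_le_cmod _) _]; exact: fk.
pose J N : seq (Z * bool) := [seq (k, b) | k <- exhaust n N, b <- [:: true; false]].
have [s [r [smono hr]]] := bounded_subsequence J qc.
pose h k : R[i] := (r (k, true) +i* r (k, false))%C.
have near N k : k \in exhaust n N -> cmod (f (s N) k - h k) <= 2 * N.+1%:R^-1.
  move=> kN; apply: le_trans (cmod_le_ReIm _) _; rewrite ReD ImD ReN ImN/=.
  have h1 : `|q (s N) (k, true) - r (k, true)| <= N.+1%:R^-1.
    by apply: hr; apply/allpairsP; exists (k, true).
  have h2 : `|q (s N) (k, false) - r (k, false)| <= N.+1%:R^-1.
    by apply: hr; apply/allpairsP; exists (k, false).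
  by apply: le_trans (lerD h1 h2) _; rewrite mulr_natl mulr2n.
have fcv k : (fun i => cmod (f (s i) k - h k)) @ \oo --> (0 : R).
  apply/cvg_eps => [M|e e0]; first exact: cmod_ge0.
  have [N1 hN1] := exhaust_cover [:: k].
  pose N2 := (Num.truncn (2 / e)).+1; exists (maxn N1 N2) => N; rewrite geq_max => /andP[NN1 NN2].
  apply: le_trans (near N k _) _; first by apply: (hN1 N NN1); rewrite inE.
  rewrite ler_pdivrMr// -ler_pdivrMl// mulrC; apply/ltW.
  apply: (lt_le_trans (truncnS_gt _)); rewrite ler_nat; exact: leqW.
(* The slack 2 is a bound for 2 / (N1 + 1), the error at a stage that controls k. *)
have hk k : cmod (h k) <= c + 2.
  have [N1 hN1] := exhaust_cover [:: k].
  have kN : k \in exhaust n N1 by apply: (hN1 N1 (leqnn _)); rewrite inE.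
  rewrite -(subrK (f (s N1) k) (h k)) addrC; apply: le_trans (cmodD _ _) _.
  apply: lerD => //; rewrite cmodC; apply: le_trans (near N1 k kN) _.
  by rewrite ler_piMr// invf_le1// ler1n.
pose S := stft g h; pose Si i := stft g (f (s i)).
pose C := c + 2; have C0 : 0 <= C by rewrite addr_ge0.
have fk' i k : cmod (f i k) <= C by apply: le_trans (fk i k) _; rewrite lerDl.
have Scv x : (fun i => cmod (Si i x - S x)) @ \oo --> (0 : R).
  have [|||_ //] := @cint_dominated _ _ _ mZ
    (fun i k => f (s i) k * (tfshift x.1 x.2 g k)^*) (fun k => h k * (tfshift x.1 x.2 g k)^*)
    (fun k => C * cmod (tfshift x.1 x.2 g k)) (fun i => cmeas_Z _) _ (meas_Z _).
  - move=> k; have := cvg0_scale (cmod (tfshift x.1 x.2 g k)) (fcv k).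
    by under eq_fun do rewrite -cmodJ -cmodM mulrC mulrBl.
  - rewrite gint_scale//; last by nonneg.
    by rewrite -/(abn (tfshift x.1 x.2 g)) abn_tfshift lte_mul_pinfty// lee_fin.
  - by move=> i k; rewrite cmodM cmodJ ler_wpM2r ?cmod_ge0.
have mF := cintegrable_meas Fi.
have [hi _] := @sym_mul S (C * ga) (stft_cmeas g h) (fun x => stft_bounded x hk).
have habs : (fun i => \int[mZT]_x (cmod (F x * Si i x - F x * S x))%:E)%E @ \oo --> 0%E.
  apply: (@cint_dominated_abs _ _ _ mZT (fun i x => F x * Si i x) (fun x => F x * S x)
    (fun x => (C * ga) * cmod (F x))).
  - by move=> i; apply: cmeasM => //; exact: stft_cmeas.
  - move=> x; have := cvg0_scale (cmod (F x)) (Scv x).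
    by under eq_fun do rewrite -cmodM mulrBr.
  - by apply: measurable_funM => //; exact: cmeas_cmod.
  - rewrite gint_scale; [|exact: cmeas_cmod|by rewrite mulr_ge0// ga_ge0|by nonneg].
    by rewrite lte_mul_pinfty// ?lee_fin ?mulr_ge0 ?ga_ge0//; exact: cintegrable_lty Fi.
  - move=> i x; rewrite cmodM mulrC ler_wpM2r ?cmod_ge0//; exact: stft_bounded.
have Loo H : cintegrable mZT H -> (abn (synth H) < +oo)%E.
  move=> iH; apply: le_lt_trans (abn_synth (cintegrable_meas iH)) _.
  by rewrite -gaE lte_mul_pinfty// ?lee_fin ?ga_ge0//; exact: cintegrable_lty iH.
exists s, (synth (fun x => F x * S x)); split=> //.
  by have [] := abn_l2 (Loo _ hi).
have fi i : cintegrable mZT (fun x => F x * Si i x) by apply: locop_int; have [] := fc (s i).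
have di i : (fun k => locop (f (s i)) k - synth (fun x => F x * S x) k) =
    synth (fun x => F x * Si i x - F x * S x).
  apply/funext => k; have := congr1 (fun v => v k) (synth_lin (-1) hi (fi i)).
  rewrite /= mulN1r addrC => <-; congr (synth _ k).
  by apply/funext => x; rewrite mulN1r addrC.
apply: (@squeeze_cvge _ _ _ _ (fun=> 0%E) _ (fun i => abn g *
    \int[mZT]_x (cmod (F x * Si i x - F x * S x))%:E)%E).
- apply: nearW => i; rewrite di; apply/andP; split; first exact: Lnorm_ge0.
  have ii := cintegrableB (fi i) hi.
  apply: le_trans (lp2_le_abn (Loo _ ii)) _.
  exact: abn_synth (cintegrable_meas ii).
- exact: cvg_cst.
- rewrite -(mule0 (abn g)); apply: cvgeZl => //.
  by rewrite ge0_fin_numE// abn_ge0.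
Qed.

End Synthesis.

Section Density.
Variables (R : realType) (n : nat).
Local Notation Z := (Zn n).
Local Notation mZ := (@muZ R n).
Local Notation H := (l2t R n).
Implicit Types (f h : Z -> R[i]) (A B : (Z -> R[i]) -> (Z -> R[i])).

Definition deltaH (a : Z) : H := mkl2 (l2_delta R a).

Lemma deltaHE a k : deltaH a k = (k == a)%:R. Proof. by []. Qed.

Lemma trunc_cvg (f : H) :
  Hcvg (@dotH R n) (fun N => \sum_(k <- exhaust n N) f k *: deltaH k) f.
Proof.
have lf := l2tP f.
have E N k : (\sum_(l <- exhaust n N) f l *: deltaH l : H) k = (pickle k < N)%:R * f k.
  have E0 l : (f l *: deltaH l : H) k = (k == l)%:R * f k.
    by rewrite l2vZ deltaHE; case: eqVneq => [->|_]; rewrite ?mulr1 ?mul1r ?mulr0 ?mul0r.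
  rewrite l2v_sum (eq_bigr _ (fun l _ => E0 l)) -mulr_suml -mem_exhaust; congr (_ * _).
  have [kN|kN] := boolP (k \in exhaust n N).
    rewrite (bigD1_seq k) ?exhaust_uniq//= eqxx big1 ?addr0// => l /negPf lk.
    by rewrite eq_sym lk.
  rewrite big1_seq// => l /andP[_ lN]; case: eqVneq => // kl.
  by rewrite kl lN in kN.
(* Squared moduli made complex, to reuse dominated convergence; the squared distance to f is their
   tail. *)
pose c k : R[i] := (cmod (f k) ^+ 2)%:C%C.
have cE k : cmod (c k) = cmod (f k) ^+ 2 by rewrite /c cmod_real ger0_norm// sqr_ge0.
have coo : (\int[mZ]_k (cmod (c k))%:E < +oo)%E.
  by under eq_integral do rewrite cE; exact/l2P.
have h := @cint_dominated_abs _ _ _ mZ (fun N k => (pickle k < N)%:R * c k) c (fun k => cmod (c k))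
  (fun N => cmeas_Z _) _ (meas_Z _) coo _.
have {}h : (fun N => \int[mZ]_k (cmod ((pickle k < N)%:R * c k - c k))%:E)%E @ \oo --> 0%E.
  apply: h.
    move=> k; apply/cvg_eps => [M|e e0]; first exact: cmod_ge0.
    by exists (pickle k).+1 => N kN; rewrite kN mul1r subrr cmod0 ltW.
  move=> N k; case: (_ < _)%N; first by rewrite mul1r.
  by rewrite mul0r cmod0 cmod_ge0.
have nE N : (\int[mZ]_k (cmod ((pickle k < N)%:R * c k - c k))%:E =
    (nrm (@dotH R n) (\sum_(k <- exhaust n N) f k *: deltaH k - f) ^+ 2)%:E)%E.
  rewrite (nrm_sq (dotH_ip R n)) -nsqE; apply: eq_integral => k _.
  rewrite l2vD l2vN E; case: (_ < _)%N.
    by rewrite !mul1r !subrr !cmod0 expr0n.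
  by rewrite !mul0r !sub0r !cmodN cE.
have h2 : (fun N => nrm (@dotH R n) (\sum_(k <- exhaust n N) f k *: deltaH k - f) ^+ 2) @ \oo --> (0 : R).
  by apply/(cvgEFinP (F := \oo)); under eq_fun do rewrite -nE.
apply/cvg_eps => [M|e e0]; first exact: nrm_ge0.
have [M hM] := (cvg_eps (fun N => sqr_ge0 _)).1 h2 _ (exprn_gt0 2 e0).
exists M => N MN; have := hM N MN.
by rewrite ler_pXn2r// nnegrE ?nrm_ge0 ?ltW.
Qed.

(** Truncations converge in norm by [trunc_cvg], and both operators are continuous. *)
Lemma bounded_op_ext A B : bounded_op A -> bounded_op B ->
  (forall a, A (deltaZ R a) = B (deltaZ R a)) -> forall f, l2 f -> A f = B f.
Proof.
move=> bA bB AB f lf; have ip := dotH_ip R n.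
have cA := Hcvg_lin (opH_lin bA) (opH_bnd bA) (trunc_cvg (mkl2 lf)).
have cB := Hcvg_lin (opH_lin bB) (opH_bnd bB) (trunc_cvg (mkl2 lf)).
have E : (fun N => opH A (\sum_(k <- exhaust n N) (mkl2 lf) k *: deltaH k)) =
    (fun N => opH B (\sum_(k <- exhaust n N) (mkl2 lf) k *: deltaH k)).
  apply/funext => N; rewrite (Hlin_sum (opH_lin bA)) (Hlin_sum (opH_lin bB)).
  apply: eq_bigr => k _; rewrite (HlinZ (opH_lin bA)) (HlinZ (opH_lin bB)); congr (_ *: _).
  by apply: l2v_inj => j; rewrite opHE// opHE// /deltaH mkl2E AB.
rewrite E in cA; have := Hcvg_unique ip cA cB => e.
have := congr1 (fun v : H => (v : Z -> R[i])) e.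
by rewrite opHE// opHE// mkl2E.
Qed.

End Density.

Section LocopUnique.
Variables (R : realType) (n : nat).
Local Notation T := (Tn R n).
Local Notation Z := (Zn n).
Local Notation mZ := (@muZ R n).
Local Notation hT := (haar R n).
Local Notation mZT := (@muZT R n).
Variable g : Z -> R[i].
Hypothesis g1 : (abn g < +oo)%E.
Variable u : (Z * T -> R[i]) -> R[i].
Implicit Types (F sig : Z * T -> R[i]) (f h : Z -> R[i]) (a b m l : Z).

Let lg : l2 g := (abn_l2 g1).1.

Lemma stft_delta a m (w : T) : stft g (deltaZ R a) (m, w) = chr (- a) w * (g (a - m))^*.
Proof.
rewrite /stft dotl2_conj; [|exact: l2_delta|exact: l2_tfshift].
by rewrite dotl2_delta /tfshift -/(chr a w) rmorphM/= chrN.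
Qed.

Lemma represents_coef sig m l : represents mZT (@schwartzZT R n) u sig ->
  cintegrable hT (fun w => sig (m, w) * chr l w) /\
  cint hT (fun w => sig (m, w) * chr l w) = u (mono m l).
Proof.
move=> [ms hs]; have [si ->] := hs _ (schwartz_mono R m l).
have E : (fun w => sig (m, w) * mono m l (m, w)) = (fun w => sig (m, w) * chr l w).
  by apply/funext => w; rewrite /mono/= eqxx mul1r.
split.
  have sm : cmeasurable (fun w => sig (m, w) * chr l w).
    by apply: cmeasM; [exact: cmeas_xsection|exact: cmeas_chr].
  apply/cintegrableP; split=> //; have := cintegrable_lty si.
  rewrite (tonelli1 mZ hT (cintegrable_meas si)); apply: le_lt_trans.
  have e w : sig (m, w) * chr l w = sig (m, w) * mono m l (m, w) by rewrite /mono/= eqxx mul1r.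
  under eq_integral do rewrite e.
  apply: (@intZ_ge R n m (fun k => \int[hT]_w (cmod (sig (k, w) * mono m l (k, w))%R)%:E)%E) => k.
  by apply: integral_ge0; nonneg.
have [_ ->] := cint_fubini1 (m1 := mZ) (m2 := hT) si.
have [|_ ->] := @cintZ_single R n m (fun k => cint hT (fun w => sig (k, w) * mono m l (k, w))).
  move=> k /negPf km; rewrite -[RHS](cint0 hT); apply: eq_cint => w.
  by rewrite /mono/= km mul0r mulr0.
by rewrite E.
Qed.

(* The matrix of A sees the symbol only through u, whichever function
   representing u is used. *)
Lemma locop_entry A a b : is_locop u g g A ->
  A (deltaZ R a) b = cint mZ (fun m => (g (a - m))^* * g (b - m) * u (mono m (b - a))).
Proof.
move=> [bA [sig rsig hA]]; rewrite -dotl2_delta.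
have [/= Ii ->] := hA _ _ (l2_delta R a) (l2_delta R b).
have [_ ->] := cint_fubini1 (m1 := mZ) (m2 := hT) Ii.
apply: eq_cint => m; have [si sE] := represents_coef m (b - a) rsig.
rewrite -sE -cintZ//; apply: eq_cint => w.
by rewrite !stft_delta rmorphM/= conjCK -chrN opprK chrD; ring.
Qed.

Lemma locop_is_locop F : represents mZT (@schwartzZT R n) u F -> cintegrable mZT F ->
  is_locop u g g (locop g F).
Proof.
move=> rF Fi; split; first exact: locop_bounded.
by exists F => // f h lf lh; exact: locop_dot.
Qed.

Lemma locop_unique F A : represents mZT (@schwartzZT R n) u F -> cintegrable mZT F ->
  is_locop u g g A -> forall f, l2 f -> A f = locop g F f.
Proof.
move=> rF Fi hA; have hL := locop_is_locop rF Fi.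
apply: bounded_op_ext; [by case: hA|by case: hL|] => a.
by apply/funext => b; rewrite (locop_entry a b hA) (locop_entry a b hL).
Qed.

Lemma locop_adjoint F : cintegrable mZT F ->
  adjoint_op (locop g F) (locop g (fun x => (F x)^*)).
Proof.
move=> Fi; have Fi' := cintegrableJ Fi; split; first exact: locop_bounded.
move=> f h lf lh; have [_ ->] := locop_dot g1 Fi lf lh.
have [Ii E] := locop_dot g1 Fi' lh lf.
have [bl _ _] := locop_bounded g1 Fi'.
rewrite dotl2_conj; [|done|exact: bl].
by rewrite E -cintJ//; apply: eq_cint => x; rewrite !rmorphM/= !conjCK; ring.
Qed.

End LocopUnique.

(** * Trace norms *)

Section Polarization.
Variables (R : realType) (H : lmodType R[i]) (dot : H -> H -> R[i]).
Hypothesis ip : inner_product dot.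

(* Applied to f + g and 'i f + g, positivity gives the two real equations of
   <P f, g> = <f, P g>. *)
Lemma pos_sym (P : H -> H) : Hlinear P -> (forall f, 0 <= dot (P f) f) -> Hsym dot P.
Proof.
move=> lP pP f g; have hf := ip_form ip.
have im0 h : complex.Im (dot (P h) h) = 0.
  by have := pP h; rewrite complex_ge0P => /andP[/eqP].
have key h : complex.Im (dot (P h) g) + complex.Im (dot (P g) h) = 0.
  have := im0 (h + g).
  rewrite (HlinD lP) (formDl hf) !(formDr hf) !ImD (im0 h) (im0 g).
  by rewrite add0r addr0.
rewrite [RHS](hf_conj hf).
have e1 := key f; have := key ('i%C *: f).
rewrite (HlinZ lP) (formZl hf) (formZr hf) !ImM.
have -> : complex.Re ('i%C : R[i]) = 0 by [].
have -> : complex.Im ('i%C : R[i]) = 1 by [].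
rewrite ReJ ImJ; have -> : complex.Re ('i%C : R[i]) = 0 by [].
have -> : complex.Im ('i%C : R[i]) = 1 by [].
move=> e2; apply: eqRI; rewrite ?ReJ ?ImJ.
  by apply/eqP; rewrite -subr_eq0; apply/eqP; rewrite -e2; ring.
by apply/eqP; rewrite -subr_eq0 opprK e1.
Qed.

End Polarization.

(** * The absolute value of a compact operator and its eigenspaces *)

Section AbsoluteValue.
Variables (R : realType) (n : nat).
Local Notation Z := (Zn n).
Local Notation H := (l2t R n).
Local Notation dot := (@dotH R n).
Local Notation nrm := (nrm dot).
Local Notation nsq := (nsq dot).
Implicit Types (A B P : (Z -> R[i]) -> (Z -> R[i])).
Let ip := dotH_ip R n.
Let hf := ip_form ip.

Lemma opH_dot A (f g : H) : bounded_op A -> dot (opH A f) g = dotl2 (A f) g.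
Proof. by move=> bA; rewrite /dotH opHE. Qed.

Lemma adjoint_H A B (f g : H) : bounded_op A -> adjoint_op A B ->
  dot (opH A f) g = dot f (opH B g).
Proof.
move=> bA [bB hB]; rewrite opH_dot// /dotH opHE//; apply: hB; exact: l2tP.
Qed.

Lemma adjoint_HC A B (f g : H) : bounded_op A -> adjoint_op A B ->
  dot (opH B f) g = dot f (opH A g).
Proof.
by move=> bA aB; rewrite (hf_conj hf) -(adjoint_H _ _ bA aB) -(hf_conj hf).
Qed.

(** [positive_sqrt] is applied to B A, which is positive since <B A f, f> = |A f|^2, and compact
    since A is compact and B bounded. *)
Lemma absop_exists A B : bounded_op A -> compact_op A -> adjoint_op A B ->
  exists P, is_absop A P.
Proof.
move=> bA cA aB; have [bB _] := aB.
pose P0 f := opH B (opH A f).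
have PE f g : dot (P0 f) g = dot (opH A f) (opH A g) by rewrite (adjoint_HC _ _ bA aB).
have [cB cB0 hcB] := opH_bnd bB; have [c c0 hc] := opH_bnd bA.
have [| | | | |S [lS bS pS S2]] := @positive_sqrt _ _ _ ip P0 (@l2_complete R n).
- by move=> a f g; rewrite /P0 (opH_lin bA) (opH_lin bB).
- by move=> f g; rewrite PE (hf_conj hf) -PE -(hf_conj hf).
- by move=> f; rewrite PE; exact: hf_ge0.
- exists (cB * c) => [|f]; first exact: mulr_ge0.
  by apply: le_trans (hcB _) _; rewrite -mulrA ler_wpM2l.
- move=> v k vk; have [s [h [sm hh]]] := opH_compact bA cA vk.
  exists s, (opH B h); split=> //; exact: Hcvg_lin (opH_lin bB) (opH_bnd bB) _ _ hh.
exists (unH S); split; first exact: unH_bounded.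
  move=> f lf; have := pS (mkl2 lf).
  by rewrite /dotH -unHE mkl2E.
exists B => // f lf; have E (g : H) : unH S (g : Z -> R[i]) = S g by exact: unHE.
have := S2 (mkl2 lf); rewrite /P0 => /(congr1 (fun v : H => (v : Z -> R[i]))).
by rewrite opHE// opHE// -E -E mkl2E.
Qed.

Section SingularValues.
Variables A P : (Z -> R[i]) -> (Z -> R[i]).
Hypothesis bA : bounded_op A.
Hypothesis cA : compact_op A.
Hypothesis hP : is_absop A P.

Let AH := opH A.
Let PH := opH P.

Let bP : bounded_op P. Proof. by case: hP. Qed.

Lemma PH_pos f : 0 <= dot (PH f) f.
Proof. by case: hP => _ pP _; rewrite opH_dot//; apply: pP; exact: l2tP. Qed.

Lemma PH_sym : Hsym dot PH.
Proof. exact: (pos_sym ip (opH_lin bP) PH_pos). Qed.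

Lemma dot_PH f g : dot (PH f) (PH g) = dot (AH f) (AH g).
Proof.
have [_ _ [B aB PP]] := hP; have [bB _] := aB.
rewrite -PH_sym -(adjoint_HC _ _ bA aB); congr (dot _ _).
by apply: l2v_inj => k; rewrite !opHE// PP//; exact: l2tP.
Qed.

Lemma nsq_PH f : nsq (PH f) = nsq (AH f).
Proof. by rewrite /nsq dot_PH. Qed.

Lemma nrm_PH f : nrm (PH f) = nrm (AH f).
Proof. by rewrite /nrm nsq_PH. Qed.

(** |P f| = |A f| carries Cauchy sequences of images under A over to images under P, and l^2 is
    complete. *)
Lemma PH_compact : Hcompact dot PH.
Proof.
move=> v k vk; have [s [h [sm hh]]] := opH_compact bA cA vk.
have [|l hl] := @l2_complete R n (fun i => PH (v (s i))); last by exists s, l.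
move=> e e0; have [N hN] := Hcvg_cauchy ip hh e0; exists N => i j Ni Nj.
by rewrite -(HlinB (opH_lin bP)) nrm_PH /AH (HlinB (opH_lin bA)); exact: hN.
Qed.

Lemma eigen_orth (a b : R) f g : PH f = a%:C%C *: f -> PH g = b%:C%C *: g -> a != b ->
  dot f g = 0.
Proof.
move=> Pf Pg ab; have := PH_sym f g; rewrite Pf Pg (formZl hf) (formZr hf).
have -> : (b%:C%C : R[i])^* = b%:C%C by apply: eqRI; rewrite ?ReJ ?ImJ//= oppr0.
move=> /eqP; rewrite -subr_eq0 -mulrBl mulf_eq0 => /orP[|/eqP//].
by rewrite -rmorphB/= -cmod_eq0 cmod_real normr_eq0 subr_eq0 (negPf ab).
Qed.

Definition eigen_set (lam : R) : set nat := [set r : nat | exists e : 'I_r -> Z -> R[i],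
  lin_indep e /\ forall i, l2 (e i) /\ P (e i) = (fun k => lam%:C%C * e i k)].

(** Gram-Schmidt only forms linear combinations, so it stays inside the eigenspace. *)
Lemma eigen_family lam r : eigen_set lam r -> exists o : nat -> H,
  [/\ forall i j, (i < r)%N -> (j < r)%N -> i != j -> dot (o i) (o j) = 0,
      forall i, (i < r)%N -> nsq (o i) = 1 &
      forall i, (i < r)%N -> PH (o i) = lam%:C%C *: o i].
Proof.
move=> [e [ie he]].
pose v (j : nat) : H := if insub j is Some i then mkl2 (he i).1 else 0.
have vE (i : 'I_r) : v i = mkl2 (he i).1 by rewrite /v valK.
have vind (c : nat -> R[i]) : \sum_(j < r) c j *: v j = 0 -> forall j, (j < r)%N -> c j = 0.
  move=> c0 j jr; apply: (ie (fun i => c i) _ (Ordinal jr)) => k.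
  have := congr1 (fun w : H => w k) c0; rewrite l2v_sum l2v0 => h.
  by rewrite -[RHS]h; apply: eq_bigr => i _; rewrite l2vZ vE.
have [w [wo on1 osp]] := gram_schmidt ip vind; exists w; split=> // i ir.
have [c ->] := osp i ir.
rewrite /PH (Hlin_sum (opH_lin bP)) scaler_sumr; apply: eq_bigr => j _.
rewrite (HlinZ (opH_lin bP)) scalerA mulrC -scalerA; congr (_ *: _).
by apply: l2v_inj => k; rewrite opHE// vE l2vZ /= (he j).2.
Qed.

Lemma eigen_ge lam r (o : nat -> H) :
  (forall i j, (i < r)%N -> (j < r)%N -> i != j -> dot (o i) (o j) = 0) ->
  (forall i, (i < r)%N -> nsq (o i) = 1) ->
  (forall i, (i < r)%N -> PH (o i) = lam%:C%C *: o i) -> eigen_set lam r.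
Proof.
move=> oo on1 oP; exists (fun i k => o i k); split; last first.
  move=> i; split; first exact: l2tP.
  apply/funext => k; have := congr1 (fun w : H => w k) (oP i (ltn_ord i)).
  by rewrite opHE// l2vZ.
move=> c c0 i.
have s0 : \sum_(j < r) c j *: o j = 0.
  by apply: l2v_inj => k; rewrite l2v_sum l2v0 -[RHS](c0 k); apply: eq_bigr => j _; rewrite l2vZ.
have := congr1 (fun w => dot w (o i)) s0; rewrite (form_suml hf) (form0l hf).
rewrite (bigD1 i)//= big1 => [|j ji]; last first.
  by rewrite (formZl hf) oo ?mulr0.
rewrite addr0 (formZl hf) (form_self hf) -/(nsq _) on1// => h.
by rewrite -[LHS]mulr1.
Qed.

(** Equal eigenvalues are grouped: a positive value occurring r times comes with r orthonormal
    eigenvectors, so r is at most its multiplicity. Zero eigenvalues contribute nothing. *)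
Lemma spectral_sum_le (e : nat -> H) (l : nat -> R) N :
  (forall j, 0 <= l j /\ PH (e j) = (l j)%:C%C *: e j) ->
  (forall i j, i != j -> dot (e i) (e j) = 0) ->
  (forall j, nsq (e j) = 1 \/ (e j = 0 /\ l j = 0)) ->
  ((\sum_(j < N) l j)%:E <=
   \esum_(lam in [set lam : R | (0 < lam)%R]) (lam%:E * eigen_mult P lam))%E.
Proof.
move=> he eo en.
pose s := undup [seq l j | j <- iota 0 N & 0 < l j].
have s0 lam : lam \in s -> 0 < lam.
  by rewrite mem_undup => /mapP[j]; rewrite mem_filter => /andP[lj _] ->.
have us : uniq s by exact: undup_uniq.
have -> : \sum_(j < N) l j = \sum_(lam <- s) lam * \sum_(j < N) (l j == lam)%:R.
  under [RHS]eq_bigr do rewrite mulr_sumr; rewrite exchange_big/=.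
  apply: eq_bigr => j _; have [lj0 _] := he j.
  have [ljs|ljs] := boolP (l j \in s).
    rewrite (bigD1_seq (l j))//= eqxx mulr1 big1 ?addr0// => lam /negPf h.
    by rewrite eq_sym h mulr0.
  rewrite big1_seq => [|lam /andP[_ lams]]; last first.
    by case: eqVneq => [h|]; [rewrite h lams in ljs|rewrite mulr0].
  apply/le_anti; rewrite lj0 andbT leNgt; apply: contra ljs => lj.
  by rewrite mem_undup; apply: map_f; rewrite mem_filter lj mem_iota/=.
apply: esum_ge; exists [set` s].
  by split; [exact: finite_seq|exact: s0].
rewrite -fsbig_seq// -sumEFin big_seq [leRHS]big_seq; apply: lee_sum => lam lams.
rewrite EFinM; apply: lee_wpmul2l; first by rewrite lee_fin (ltW (s0 _ lams)).
pose js := [seq j <- iota 0 N | l j == lam].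
have -> : \sum_(j < N) (l j == lam)%:R = (size js)%:R :> R.
  rewrite size_filter -(big_mkord xpredT (fun j => (l j == lam)%:R)) /index_iota subn0.
  by elim: (iota 0 N) => [|j t IH]; rewrite ?big_nil// big_cons IH natrD.
rewrite /eigen_mult; apply: ereal_sup_ubound; exists (size js) => //; rewrite -/(eigen_set lam).
have jsP i : (i < size js)%N -> l (nth 0%N js i) = lam.
  by move=> ir; have := mem_nth 0%N ir; rewrite mem_filter => /andP[/eqP].
have ujs : uniq js by rewrite filter_uniq// iota_uniq.
apply: (@eigen_ge lam (size js) (fun i => e (nth 0%N js i))).
- by move=> i j ir jr ij; apply: eo; rewrite nth_uniq.
- move=> i ir; case: (en (nth 0%N js i)) => // -[_]; rewrite jsP// => l0.
  by have := s0 _ lams; rewrite l0 ltxx.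
- by move=> i ir; have [_ ->] := he (nth 0%N js i); rewrite jsP.
Qed.

End SingularValues.

End AbsoluteValue.

(** * Upper and lower estimates of the trace norm *)

Section TraceNorm.
Variables (R : realType) (n : nat).
Local Notation T := (Tn R n).
Local Notation Z := (Zn n).
Local Notation mZT := (@muZT R n).
Local Notation H := (l2t R n).
Local Notation dot := (@dotH R n).
Local Notation nrm := (nrm dot).
Local Notation nsq := (nsq dot).
Let ip := dotH_ip R n.
Let hf := ip_form ip.
Variable g : Z -> R[i].
Hypothesis g1 : (abn g < +oo)%E.
Variable F : Z * T -> R[i].
Hypothesis Fi : cintegrable mZT F.
Variables A P : (Z -> R[i]) -> (Z -> R[i]).
Hypothesis bA : bounded_op A.
Hypothesis cA : compact_op A.
Hypothesis hP : is_absop A P.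
Hypothesis AF : forall f h, l2 f -> l2 h ->
  dotl2 (A f) h = cint mZT (fun x => F x * stft g f x * (stft g h x)^*).

Let lg : l2 g := (abn_l2 g1).1.
Let AH := opH A.
Let PH := opH P.
Let bP : bounded_op P. Proof. by case: hP. Qed.
Local Notation S1P :=
  (\esum_(lam in [set lam : R | (0 < lam)%R]) (lam%:E * eigen_mult P lam))%E.
Local Notation Fn := (fine (\int[mZT]_x (cmod (F x))%:E)%E).

Definition gH (x : Z * T) : H := mkl2 (l2_tfshift x.1 x.2 lg).

Lemma stft_dot (f : H) x : stft g f x = dot f (gH x). Proof. by []. Qed.

Lemma nsq_gH x : nsq (gH x) = fine (sqn g).
Proof. by rewrite /nsq /dotH Re_dotl2 /= sqn_tfshift. Qed.

Lemma cmod_dotC (f h : H) : cmod (dot f h) = cmod (dot h f).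
Proof. by rewrite (hf_conj hf) cmodJ. Qed.

Lemma dot_selfC (f : H) : dot f f = (nsq f)%:C%C.
Proof. exact: (form_self hf). Qed.

(* The A (E i) / l i are orthogonal and shorter than 1 as well, so that
   l i * |E i|^2 = <A (E i), A (E i) / l i>, and Bessel applies to both families
   under the integral. *)
Lemma trace_bound (I : finType) (E : I -> H) (l : I -> R) :
  (forall i j, i != j -> dot (E i) (E j) = 0) -> (forall i, nsq (E i) <= 1) ->
  (forall i, 0 < l i) -> (forall i, PH (E i) = (l i)%:C%C *: E i) ->
  \sum_i l i * nsq (E i) <= Fn * fine (sqn g).
Proof.
move=> oE nE l0 PE.
have cR (a : R) : (a%:C%C : R[i])^* = a%:C%C by apply: eqRI; rewrite ?ReJ ?ImJ//= oppr0.
have dA i j : dot (AH (E i)) (AH (E j)) = (l i)%:C%C * ((l j)%:C%C * dot (E i) (E j)).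
  rewrite -(dot_PH bA hP) -/PH !PE (formZl hf) (formZr hf) cR //.
pose f i := ((l i)^-1)%:C%C *: AH (E i).
have lC i : (l i)%:C%C != 0 :> R[i] by rewrite -cmod_eq0 cmod_real normr_eq0 gt_eqF.
have lV i : ((l i)^-1)%:C%C = ((l i)%:C%C)^-1 :> R[i] by rewrite fmorphV.
have of_ i j : i != j -> dot (f i) (f j) = 0.
  by move=> ij; rewrite /f (formZl hf) (formZr hf) dA oE// !mulr0.
have nf i : nsq (f i) <= 1.
  have -> : nsq (f i) = nsq (E i); last exact: nE.
  apply: (@congr1 _ _ (@complex.Re R) (dot (f i) (f i)) (dot (E i) (E i))).
  rewrite /f (formZl hf) (formZr hf) dA cR lV; set d := dot _ _; have := lC i.
  by set a := (l i)%:C%C => a0; rewrite !mulKf.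
have tr i : dot (AH (E i)) (f i) = (l i * nsq (E i))%:C%C.
  rewrite /f (formZr hf) dA cR lV dot_selfC rmorphM/= mulKf//.
pose q i x := F x * stft g (E i) x * (stft g (f i) x)^*.
have qi i : cintegrable mZT (q i) by have [] := locop_dot g1 Fi (l2tP (E i)) (l2tP (f i)).
have Q : (\sum_i l i * nsq (E i))%:C%C = cint mZT (fun x => \sum_i q i x).
  rewrite cint_sum// rmorph_sum/=; apply: eq_bigr => i _.
  by rewrite -tr /AH opH_dot// /dotH AF//; exact: l2tP.
have s0 : 0 <= \sum_i l i * nsq (E i).
  by apply: sumr_ge0 => i _; rewrite mulr_ge0 ?(nsq_ge0 ip)// (ltW (l0 i)).
rewrite -[leLHS]ger0_norm// -cmod_real Q.
have mF := cintegrable_meas Fi.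
have Foo := cintegrable_lty Fi.
have F0 : (0 <= \int[mZT]_x (cmod (F x))%:E)%E by apply: integral_ge0; nonneg.
apply: cmod_cint_bound; first exact: cintegrable_sum.
have g0 : 0 <= fine (sqn g) by rewrite fine_ge0// sqn_ge0.
rewrite EFinM fineK ?ge0_fin_numE// muleC -gint_scale//; last 2 first.
- exact: cmeas_cmod.
- by nonneg.
apply: gint_le.
- by apply: cmeas_cmod; apply: cmeas_sum => i; exact: cintegrable_meas.
- by apply: measurable_funM => //; exact: cmeas_cmod.
- by nonneg.
move=> x; rewrite /q.
have -> : \sum_i F x * stft g (E i) x * (stft g (f i) x)^* =
   F x * \sum_i stft g (E i) x * (stft g (f i) x)^*.
  by rewrite mulr_sumr; apply: eq_bigr => i _; rewrite mulrA.
rewrite cmodM mulrC ler_wpM2r ?cmod_ge0//.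
apply: le_trans (cmod_sum _ _ _) _.
have bE := bessel ip oE (gH x) nE; have bf := bessel ip of_ (gH x) nf.
(* From a b <= (a^2 + b^2) / 2, so that each of the two Bessel sums contributes at most half of
   |g|_2^2. *)
have am i : cmod (stft g (E i) x * (stft g (f i) x)^*) <=
    2^-1 * (cmod (dot (gH x) (E i)) ^+ 2 + cmod (dot (gH x) (f i)) ^+ 2).
  rewrite cmodM cmodJ !stft_dot (cmod_dotC (E i)) (cmod_dotC (f i)).
  by set a := cmod _; set b := cmod _; have := sqr_ge0 (a - b); rewrite sqrrB => h; lra.
apply: le_trans (ler_sum _ (fun i _ => am i)) _; rewrite -mulr_sumr big_split.
rewrite -(nsq_gH x) mulrC ler_pdivrMr// mulr_natr mulr2n; exact: lerD.
Qed.

Lemma eigen_mult_le lam r : 0 < lam -> eigen_set P lam r -> lam * r%:R <= Fn * fine (sqn g).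
Proof.
move=> l0 /(eigen_family hP)[w [oo1 oN oP]].
have := @trace_bound 'I_r (fun i => w i) (fun=> lam) _ _ (fun=> l0) _.
have -> : \sum_(i < r) lam * nsq (w i) = lam * r%:R.
  rewrite (eq_bigr (fun=> lam)) => [|i _]; last by rewrite oN// mulr1.
  by rewrite sumr_const card_ord mulr_natr.
apply.
- by move=> i j ij; apply: oo1.
- by move=> i; rewrite oN.
- by move=> i; apply: oP.
Qed.

(** [trace_bound] limits the number of independent eigenvectors, so the supremum defining the
    multiplicity is a maximum. *)
Lemma eigen_mult_attained lam : 0 < lam -> exists2 r : nat,
  eigen_mult P lam = r%:R%:E & eigen_set P lam r.
Proof.
move=> l0; pose p r := `[< eigen_set P lam r >].
have p0 : exists r, p r.
  exists 0%N; apply/asboolP; exists (fun i _ => 0).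
  by split; [move=> c _ []|case].
pose M := (Num.truncn (Fn * fine (sqn g) / lam)).+1.
have pM r : p r -> (r <= M)%N.
  move=> /asboolP/(eigen_mult_le l0); rewrite mulrC -ler_pdivlMr// => h.
  by rewrite -(ler_nat R); apply: le_trans h _; exact/ltW/truncnS_gt.
have [r /asboolP pr rmax] := ex_maxnP p0 pM; exists r => //.
apply/le_anti/andP; split.
  by apply: ub_ereal_sup => _ [q hq <-]; rewrite lee_fin ler_nat; apply: rmax; exact/asboolP.
by apply: ereal_sup_ubound; exists r.
Qed.

Lemma trace_norm_le : (S1P <= (Fn * fine (sqn g))%:E)%E.
Proof.
have hex (lam : R) : exists ro : nat * (nat -> H), 0 < lam ->
    [/\ eigen_mult P lam = ro.1%:R%:E,
      forall i j, (i < ro.1)%N -> (j < ro.1)%N -> i != j -> dot (ro.2 i) (ro.2 j) = 0,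
      forall i, (i < ro.1)%N -> nsq (ro.2 i) = 1 &
      forall i, (i < ro.1)%N -> PH (ro.2 i) = lam%:C%C *: ro.2 i].
  have [l0|_] := boolP (0 < lam); last by exists (0%N, fun=> 0).
  have [r rE /(eigen_family hP)[w [h1 h2 h3]]] := eigen_mult_attained l0.
  by exists (r, w).
have [ro hro] := choice hex.
apply: ub_ereal_sup => _ [X [fX Xpos] <-].
have /finite_seqP[t Xt] := fX; pose s := undup t.
have us : uniq s by exact: undup_uniq.
have Xs : X = [set` s] by rewrite Xt; apply/seteqP; split=> a /=; rewrite mem_undup.
have s0 lam : lam \in s -> 0 < lam by move=> ls; apply: Xpos; rewrite Xs.
rewrite Xs -fsbig_seq//.
pose r lam := (ro lam).1.
have -> : (\sum_(lam <- s) lam%:E * eigen_mult P lam = (\sum_(lam <- s) lam * (r lam)%:R)%:E)%E.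
  rewrite -sumEFin big_seq [RHS]big_seq; apply: eq_bigr => lam /s0 l0.
  by have [-> _ _ _] := hro _ l0; rewrite EFinM.
rewrite lee_fin.
(* The eigenvectors of finitely many eigenvalues are arranged in a rectangle with M columns, M being
   the largest multiplicity. Shorter rows are padded with 0, which [trace_bound] admits. *)
pose M := (\max_(lam <- s) r lam)%N.
have rM lam : lam \in s -> (r lam <= M)%N.
  by move=> ls; rewrite /M (big_rem lam)//= leq_maxl.
pose sl (i : 'I_(size s)) := nth 0 s i.
have sls i : sl i \in s by exact: mem_nth.
pose E (ij : 'I_(size s) * 'I_M) : H :=
  if (ij.2 < r (sl ij.1))%N then (ro (sl ij.1)).2 ij.2 else 0.
pose l (ij : 'I_(size s) * 'I_M) := sl ij.1.
have PE ij : PH (E ij) = (l ij)%:C%C *: E ij.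
  rewrite /E /l; case: ifP => [h|_]; last by rewrite scaler0 /PH (Hlin0 (opH_lin bP)).
  by have [_ _ _] := hro _ (s0 _ (sls ij.1)); exact.
have h := @trace_bound _ E l _ _ _ PE.
apply: (@le_trans _ _ (\sum_ij l ij * nsq (E ij))); last first.
  apply: h.
  - move=> [i j] [i' j'] ne; have [si|si] := eqVneq (sl i) (sl i'); last first.
      exact: (eigen_orth hP (PE (i, j)) (PE (i', j'))).
    have ii : i = i' by apply/val_inj/eqP; rewrite -(nth_uniq 0 (ltn_ord i) (ltn_ord i') us); apply/eqP.
    rewrite -ii in ne *; rewrite /E/=; case: ifP => [h1|_]; last by rewrite (form0l hf).
    case: ifP => [h2|_]; last by rewrite (form0r hf).
    have [_ oo1 _ _] := hro _ (s0 _ (sls i)); apply: oo1 => //.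
    by apply: contra ne => /eqP jj; apply/eqP; congr pair; apply: val_inj.
  - move=> ij; rewrite /E; case: ifP => [h1|_]; last by rewrite (nsq0 ip).
    by have [_ _ nn _] := hro _ (s0 _ (sls ij.1)); rewrite (nn _ h1).
  - by move=> ij; exact: (s0 _ (sls ij.1)).
rewrite -(pair_bigA _ (fun i j => l (i, j) * nsq (E (i, j))))/=.
rewrite (big_nth 0) big_mkord; apply: ler_sum => i _.
rewrite -mulr_sumr ler_wpM2l ?(ltW (s0 _ (sls i)))//.
have -> : \sum_(j < M) nsq (E (i, j)) = \sum_(j < M) (j < r (sl i))%:R.
  apply: eq_bigr => j _; rewrite /E/=; case: ifP => [h1|_]; last exact: (nsq0 ip).
  by have [_ _ nn _] := hro _ (s0 _ (sls i)); exact: nn.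
have cnt m q : (\sum_(j < m) (j < q) = minn m q)%N.
  elim: m => [|m IH]; first by rewrite big_ord0 min0n.
  by rewrite big_ord_recr/= IH; lia.
by rewrite -natr_sum cnt (minn_idPr (rM _ (sls i))).
Qed.

Lemma int_cmod_sum (q : nat -> Z * T -> R[i]) (B : nat -> R) N :
  (forall j, cmeasurable (q j)) ->
  (forall j, (\int[mZT]_x (cmod (q j x))%:E <= (B j)%:E)%E) ->
  (\int[mZT]_x (cmod (\sum_(j < N) q j x))%:E <= (\sum_(j < N) B j)%:E)%E.
Proof.
move=> mq qB; elim: N => [|N IH].
  rewrite big_ord0; under eq_integral do rewrite big_ord0 cmod0.
  by rewrite integral0.
have ms : cmeasurable (fun x => \sum_(j < N) q j x) by apply: cmeas_sum => j; exact: mq.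
rewrite big_ord_recr EFinD; apply: le_trans (leeD IH (qB N)).
rewrite -gint_add; [|exact: cmeas_cmod|exact: cmeas_cmod|by nonneg|by nonneg].
apply: gint_le; [| |by nonneg|].
- have := cmeas_cmod (cmeasD ms (mq N)); congr measurable_fun; apply/funext => x.
  by rewrite big_ord_recr.
- by apply: measurable_funD; exact: cmeas_cmod.
by move=> x; rewrite big_ord_recr; exact: cmodD.
Qed.

(** The weighted inequality a b <= (l a^2 + b^2 / l) / 2 for l > 0. By Moyal the integrals of a^2
    and b^2 are |g|_2^2 and l^2 |g|_2^2, because |A e| = |P e| = l, so the two halves are equal. *)
Lemma singular_term_le (e : H) (l : R) : 0 <= l -> PH e = l%:C%C *: e ->
  nsq e = 1 \/ (e = 0 /\ l = 0) ->
  (\int[mZT]_x (cmod (dot (gH x) e * dot (AH e) (gH x)))%:E <= (fine (sqn g) * l)%:E)%E.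
Proof.
move=> l0 Pe ne.
have nA : nsq (AH e) = l ^+ 2 * nsq e.
  by rewrite -(nsq_PH bA hP) -/PH Pe (nsqZ ip) cmod_real ger0_norm.
have [lz|lz] := eqVneq l 0.
  have A0 : AH e = 0.
    by apply: (nrm_eq0 ip); rewrite /nrm nA lz expr0n mul0r sqrtr0.
  rewrite lz mulr0; under eq_integral do rewrite A0 (form0l hf) mulr0 cmod0.
  by rewrite integral0.
have lp : 0 < l by rewrite lt_neqAle eq_sym lz.
have n1 : nsq e = 1 by case: ne => // -[_ h]; rewrite h eqxx in lz.
rewrite n1 mulr1 in nA.
have m1 := cmeas_cmod (stft_cmeas g (e : Z -> R[i])).
have m2 := cmeas_cmod (stft_cmeas g (AH e : Z -> R[i])).
have sgE : (sqn g = (fine (sqn g))%:E)%E by rewrite fineK//; exact: l2_sqn_fin.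
have M1 : (\int[mZT]_x (cmod (stft g e x) ^+ 2)%:E = (fine (sqn g))%:E)%E.
  by rewrite moyal//; [rewrite nsqE n1 mul1e|exact: l2tP].
have M2 : (\int[mZT]_x (cmod (stft g (AH e) x) ^+ 2)%:E = (l ^+ 2 * fine (sqn g))%:E)%E.
  by rewrite moyal//; [rewrite nsqE nA (EFinM (l ^+ 2)) -sgE|exact: l2tP].
have ms1 : measurable_fun setT (fun x => cmod (stft g e x) ^+ 2) by exact: measurable_funX.
have ms2 : measurable_fun setT (fun x => cmod (stft g (AH e) x) ^+ 2) by exact: measurable_funX.
have lv0 : 0 <= l^-1 by rewrite invr_ge0.
apply: (@le_trans _ _ (\int[mZT]_x (2^-1 * (l * cmod (stft g e x) ^+ 2 +
    l^-1 * cmod (stft g (AH e) x) ^+ 2))%:E)%E).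
  apply: gint_le.
  - have := cmeas_cmod (cmeasM (cmeasJ (stft_cmeas g (e : Z -> R[i])))
      (stft_cmeas g (AH e : Z -> R[i]))).
    congr measurable_fun; apply/funext => x; rewrite !stft_dot.
    by rewrite -(hf_conj hf).
  - apply: measurable_funM => //; apply: measurable_funD; exact: measurable_funM.
  - by nonneg.
  move=> x; rewrite cmodM (cmod_dotC (gH x)) -!stft_dot.
  set a := cmod _; set b := cmod _.
  have := sqr_ge0 (l * a - b); rewrite sqrrB exprMn => h.
  have -> : 2^-1 * (l * a ^+ 2 + l^-1 * b ^+ 2) =
      (2^-1 * l^-1) * (l ^+ 2 * a ^+ 2 + b ^+ 2) by field.
  have -> : a * b = (2^-1 * l^-1) * (l * a * b *+ 2) by field.
  apply: ler_wpM2l; first by rewrite mulr_ge0.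
  by rewrite -subr_ge0 addrAC.
rewrite gint_scale//; last 2 first.
- by apply: measurable_funD; exact: measurable_funM.
- by move=> x; rewrite addr_ge0// mulr_ge0 ?sqr_ge0.
rewrite gint_add//; [|exact: measurable_funM|exact: measurable_funM|
  by move=> x; rewrite mulr_ge0 ?sqr_ge0|by move=> x; rewrite mulr_ge0 ?sqr_ge0].
rewrite !gint_scale//; [|by move=> x; exact: sqr_ge0|by move=> x; exact: sqr_ge0].
rewrite M1 M2 [leLHS](_ : _ = (2^-1 * (l * fine (sqn g) + l^-1 * (l ^+ 2 * fine (sqn g))))%:E)%E//.
rewrite lee_fin le_eqVlt; apply/orP; left; apply/eqP; field.
exact: lz.
Qed.

(** With f = M_w T_m g and p_N the truncated expansion of f, the remainder is at most |P (f - p_N)|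
    |f| <= l_N |f|^2, which gives pointwise convergence. The L^1-norms of the partial sums are
    bounded through the singular values, and Fatou's lemma concludes. *)
Lemma lower_symbol_le :
  (\int[mZT]_x (cmod (lower_symbol A g x))%:E <= sqn g * S1P)%E.
Proof.
have posP : Hpos dot PH by move=> f; have := PH_pos hP f; rewrite complex_ge0P => /andP[].
have [e [l [he eo en [_ lcv] hN]]] := spectral_theorem ip (opH_lin bP)
  (PH_sym hP) posP (opH_bnd bP) (PH_compact bA cA hP).
pose q j x := dot (gH x) (e j) * dot (AH (e j)) (gH x).
have mq j : cmeasurable (q j).
  have := cmeasM (cmeasJ (stft_cmeas g (e j : Z -> R[i]))) (stft_cmeas g (AH (e j) : Z -> R[i])).
  by congr cmeasurable; apply/funext => x; rewrite !stft_dot -(hf_conj hf).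
have qN x N : dot (AH (gH x)) (gH x) - \sum_(j < N) q j x =
    dot (AH (gH x - \sum_(j < N) dot (gH x) (e j) *: e j)) (gH x).
  rewrite /AH (HlinB (opH_lin bA)) (Hlin_sum (opH_lin bA)) (formBl hf) (form_suml hf).
  congr (_ - _); apply: eq_bigr => j _.
  by rewrite (HlinZ (opH_lin bA)) (formZl hf).
apply: (fatou_bound (h_ := fun N x => cmod (\sum_(j < N) q j x))).
- by move=> N; apply: cmeas_cmod; apply: cmeas_sum => j; exact: mq.
- by nonneg.
- move=> x; apply: cvg_cmod.
  have -> : lower_symbol A g x = dot (AH (gH x)) (gH x) by rewrite /AH opH_dot.
  have := cvg0_scale (nrm (gH x) ^+ 2) lcv; apply: cvg0_le => N.
  rewrite cmod_ge0 andTb cmodC qN; apply: le_trans (dot_CS ip _ _) _.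
  rewrite -(nrm_PH bA hP) expr2 [leRHS]mulrC mulrA ler_wpM2r ?(nrm_ge0 dot)//.
move=> N; apply: (@le_trans _ _ (fine (sqn g) * \sum_(j < N) l j)%:E).
  rewrite mulr_sumr; apply: (int_cmod_sum (B := fun j => fine (sqn g) * l j)) => // j.
  by have [l0 Pe] := he j; exact: singular_term_le (en j).
rewrite EFinM fineK; last exact: l2_sqn_fin.
apply: lee_wpmul2l; first exact: sqn_ge0.
by apply: (spectral_sum_le hP N he eo en).
Qed.

End TraceNorm.

Section LocopTraceClass.
Variables (R : realType) (n : nat).
Local Notation T := (Tn R n).
Local Notation Z := (Zn n).
Local Notation mZT := (@muZT R n).
Variable g : Z -> R[i].
Hypothesis g1 : (abn g < +oo)%E.
Variable F : Z * T -> R[i].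
Hypothesis Fi : cintegrable mZT F.
Variable A : (Z -> R[i]) -> (Z -> R[i]).
Hypothesis bA : bounded_op A.
Hypothesis AL : forall f, l2 f -> A f = locop g F f.

Lemma locop_ext_compact : compact_op A.
Proof.
move=> f c fc; have [s [h [sm lh hs]]] := locop_compact g1 Fi fc.
exists s, h; split=> //.
have -> : (fun i => lpnorm (@muZ R n) 2%:E (fun k => A (f (s i)) k - h k)) =
    (fun i => lpnorm (@muZ R n) 2%:E (fun k => locop g F (f (s i)) k - h k)).
  by apply/funext => i; rewrite AL//; have [] := fc (s i).
exact: hs.
Qed.

Lemma locop_ext_absop : is_absop A (absop A).
Proof.
have aA : adjoint_op A (locop g (fun x => (F x)^*)).
  have [bB aB] := locop_adjoint g1 Fi; split=> // f h lf lh.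
  by rewrite AL// aB.
have ex := absop_exists bA locop_ext_compact aA.
by rewrite /absop; case: pselect => // ex'; case: cid.
Qed.

Let AF f h (lf : l2 f) (lh : l2 h) :
  dotl2 (A f) h = cint mZT (fun x => F x * stft g f x * (stft g h x)^*).
Proof. by rewrite AL//; have [] := locop_dot g1 Fi lf lh. Qed.

Lemma locop_S1norm_le :
  (S1norm A <= (fine (\int[mZT]_x (cmod (F x))%:E)%E * fine (sqn g))%:E)%E.
Proof. exact: (trace_norm_le g1 Fi bA locop_ext_absop AF). Qed.

Lemma locop_symbol_le :
  (\int[mZT]_x (cmod (lower_symbol A g x))%:E <= sqn g * S1norm A)%E.
Proof. exact: (lower_symbol_le g1 bA locop_ext_compact locop_ext_absop). Qed.

End LocopTraceClass.

(** * The constant of the windows and the final estimate *)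

Section WindowNormalization.
Variables (R : realType) (n : nat).
Local Notation Z := (Zn n).
Local Notation T := (Tn R n).
Variables (phi : Z -> R[i]) (Phi : Z * T -> R[i]).
Hypothesis hPhi : schwartzZT Phi.

Definition supmod : R := sup [set cmod (Phi y) | y in [set: Z * T]].

Lemma supmod_has_sup : has_sup [set cmod (Phi y) | y in [set: Z * T]].
Proof.
have [B B0 hB] := schwartz_bounded hPhi.
split; first by exists (cmod (Phi (0, [tuple 0 | i < n]))), (0, [tuple 0 | i < n]).
by exists B => _ [y _ <-].
Qed.

Lemma le_supmod y : cmod (Phi y) <= supmod.
Proof. by apply: (sup_upper_bound supmod_has_sup); exists y. Qed.

(** The inversion provides the estimate only where Phi does not vanish; elsewhere K >= 0
    suffices. *)
Lemma supmod_mul_le (s K : R) : 0 <= s -> (forall y, Phi y != 0 -> cmod (Phi y) * s <= K) ->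
  0 <= K -> supmod * s <= K.
Proof.
rewrite le_eqVlt => /predU1P[<-|s0] h K0; first by rewrite mulr0.
rewrite -ler_pdivlMr//; apply: ge_sup; first by case: supmod_has_sup.
move=> _ [y _ <-]; rewrite ler_pdivlMr//; have [->|y0] := eqVneq (Phi y) 0; last exact: h.
by rewrite cmod0 mul0r.
Qed.

Lemma supmod_ge1 : (1 <= lpnorm (@muZT R n) +oo%E Phi)%E -> 1 <= supmod.
Proof.
(* If the whole space had measure 0, the norm would be 0 by convention, against the hypothesis. *)
rewrite /lpnorm unlock /=; case: ifP => _; last by rewrite lee_fin ler10.
move=> h; rewrite -lee_fin; apply: le_trans h _; apply/ess_supP.
by apply: aeW => y /=; rewrite lee_fin ger0_norm ?cmod_ge0// le_supmod.
Qed.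

Lemma sqn_normalized : (1 <= lpnorm (@muZ R n) 2%:E phi)%E -> (fine (sqn phi))^-1 <= 1.
Proof.
have [/l2P lphi|] := ltP (sqn phi) +oo%E; last first.
  (* [fine] sends an infinite [sqn phi] to 0, and the inverse of 0 is 0. *)
  by rewrite leye_eq => /eqP -> _; rewrite /= invr0.
rewrite lp2_sqrt// lee_fin => h.
have s0 : 0 <= fine (sqn phi) by rewrite fine_ge0// sqn_ge0.
have s1 : 1 <= fine (sqn phi).
  by rewrite -(sqr_sqrtr s0) expr_ge1.
by rewrite invf_le1// (lt_le_trans ltr01).
Qed.

(** The first factor makes |G|_2^2 <= c |W|_1^2 follow from [window_bound]. The second enters the
    upper bound, where the supremum over window values leaves |V|_1 |G|_2^2 / sup |Phi|. The maxima
    with 1 give c = 1 for normalized windows. *)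
Definition window_const : R :=
  Num.max 1 (fine (sqn phi))^-1 * Num.max 1 supmod^-1.

Lemma window_const_gt0 : 0 < window_const.
Proof. by rewrite mulr_gt0// lt_max ltr01. Qed.

Lemma window_const1 : normalized_windows phi Phi -> window_const = 1.
Proof.
move=> [h1 h2]; have s1 := supmod_ge1 h2.
have q1 : supmod^-1 <= 1 by rewrite invf_le1// (lt_le_trans ltr01).
by rewrite /window_const (max_idPl (sqn_normalized h1)) (max_idPl q1) mulr1.
Qed.

End WindowNormalization.

Theorem theorem4p9 (R : realType) (n : nat)
    (phi : Zn n -> R[i]) (Phi : Zn n * Tn R n -> R[i])
    (hphi : schwartzZ phi) (phi0 : exists k, phi k != 0)
    (hPhi : schwartzZT Phi) (Phi0 : exists y, Phi y != 0) :
  exists c : R, [/\ 0 < c, normalized_windows phi Phi -> c = 1 &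
  forall (vsig : (Zn n * Tn R n -> R[i]) -> R[i]) (g : (Zn n -> R[i]) -> R[i]),
    inMpZT Phi 1%:E vsig -> inMpZ phi 1%:E g ->
    (exists2 psi, schwartzZ psi & g psi != 0) ->
    (exists L, is_locop vsig (seq_of g) (seq_of g) L) /\
    forall L, is_locop vsig (seq_of g) (seq_of g) L ->
      inS1 L /\
      ((c%:E * MpZnorm phi 1%:E g ^+ 2)^-1 *
         lpnorm (@muZT R n) 1%:E (lower_symbol L (seq_of g))
       <= S1norm L
       <= c%:E * MpZnorm phi 1%:E g ^+ 2 * MpZTnorm Phi 1%:E vsig)%E].
Proof.
exists (window_const phi Phi); split; [exact: window_const_gt0|exact: window_const1|].
move=> u v [hu hV] [hv hW] [psi Spsi vpsi]; set G := seq_of v.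
have [k0 pk0] := phi0.
have Goo : (abn G < +oo)%E by exact: (seq_of_abn hv hphi hW pk0).
have [k1 Gk1] := seq_of_neq0 hv Spsi Goo vpsi.
have phioo : (abn phi < +oo)%E by exact: (window_abn hv hphi hW Gk1).
have [lG _] := abn_l2 Goo; have [lphi _] := abn_l2 phioo.
have sqn_gt0 (f : Zn n -> R[i]) k : l2 f -> f k != 0 -> 0 < fine (sqn f).
  move=> lf fk; rewrite fine_gt0//; apply/andP; split; last exact/l2P.
  apply: lt_le_trans (intZ_ge k (h := fun k => (cmod (f k) ^+ 2)%:E) _); last by nonneg.
  by rewrite lte_fin exprn_gt0// cmod_gt0.
have sG0 := sqn_gt0 _ _ lG Gk1; have sp0 := sqn_gt0 _ _ lphi pk0.
have := window_bound hv hphi hW lG lphi Goo.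
rewrite -/(MpZnorm phi 1%:E v) => wb.
set N := MpZnorm phi 1%:E v in wb *.
have NE : N = (fine N)%:E.
  by rewrite fineK// ge0_fin_numE; [case: hW|exact: Lnorm_ge0].
set W := MpZTnorm Phi 1%:E u.
have WE : W = (fine W)%:E.
  by rewrite fineK// ge0_fin_numE; [case: hV|exact: Lnorm_ge0].
have W0 : 0 <= fine W by rewrite fine_ge0// Lnorm_ge0.
have rep (z : Zn n * Tn R n) : Phi z != 0 -> exists F, [/\ represents (@muZT R n) (@schwartzZT R n) u F,
    cintegrable (@muZT R n) F &
    cmod (Phi z) * fine (\int[@muZT R n]_x (cmod (F x))%:E)%E <= fine W].
  case: z => p zeta z0; exists (symF u Phi p zeta); split.
  - exact: (symF_represents hu hPhi hV z0).
  - exact: (symF_integrable hPhi hV z0).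
  have Fi := cintegrable_lty (symF_integrable hPhi hV z0).
  have := symF_norm hPhi hV z0; rewrite -/(MpZTnorm Phi 1%:E u) -/W WE.
  move=> h; rewrite -lee_fin EFinM fineK//.
  by rewrite ge0_fin_numE//; apply: integral_ge0; nonneg.
have [z0 Pz0] := Phi0.
split.
  have [F [rF iF _]] := rep _ Pz0.
  by exists (locop G F); exact: locop_is_locop.
move=> L hL; have bL : bounded_op L by case: hL.
have LE F : represents (@muZT R n) (@schwartzZT R n) u F -> cintegrable (@muZT R n) F ->
    forall f, l2 f -> L f = locop G F f.
  by move=> rF iF; exact: (locop_unique Goo rF iF hL).
have [F [rF iF hF]] := rep _ Pz0.
have Soo : (S1norm L < +oo)%E.
  exact: le_lt_trans (locop_S1norm_le Goo iF bL (LE F rF iF)) (ltry _).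
have S0 : (0 <= S1norm L)%E.
  apply: esum_ge0 => lam /= l0; apply: mule_ge0; first by rewrite lee_fin ltW.
  apply: ereal_sup_ubound; exists 0%N => //; exists (fun _ _ => 0).
  by split; [move=> c _ []|case].
split; first by split=> //; exact: (locop_ext_compact Goo iF (LE F rF iF)).
have SE : S1norm L = (fine (S1norm L))%:E by rewrite fineK// ge0_fin_numE.
set s := fine (S1norm L) in SE.
have s0 : 0 <= s by rewrite fine_ge0.
(* L is fixed while the representing function varies with y, so the pointwise estimates combine into
   one for the supremum. *)
have sup_le : supmod Phi * s <= fine W * fine (sqn G).
  apply: supmod_mul_le => // [y y0|]; last by rewrite mulr_ge0// ltW.
  have [F' [rF' iF' hF']] := rep _ y0.
  have := locop_S1norm_le Goo iF' bL (LE F' rF' iF'); rewrite SE lee_fin => h.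
  apply: le_trans (ler_wpM2l (cmod_ge0 _) h) _.
  by rewrite mulrA ler_wpM2r// ltW.
have b0 : 0 < supmod Phi.
  by apply: lt_le_trans (le_supmod hPhi z0); rewrite cmod_gt0.
have wb' : fine (sqn G) * fine (sqn phi) <= fine N ^+ 2.
  by rewrite -lee_fin EFinM !fineK ?l2_sqn_fin// EFin_expe -NE.
set c := window_const phi Phi.
have c1 : 1 <= Num.max 1 (supmod Phi)^-1 by rewrite le_max lexx.
have c2 : 0 <= Num.max 1 (fine (sqn phi))^-1 by rewrite le_max ler01.
have cG : fine (sqn G) <= c * fine N ^+ 2.
  have h : fine (sqn G) <= Num.max 1 (fine (sqn phi))^-1 * fine N ^+ 2.
    apply: (@le_trans _ _ ((fine (sqn phi))^-1 * fine N ^+ 2)).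
      by rewrite mulrC ler_pdivlMr.
    by rewrite ler_wpM2r ?sqr_ge0// le_max lexx orbT.
  apply: le_trans h _; rewrite ler_wpM2r ?sqr_ge0// /c /window_const.
  by rewrite ler_peMr.
have cN0 : 0 < c * fine N ^+ 2 by exact: lt_le_trans sG0 cG.
rewrite lp1E SE NE WE -EFin_expe -!EFinM.
apply/andP; split.
  rewrite inver gt_eqF// lee_pdivrMl//.
  apply: le_trans (locop_symbol_le Goo iF bL (LE F rF iF)) _.
  rewrite SE -[sqn G]fineK ?l2_sqn_fin// -EFinM lee_fin ler_wpM2r//.
rewrite lee_fin.
apply: (@le_trans _ _ ((supmod Phi)^-1 * (fine W * fine (sqn G)))).
  by rewrite mulrC ler_pdivlMr// mulrC.
apply: (@le_trans _ _ ((supmod Phi)^-1 * (fine W * ((fine (sqn phi))^-1 * fine N ^+ 2)))).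
  rewrite ler_wpM2l ?invr_ge0 ?(ltW b0)// ler_wpM2l//.
  by rewrite mulrC ler_pdivlMr.
have -> : (supmod Phi)^-1 * (fine W * ((fine (sqn phi))^-1 * fine N ^+ 2)) =
    ((fine (sqn phi))^-1 * (supmod Phi)^-1) * fine N ^+ 2 * fine W by ring.
rewrite ler_wpM2r// ler_wpM2r ?sqr_ge0// /c /window_const.
apply: ler_pM; rewrite ?invr_ge0 ?(ltW sp0) ?(ltW b0)//.
  by rewrite le_max lexx orbT.
by rewrite le_max lexx orbT.
Qed.
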